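(* Fix $R\subset V$, ordered endpoint pairs $(a_i,b_i)_{1\le i\le r}$ with $\mathcal G_R(a_i,b_i)>0$, and $0\le\lambda\le1$. Let $\omega_i:a_i\to b_i$ be independent normalized random walks in $R$, and let $\Omega^{(0)}=(\omega_1^\lambda,\dots,\omega_r^\lambda)$ be the output of the Construction Algorithm with parameter $\lambda$ applied to $(\omega_1,\dots,\omega_r)$ in $R$. Sample an independent random-walk loop soup $\mathcal L_R^\lambda$ in $R$ with intensity $\lambda$. Then the output of the Recovery Algorithm applied to $\Omega^{(0)}$ and $\mathcal L_R^\lambda$ has the same joint law as $(\omega_1,\dots,\omega_r)$.
   Context: Setting. $V$ is a finite set, $Q$ a nonnegative substochastic matrix on $V$ with spectral radius $<1$; $\mathcal G_R=(I-Q_R)^{-1}$ with $Q_R$ the principal submatrix. $q(\xi)$ is the product of the edge weights of a directed path/loop $\xi$ and $\mathrm{supp}(\xi)$ its vertex set. A normalized random walk $\omega:a\to b$ in $R$ is a random directed path in $R$ (length zero allowed) with $\mathbb P[\omega]=q(\omega)/\mathcal G_R(a,b)$. The intensity-$\lambda$ random-walk loop soup in $R$ is the Poisson process on directed loops modulo cyclic shift with intensity $\lambda$ times the image of the rooted measure giving weight $\frac1n\prod_{i<n}Q_{x_ix_{i+1}}$ to $(x_0,\dots,x_n=x_0)$ in $R$, $n\ge1$. For real $x\ge0$: $(x)^{\overline0}=1$, $(x)^{\overline n}=x(x+1)\cdots(x+n-1)$. Records and entangled multipath loop-erasure. Chronological loop erasure of a directed path $\omega$ gives $P(\omega)=(\eta;\ell_1,\dots,\ell_m)$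 with $\eta$ the loop erasure and $\ell_k$ the erased simple directed loops (including those of length one), in erasure order, identified under cyclic shift but not reversal, repeated copies distinguished. A record is a tuple of this form modulo adjacent exchanges of simple loops with disjoint supports; $\prec$ is the transitive closure of $\ell_i\prec\ell_j$ ($i<j$, intersecting supports) and $\ell_i\prec\eta$ (intersecting supports); a record is legal if all $\ell_i\prec\eta$. $\omega\mapsto P(\omega)$ is a bijection between directed paths and legal records. $\mathrm{supp}(P)=\mathrm{supp}(\eta)\cup\bigcup_k\mathrm{supp}(\ell_k)$. For $A\subset R$, adjoin $A\prec\ell_k$ whenever $A\cap\mathrm{supp}(\ell_k)\ne\varnothing$ and take the transitive closure; $\Phi_A(P)$ retains $\eta$ and exactly the loops $\ell$ with $A\prec\ell$. For directed paths $(\omega_1,\dots,\omega_r)$ put $H_i=P(\omega_i)$, $C_0=\varnothing$, $P_i=\Phi_{C_{i-1}}(H_i)$, $C_i=C_{i-1}\cup\mathrm{supp}(P_i)$, and let $\gamma_i$ be the directed path with record $P_i$; $(\gamma_1,\dots,\gamma_r)$ is the entangled multipath loop-erasure, of range $C_r$. Lists at first-visit times. For $A\subset R$ and a legal record $H$ in $R$ with $P=\Phi_A(H)$ and corresponding path $\gamma$, list $\mathrm{supp}(P)\setminus A$ as $u_1,\dots,u_m$ in first-visit order along $\gamma$, let $t_j$ be the first-visit time of $u_j$ and $D_j=R\setminus(A\cup\{u_1,\dots,u_{j-1}\})$. There are unique ordered lists $(\ell_{j,s})_{1\le s\le n_j}$ of loops in $D_j$ from $u_j$ to $u_j$ with no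 intermediate visit to $u_j$ whose insertion in $\gamma$ at the times $t_j$ (replacing that visit to $u_j$ by the concatenation of the list) reconstructs the path of $H$. For a tuple $(\omega_i)$ these lists are taken successively with $A=C_{i-1}$, $H=H_i$. Construction Algorithm (input: an ordered tuple $(\omega_1,\dots,\omega_r)$ of directed paths in $R$). (1) Put $H_i=P(\omega_i)$, $C_0=\varnothing$, $P_i=\Phi_{C_{i-1}}(H_i)$ and $C_i=C_{i-1}\cup\mathrm{supp}(P_i)$ for $1\le i\le r$, let $\gamma_i$ be the directed path with record $P_i$, and put $S=C_r$, $B=R\setminus S$. (2) At each first-visit time let $\ell_1,\dots,\ell_d$ be its ordered list; independently at different first-visit times choose $N_0\in\{0,\dots,d\}$ with $\mathbb P[N_0=k]=\frac{(\lambda)^{\overline k}}{k!}\frac{(1-\lambda)^{\overline{d-k}}}{(d-k)!}$; delete $\ell_1,\dots,\ell_{N_0}$ and retain the others. (3) For every retained loop list, in time order, all maximal segments $x,b_0,\dots,b_n,y$ with $x,y\in S$, $b_0,\dots,b_n\in B$, $n\ge0$, and view $(b_0,\dots,b_n)$ as a directed path in $B$, labelled $(i,t,h,s)$: $i$ the index of the path $\gamma_i$, $t$ the first-visit time at which the loop is attached, $h$ the index of the loop in its ordered list, $s$ the starting time of the segment within the loop. Order these paths lexicographically by label, giving $(\zeta_1,\dots,\zeta_N)$ (portions of retained loops in $S$ are unchanged). (4) If $N>0$, apply the algorithm recursively to $(\zeta_1,\dots,\zeta_N)$ in $B$ and replace each $\zeta_j$ by the returned path $\zeta_j^\lambda$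 at its recorded position; if $N=0$ make no recursive call. (5) Insert the resulting retained loops, in their recorded order, at the corresponding first-visit times of the $\gamma_i$. Output: the tuple $(\omega_1^\lambda,\dots,\omega_r^\lambda)$. Recursive layers of an output $\Omega^{(0)}$. Set $R_0=R$. Given the tuple $\Omega^{(n)}$ in $R_n$, let $\boldsymbol\gamma^{(n)}=(\gamma^{(n)}_1,\dots,\gamma^{(n)}_{r_n})$ be its entangled multipath loop-erasure (in $R_n$), $S_n=\bigcup_i\mathrm{supp}(\gamma^{(n)}_i)$, $R_{n+1}=R_n\setminus S_n$; form the ordered lists of loops at the first-visit times of $\boldsymbol\gamma^{(n)}$, and let $\Omega^{(n+1)}$ be the ordered tuple (ordered lexicographically by the labels $(i,t,h,s)$ described in step (3) of the Construction Algorithm) of all maximal subpaths of these loops lying in $R_{n+1}$, with their recorded positions. If $\Omega^{(n+1)}$ is empty, set $L=n$ and stop. Let $S_{\lambda,\times}=\bigcup_{n=0}^LS_n$, which equals $\bigcup_i\mathrm{supp}(\omega_i^\lambda)$. Recovery Algorithm (input: $\Omega^{(0)}$ and $\mathcal L_R^\lambda$). (1) Recover the layers $0\le n\le L$. (2) For each $\ell\in\mathcal L_R^\lambda$ intersecting $S_{\lambda,\times}$, let $n$ be the smallest index with $\ell\cap S_n\neq\varnothing$; within layer $n$ take the smallest path index $i$ for which $\ell$ meets $\gamma_i^{(n)}$, then the earliest path time $t$ at which it is met. If $\ell$ visits $\gamma_i^{(n)}(t)$ more than once, root it uniformly at one of those visits. At each fixed $(n,i,t)$ order the assigned rooted loops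 by an independent uniform permutation. (3) Process layers $L,L-1,\dots,0$: at each first-visit time, prepend the assigned rooted loops (cut at their successive returns to the root), in the chosen order, to the ordered list of loops already there, and insert the resulting list. After completing layer $n>0$, substitute the resulting paths into their recorded positions in the loops of layer $n-1$. Output: the directed paths obtained at layer $0$. *)

(* Defs.v *)
From HB Require Import structures.
From mathcomp Require Import all_boot all_order all_algebra perm.
From mathcomp Require Import finmap multiset complex.
From mathcomp Require Import all_classical all_reals all_analysis.

Set Implicit Arguments.
Unset Strict Implicit.
Unset Printing Implicit Defensive.

Import Order.TTheory GRing.Theory Num.Theory.

Local Open Scope quotient_scope.
Local Open Scope ring_scope.

(* A directed path (x_0, ..., x_n) is the sequence of its vertices [:: x_0; ...; x_n]
   (length zero: one vertex).  A rooted directed loop (x_0, ..., x_n = x_0) is the sequence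
   [:: x_0; ...; x_{n-1}], the final return to the root being omitted; its length is the
   size of the sequence. *)

Definition cyclic_shift (V : finType) : rel (seq V) :=
  fun s t => [exists k : 'I_(size s).+1, rot k s == t].

Lemma cyclic_shift_refl (V : finType) : reflexive (@cyclic_shift V).
Proof. by move=> s; apply/existsP; exists ord0; rewrite rot0. Qed.

Lemma cyclic_shift_sym (V : finType) : symmetric (@cyclic_shift V).
Proof.
suff H s t : @cyclic_shift V s t -> cyclic_shift t s.
  by move=> s t; apply/idP/idP; apply: H.
move=> /existsP[[k hk] /eqP /= <-].
apply/existsP; have hk' : (size s - k < (size (rot k s)).+1)%N.
  by rewrite size_rot ltnS leq_subr.
by exists (Ordinal hk'); apply/eqP; rewrite /= -{1}(size_rot k s); exact: rotK.
Qed.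

Lemma cyclic_shift_trans (V : finType) : transitive (@cyclic_shift V).
Proof.
move=> t s u /existsP[[k hk] /eqP /= <-] /existsP[[m hm] /eqP /= <-].
have hm' : (m <= size s)%N by move: hm; rewrite size_rot ltnS.
apply/existsP; rewrite rot_add_mod //.
set j := (if _ then _ else _).
have hj : (j < (size s).+1)%N.
  rewrite ltnS /j; case: ifP => // _.
  by rewrite leq_subLR leq_add.
by exists (Ordinal hj).
Qed.

Canonical cyclic_shift_equiv (V : finType) :=
  EquivRel (@cyclic_shift V) (@cyclic_shift_refl V)
    (@cyclic_shift_sym V) (@cyclic_shift_trans V).

(* Loops modulo cyclic shift (but not reversal).  The class of [::] is not the class of a
   loop; it never occurs in a record and has mass zero for the loop soup. *)
Definition loop (V : finType) := {eq_quot @cyclic_shift V}.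

HB.instance Definition _ (V : finType) := Choice.on (loop V).
HB.instance Definition _ (V : finType) := EqQuotient.on (loop V).

Definition loop_supp (V : finType) (l : loop V) : {set V} := [set x in repr l]%SET.

(* Chronological loop erasure; [eta] is the loop erasure of the part already read. *)
Fixpoint chron_erase (V : finType) (eta w : seq V) : seq V * seq (seq V) :=
  match w with
  | [::] => (eta, [::])
  | x :: w' =>
      if x \in eta then
        let: (eta', ls) := chron_erase (take (index x eta).+1 eta) w' in
        (eta', drop (index x eta) eta :: ls)
      else chron_erase (rcons eta x) w'
  end.

Definition record (V : finType) := (seq V * seq (loop V))%type.

Definition record_of (V : finType) (w : seq V) : record V :=
  let: (eta, ls) := chron_erase [::] w in (eta, [seq \pi_(loop V) l | l <- ls]).

Inductive exchange_equiv (V : finType) : seq (loop V) -> seq (loop V) -> Prop :=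
| exchange_refl ls : exchange_equiv ls ls
| exchange_step ls1 l l' ls2 ls :
    [disjoint loop_supp l & loop_supp l'] ->
    exchange_equiv (ls1 ++ l' :: l :: ls2) ls ->
    exchange_equiv (ls1 ++ l :: l' :: ls2) ls.

Definition record_equiv (V : finType) (P1 P2 : record V) : Prop :=
  P1.1 = P2.1 /\ exchange_equiv P1.2 P2.2.

Definition record_supp (V : finType) (P : record V) : {set V} :=
  ([set x in P.1] :|: \bigcup_(l <- P.2) loop_supp l)%SET.

(* The directed path with record P; it exists and is unique when P is legal, which is the
   case for Phi A (record_of w). *)
Definition path_of (V : finType) (P : record V) : seq V :=
  xget [::] [set g | record_equiv (record_of g) P]%classic.

Definition loop_at_index (V : finType) (ls : seq (loop V)) (i : 'I_(size ls)) : loop V :=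
  tnth (in_tuple ls) i.

Definition prec (V : finType) (ls : seq (loop V)) : rel 'I_(size ls) :=
  fun i j => (i < j)%N &&
    ~~ [disjoint loop_supp (loop_at_index i) & loop_supp (loop_at_index j)].

Definition set_prec (V : finType) (A : {set V}) (ls : seq (loop V)) : pred 'I_(size ls) :=
  fun k => [exists i, ~~ [disjoint A & loop_supp (loop_at_index i)]
                      && connect (@prec V ls) i k].

Definition Phi (V : finType) (A : {set V}) (P : record V) : record V :=
  (P.1, [seq loop_at_index k | k <- enum 'I_(size P.2) & @set_prec V A P.2 k]).

(* A path g together with, for each of its times, an ordered list of rooted loops to be
   inserted at that time. *)
Definition strand (V : finType) := (seq V * seq (seq (seq V)))%type.

Definition insert_loops (V : finType) (s : strand V) : seq V :=
  flatten [seq rcons (flatten p.2) p.1 | p <- zip s.1 s.2].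

Definition first_return_loop (V : finType) (D : {set V}) (u : V) (l : seq V) : bool :=
  if l is x :: e then [&& x == u, u \notin e & all (mem D) l] else false.

(* Times are indexed by all positions of g, with empty lists away from the first visits of
   vertices outside A.  If u is first visited after the initial segment g1, then
   A :|: g1 is A together with the vertices u_1, ..., u_{j-1} listed before u = u_j. *)
Definition first_visit_lists_spec (V : finType) (R A : {set V}) (w g : seq V)
    (lists : seq (seq (seq V))) : Prop :=
  [/\ size lists = size g,
      forall (g1 : seq V) (u : V) (g2 : seq V), g = g1 ++ u :: g2 ->
        if (u \in A) || (u \in g1) then nth [::] lists (size g1) == [::]
        else all (first_return_loop (R :\: (A :|: [set x in g1]))%SET u)
                 (nth [::] lists (size g1))
    & insert_loops (g, lists) = w].

Definition first_visit_lists (V : finType) (R A : {set V}) (w g : seq V) :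
    seq (seq (seq V)) :=
  xget [::] [set lists | first_visit_lists_spec R A w g lists]%classic.

(* The paths gamma_i, each with its first-visit lists, when C_0 = C. *)
Fixpoint entangle (V : finType) (R C : {set V}) (ws : seq (seq V)) : seq (strand V) :=
  match ws with
  | [::] => [::]
  | w :: ws' =>
      let P := Phi C (record_of w) in
      let g := path_of P in
      (g, first_visit_lists R C w g) :: entangle R (C :|: record_supp P)%SET ws'
  end.

Definition entangled_range (V : finType) (ws : seq (seq V)) : {set V} :=
  foldl (fun C w => C :|: record_supp (Phi C (record_of w)))%SET finset.set0 ws.

Definition strands_supp (V : finType) (st : seq (strand V)) : {set V} :=
  (\bigcup_(s <- st) [set x in s.1])%SET.

(* The maximal runs of consecutive elements of B in s, in order; [acc] is the run being
   read.  For a loop rooted outside B these are the segments b_0, ..., b_n. *)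
Fixpoint runs (V : finType) (B : {set V}) (acc s : seq V) : seq (seq V) :=
  match s with
  | [::] => if acc is [::] then [::] else [:: acc]
  | x :: s' =>
      if x \in B then runs B (rcons acc x) s'
      else if acc is [::] then runs B [::] s' else acc :: runs B [::] s'
  end.

(* Replaces the successive maximal runs in B of s by the elements of zs; [in_run] tells
   whether s continues a run that has already been replaced. *)
Fixpoint fill_runs (V : finType) (B : {set V}) (in_run : bool) (s : seq V)
    (zs : seq (seq V)) : seq V :=
  match s with
  | [::] => [::]
  | x :: s' =>
      if x \in B then
        if in_run then fill_runs B true s' zs
        else head [::] zs ++ fill_runs B true s' (behead zs)
      else x :: fill_runs B false s' zs
  end.

Definition loops_of (V : finType) (st : seq (strand V)) : seq (seq V) :=
  flatten (flatten (unzip2 st)).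

(* Reading the strands, their times, their loops and the runs of each loop in order is the
   lexicographic order of the labels (i, t, h, s). *)
Definition segments (V : finType) (B : {set V}) (st : seq (strand V)) : seq (seq V) :=
  flatten [seq runs B [::] l | l <- loops_of st].

Definition refill (V : finType) (B : {set V}) (st : seq (strand V)) (zs : seq (seq V)) :
    seq (strand V) :=
  let nruns := [seq size (runs B [::] l) | l <- loops_of st] in
  let filled :=
    [seq fill_runs B false p.1 p.2 | p <- zip (loops_of st) (reshape nruns zs)] in
  zip (unzip1 st)
    (reshape (shape (unzip2 st)) (reshape (shape (flatten (unzip2 st))) filled)).

(* A finitely supported law, as a list of weighted outcomes (repetitions allowed). *)
Definition flaw (K : realType) (E : Type) := seq (K * E).

Definition flaw_ret (K : realType) (E : Type) (x : E) : flaw K E := [:: (1, x)].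

Definition flaw_bind (K : realType) (E F : Type) (mu : flaw K E) (f : E -> flaw K F) :
    flaw K F :=
  flatten [seq [seq (p.1 * q.1, q.2) | q <- f p.2] | p <- mu].

Fixpoint flaw_map (K : realType) (E F : Type) (f : E -> flaw K F) (s : seq E) :
    flaw K (seq F) :=
  match s with
  | [::] => flaw_ret K [::]
  | x :: s' =>
      flaw_bind (f x) (fun y => flaw_bind (flaw_map f s') (fun ys => flaw_ret K (y :: ys)))
  end.

Definition flaw_uniform (K : realType) (E : Type) (s : seq E) : flaw K E :=
  [seq ((size s)%:R^-1, x) | x <- s].

Definition flaw_mass (K : realType) (E : eqType) (mu : flaw K E) (x : E) : K :=
  \sum_(p <- mu | p.2 == x) p.1.

Definition rising (K : realType) (x : K) (n : nat) : K := \prod_(i < n) (x + i%:R).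

Definition thinning_weight (K : realType) (lambda : K) (d k : nat) : K :=
  rising lambda k / k`!%:R * (rising (1 - lambda) (d - k) / (d - k)`!%:R).

Definition thin_list (K : realType) (lambda : K) (E : Type) (ls : seq E) : flaw K (seq E) :=
  [seq (thinning_weight lambda (size ls) k, drop k ls) | k <- iota 0 (size ls).+1].

Definition thin_strand (K : realType) (lambda : K) (V : finType) (s : strand V) :
    flaw K (strand V) :=
  flaw_bind (flaw_map (fun ls => thin_list lambda ls) s.2) (fun lists => flaw_ret K (s.1, lists)).

(* The recursion depth is at most #|R|, since each recursive call removes at least one
   vertex from the region. *)
Fixpoint construct_rec (K : realType) (lambda : K) (V : finType) (depth : nat)
    (R : {set V}) (ws : seq (seq V)) : flaw K (seq (seq V)) :=
  match depth with
  | 0%N => flaw_ret K ws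
  | depth'.+1 =>
      let B := (R :\: entangled_range ws)%SET in
      flaw_bind (flaw_map (fun s => thin_strand lambda s) (entangle R finset.set0 ws)) (fun kept =>
      let zs := segments B kept in
      flaw_bind (if zs is [::] then flaw_ret K [::]
                 else construct_rec lambda depth' B zs) (fun zs' =>
      flaw_ret K [seq insert_loops s | s <- refill B kept zs']))
  end.

Definition construct (K : realType) (lambda : K) (V : finType) (R : {set V})
    (ws : seq (seq V)) : flaw K (seq (seq V)) :=
  construct_rec lambda #|R| R ws.

(* Layer n: the strands of Omega^(n) together with the next region R_{n+1}. *)
Definition layer (V : finType) := (seq (strand V) * {set V})%type.

(* The layers 0, ..., L; again L <= #|R|. *)
Fixpoint layers_rec (V : finType) (depth : nat) (R : {set V}) (ws : seq (seq V)) :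
    seq (layer V) :=
  let st := entangle R finset.set0 ws in
  let B := (R :\: strands_supp st)%SET in
  let zs := segments B st in
  (st, B) ::
    match depth, zs with
    | depth'.+1, _ :: _ => layers_rec depth' B zs
    | _, _ => [::]
    end.

Definition layers (V : finType) (R : {set V}) (ws : seq (seq V)) : seq (layer V) :=
  layers_rec #|R| R ws.

(* The address (n, i, t) of a loop; n = size lys when the loop meets no layer. *)
Definition address (V : finType) (lys : seq (layer V)) (l : loop V) : nat * nat * nat :=
  let n := find (fun ly => ~~ [disjoint loop_supp l & strands_supp ly.1]) lys in
  let gs := unzip1 (nth ([::], finset.set0) lys n).1 in
  let i := find (has (mem (loop_supp l))) gs in
  let t := find (mem (loop_supp l)) (nth [::] gs i) in
  (n, i, t).

(* One rooted loop for each visit of l to u. *)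
Definition rootings (V : finType) (u : V) (l : loop V) : seq (seq V) :=
  [seq s <- [seq rot k (repr l) | k <- iota 0 (size (repr l))] | ohead s == Some u].

Definition arrangements (E : Type) (s : seq E) : seq (seq E) :=
  [seq [seq tnth (in_tuple s) (p i) | i <- enum 'I_(size s)] | p : 'S_(size s)].

Definition cut_at (V : finType) (u : V) (l : seq V) : seq (seq V) :=
  foldr (fun x acc =>
           if acc is e :: acc' then
             if head u e == u then [:: x] :: acc else (x :: e) :: acc'
           else [:: [:: x]]) [::] l.

(* The cut loops of the soup c assigned to the address (n, i, t), where u = gamma_i^(n)(t). *)
Definition assigned (K : realType) (V : finType) (lys : seq (layer V)) (c : seq (loop V))
    (n i t : nat) (u : V) : flaw K (seq (seq V)) :=
  flaw_bind (flaw_map (fun l => flaw_uniform K (rootings u l))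
                      [seq l <- c | address lys l == (n, i, t)]) (fun rooted =>
  flaw_bind (flaw_uniform K (arrangements rooted)) (fun ordered =>
  flaw_ret K (flatten [seq cut_at u l | l <- ordered]))).

Definition assigned_strand (K : realType) (V : finType) (lys : seq (layer V))
    (c : seq (loop V)) (n i : nat) (g : seq V) : flaw K (seq (seq (seq V))) :=
  flaw_map (fun p => assigned K lys c n i p.1 p.2) (zip (iota 0 (size g)) g).

Definition prepend_lists (V : finType) (added : seq (seq (seq V))) (s : strand V) :
    strand V :=
  (s.1, [seq p.1 ++ p.2 | p <- zip added s.2]).

(* Processes the layers [rest], the first of which has index n. *)
Fixpoint rebuild (K : realType) (V : finType) (lys : seq (layer V)) (c : seq (loop V))
    (n : nat) (rest : seq (layer V)) : flaw K (seq (seq V)) :=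
  match rest with
  | [::] => flaw_ret K [::]
  | (st, B) :: rest' =>
      flaw_bind (rebuild K lys c n.+1 rest') (fun zs =>
      flaw_bind (flaw_map (fun p => assigned_strand K lys c n p.1 p.2.1)
                          (zip (iota 0 (size st)) st)) (fun added =>
      flaw_ret K [seq insert_loops (prepend_lists p.1 p.2) | p <- zip added (refill B st zs)]))
  end.

Definition recover (K : realType) (V : finType) (R : {set V}) (ws : seq (seq V))
    (c : {mset loop V}%mset) : flaw K (seq (seq V)) :=
  let lys := layers R ws in rebuild K lys (enum_mset c) 0 lys.

Definition path_weight (K : realType) (V : finType) (Q : V -> V -> K) (s : seq V) : K :=
  \prod_(e <- zip s (behead s)) Q e.1 e.2.

Definition is_path_in (V : finType) (R : {set V}) (a b : V) (s : seq V) : bool :=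
  if s is x :: p then [&& x == a, last x p == b & all (mem R) s] else false.

Definition principal (K : realType) (V : finType) (Q : V -> V -> K) (R : {set V}) :
    'M[K]_#|R| :=
  \matrix_(i, j) Q (enum_val i) (enum_val j).

Definition spectral_radius_lt1 (K : realType) (n : nat) (M : 'M[K]_n) : Prop :=
  forall z : K[i], eigenvalue (map_mx (real_complex K) M) z -> `|z| < 1.

(* The (a, b) entry of (I - Q_R)^-1; it is 0 by convention unless a and b lie in R. *)
Definition green (K : realType) (V : finType) (Q : V -> V -> K) (R : {set V}) (a b : V) : K :=
  match [pick i : 'I_#|R| | enum_val i == a], [pick j : 'I_#|R| | enum_val j == b] with
  | Some i, Some j => invmx (1%:M - principal Q R) i j
  | _, _ => 0
  end.

Definition rooted_loop_mass (K : realType) (V : finType) (Q : V -> V -> K) (R : {set V})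
    (s : seq V) : K :=
  if s is x :: p then
    if all (mem R) s then path_weight Q (rcons s x) / (size s)%:R else 0
  else 0.

Local Open Scope classical_set_scope.

(* Random variables with values in a countable set with the discrete sigma-algebra. *)
Definition discrete_rv (d : measure_display) (T : measurableType d) (E : Type)
    (X : T -> E) : Prop :=
  forall x : E, measurable (X @^-1` [set x]).

Definition mutually_independent (K : realType) (d : measure_display)
    (T : measurableType d) (P : probability T K) (n : nat) (E : Type)
    (X : 'I_n -> T -> E) : Prop :=
  forall A : 'I_n -> set E,
    P (\bigcap_(i in [set: 'I_n]) (X i @^-1` A i)) = (\prod_(i < n) P (X i @^-1` A i))%E.

Definition independent_pair (K : realType) (d : measure_display)
    (T : measurableType d) (P : probability T K) (E F : Type)
    (X : T -> E) (Y : T -> F) : Prop :=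
  forall (A : set E) (B : set F),
    P (X @^-1` A `&` Y @^-1` B) = (P (X @^-1` A) * P (Y @^-1` B))%E.

Definition normalized_walk (K : realType) (d : measure_display)
    (T : measurableType d) (P : probability T K) (V : finType) (Q : V -> V -> K)
    (R : {set V}) (a b : V) (omega : T -> seq V) : Prop :=
  forall s : seq V, P (omega @^-1` [set s]) =
    (if is_path_in R a b s then path_weight Q s / green Q R a b else 0)%:E.

(* X is the output of a randomized algorithm run on the input Y: the conditional law of X
   given Y = y is [kernel y]. *)
Definition output_of (K : realType) (d : measure_display)
    (T : measurableType d) (P : probability T K) (E : Type) (F : eqType)
    (kernel : E -> flaw K F) (Y : T -> E) (X : T -> F) : Prop :=
  forall (y : E) (x : F),
    P (Y @^-1` [set y] `&` X @^-1` [set x]) =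
    (P (Y @^-1` [set y]) * (flaw_mass (kernel y) x)%:E)%E.

Definition loop_count (V : finType) (A : set (loop V)) (c : {mset loop V}%mset) : nat :=
  count (fun l => l \in A) (enum_mset c).

Definition loop_intensity (K : realType) (V : finType) (Q : V -> V -> K) (R : {set V})
    (lambda : K) (A : set (loop V)) : \bar K :=
  (lambda%:E * \esum_(s in [set s | A (\pi_(loop V) s)]) (rooted_loop_mass Q R s)%:E)%E.

(* The Poisson point process of loops, as a random finite multiset (its intensity is finite
   when Q has spectral radius < 1).  The second argument of [poisson_prob] is unused. *)
Definition loop_soup (K : realType) (d : measure_display)
    (T : measurableType d) (P : probability T K) (V : finType) (Q : V -> V -> K)
    (R : {set V}) (lambda : K) (L : T -> {mset loop V}%mset) : Prop :=
  (forall (A : set (loop V)) (m : K), loop_intensity Q R lambda A = m%:E ->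
     forall U : set nat, P ((loop_count A \o L) @^-1` U) = poisson_prob m 0%N U) /\
  (forall (n : nat) (A : 'I_n -> set (loop V)), trivIset [set: 'I_n] A ->
     mutually_independent P (fun i => loop_count (A i) \o L)).

(* Main.v *)
(* Tuples of paths in R with given endpoints correspond to tuples of paths that are their own
   entangled loop-erasure, together with arbitrary lists of return loops at the first-visit
   times, and the weight is the product of the weights of all the pieces.  Hence at each
   first-visit time a list of d loops has the coefficient 1 of t^d in (1 - t)^-1, and the
   thinning factorizes (1 - t)^-1 = (1 - t)^-lambda (1 - t)^-(1 - lambda): the deleted and
   the retained list become independent and their concatenation is the original list.  The
   soup loops assigned to a first-visit time, rooted, permuted and cut at their returns, form
   a list with the coefficients of exp (- lambda log (1 - t)) = (1 - t)^-lambda, that is, a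
   fresh copy of the deleted list, so prepending them restores the original weights.  Given
   the rest of the retained loops, their runs in B = R minus S are weighted as walks in B
   with given endpoints, and the soup loops contained in B are independent of the others, so
   that induction on the region treats the recursive calls.  All this is carried out with
   unnormalized weights: the mass of the soup is the inverse of the probability that it is
   empty. *)

From HB Require Import structures.
Require Import Defs.
From mathcomp Require Import all_boot all_order all_algebra perm.
From mathcomp Require Import finmap multiset.
From mathcomp Require Import all_classical all_reals all_analysis.
From mathcomp Require Import ring zify.

Set Implicit Arguments.
Unset Strict Implicit.
Unset Printing Implicit Defensive.

Import Order.TTheory GRing.Theory Num.Theory.

Local Open Scope quotient_scope.
Local Open Scope ring_scope.

(** * Records and entangled loop-erasure *)

(** Recovery sees only the output, so the layers and their lists have to be read off from it. This
    is why paths are written as skeletons ([greduced]) with lists restricted by slot predicates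
    ([gslots]): on such pairs entangling inverts insertion, and the slot predicates do not
    distinguish between the fillings of the runs in B. Hence the output has the skeletons of the
    input, and its lists differ from the retained ones only inside the runs. Both algorithms then
    act on a product of independent slots. The mass of the soup is the constant that the induction
    carries: the total weight of the deleted lists of one layer, times the mass of the soup in B, is
    the mass of the soup in R. The lists deleted by the construction thus survive only through their
    mass, and no division occurs. The recursive step is treated as an operator on test functions,
    because what happens in B is followed by an arbitrary function of the refilled loops. Sums take
    values in [0, +oo], where they may be interchanged freely; the normalization enters at the end,
    when the probabilities of the values of the soup are summed to 1. *)

Section Records.
Variable V : finType.
Implicit Types (A B C R D : {set V}) (l : loop V) (ls : seq (loop V)) (w g : seq V).

Definition meets A B := ~~ [disjoint A & B].

Lemma meetsP A B : reflect (exists2 x, x \in A & x \in B) (meets A B).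
Proof.
apply: (iffP pred0Pn) => [[x /andP[xA xB]]|[x xA xB]]; exists x => //.
by rewrite /= xA xB.
Qed.

Lemma meetsU A B C : meets (A :|: B)%SET C = meets A C || meets B C.
Proof.
apply/meetsP/orP => [[x]|[] /meetsP[x xA xC]].
- by rewrite inE => /orP[] xA xC; [left|right]; apply/meetsP; exists x.
- by exists x => //; rewrite inE xA.
- by exists x => //; rewrite inE xA orbT.
Qed.

Lemma meetsS A B A' B' : A \subset A' -> B \subset B' -> meets A B -> meets A' B'.
Proof.
move=> /fintype.subsetP sA /fintype.subsetP sB /meetsP[x xA xB].
by apply/meetsP; exists x; [apply: sA|apply: sB].
Qed.

(** One pass from left to right computes [set_prec]: [prec] relates a loop only to later ones, so it
    suffices to enlarge A by the support of each marked loop. *)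
Fixpoint marks A ls : seq bool :=
  if ls is l :: ls' then
    meets A (loop_supp l) ::
    marks (if meets A (loop_supp l) then A :|: loop_supp l else A)%SET ls'
  else [::].

Fixpoint keep A ls : seq (loop V) :=
  if ls is l :: ls' then
    if meets A (loop_supp l) then l :: keep (A :|: loop_supp l)%SET ls' else keep A ls'
  else [::].

Lemma size_marks A ls : size (marks A ls) = size ls.
Proof. by elim: ls A => //= l ls IH A; rewrite IH. Qed.

Lemma keep_mask A ls : keep A ls = mask (marks A ls) ls.
Proof. by elim: ls A => //= l ls IH A; case: ifP => _; rewrite IH. Qed.

Lemma marksP l0 A ls k : (k < size ls)%N ->
  nth false (marks A ls) k <->
  meets A (loop_supp (nth l0 ls k)) \/
  exists j, [/\ (j < k)%N, nth false (marks A ls) j &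
    meets (loop_supp (nth l0 ls j)) (loop_supp (nth l0 ls k))].
Proof.
elim: ls A k => // l ls IH A [|k] /=; first by split => [|[//|[j []//]]]; left.
rewrite ltnS => kls; rewrite IH //; split.
- case=> [|[j [jk mj mjk]]]; last by right; exists j.+1.
  case: ifP => [ml|_]; last by left.
  by rewrite meetsU => /orP[|ml']; [left|right; exists 0%N].
- case=> [mk|[[|j] /= [jk mj mjk]]].
  + by left; case: ifP => // _; rewrite meetsU mk.
  + by left; rewrite mj meetsU mjk orbT.
  + by right; exists j.
Qed.

(** Splitting off the last step of a chain gives [set_prec] the recursive form of [marksP]. *)
Lemma set_precE A ls (k : 'I_(size ls)) :
  @set_prec V A ls k <->
  meets A (loop_supp (loop_at_index k)) \/
  exists j : 'I_(size ls), [/\ (j < k)%N, @set_prec V A ls j &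
    meets (loop_supp (loop_at_index j)) (loop_supp (loop_at_index k))].
Proof.
split.
- move=> /existsP[i /andP[Ai /connectP[p]]].
  elim/last_ind: p k => [k _ ->|p y IH k]; first by left.
  rewrite rcons_path last_rcons => /andP[pi /andP[lt_y m_y]] ->.
  right; exists (last i p); split => //.
  by apply/existsP; exists i; apply/andP; split => //; apply/connectP; exists p.
- case=> [mk|[j [jk /existsP[i /andP[Ai cij]] mjk]]]; apply/existsP.
    by exists k; apply/andP; split => //; exact: connect0.
  exists i; apply/andP; split => //; apply: (connect_trans cij); apply: connect1.
  by apply/andP; split.
Qed.

Lemma set_prec_marks A ls (k : 'I_(size ls)) :
  @set_prec V A ls k = nth false (marks A ls) k.
Proof.
case: k => k; elim/ltn_ind: k => k IH hk.
have l0 : loop V by move: hk; case: (ls) => // l.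
have E j (hj : (j < size ls)%N) : loop_at_index (Ordinal hj) = nth l0 ls j.
  by rewrite /loop_at_index (tnth_nth l0).
apply/idP/idP.
- move=> /set_precE; rewrite E => h; apply/(marksP l0) => //.
  case: h => [|[[j hj] /= [jk pj]]]; first by left.
  rewrite E => mjk; right; exists j; split => //.
  by rewrite -(IH j jk hj).
- move=> /(marksP l0 _ hk) h; apply/set_precE; rewrite E.
  case: h => [|[j [jk mj mjk]]]; first by left.
  have hj := ltn_trans jk hk.
  by right; exists (Ordinal hj); rewrite E IH.
Qed.

Lemma Phi_keep A (P : record V) : Phi A P = (P.1, keep A P.2).
Proof.
case: P => eta ls; rewrite /Phi /= keep_mask; congr pair.
rewrite (eq_filter (@set_prec_marks A ls)) filter_mask map_mask; congr mask.
  have -> : [seq nth false (marks A ls) k | k : 'I_(size ls) <- enum 'I_(size ls)] =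
     [seq nth false (marks A ls) k | k <- [seq val k | k <- enum 'I_(size ls)]].
    by rewrite -map_comp.
  by rewrite val_enum_ord -(size_marks A) -/(mkseq _ _) mkseq_nth.
exact: map_tnth_enum (in_tuple ls).
Qed.

Definition lsupp ls : {set V} := (\bigcup_(l <- ls) loop_supp l)%SET.

Lemma lsupp_cat ls1 ls2 : lsupp (ls1 ++ ls2) = (lsupp ls1 :|: lsupp ls2)%SET.
Proof. by rewrite /lsupp big_cat. Qed.

Lemma lsupp_cons l ls : lsupp (l :: ls) = (loop_supp l :|: lsupp ls)%SET.
Proof. by rewrite /lsupp big_cons. Qed.

Lemma lsupp_nil : lsupp [::] = finset.set0.
Proof. by rewrite /lsupp big_nil. Qed.

Lemma keep_cat A ls1 ls2 :
  keep A (ls1 ++ ls2) = keep A ls1 ++ keep (A :|: lsupp (keep A ls1))%SET ls2.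
Proof.
elim: ls1 A => [|l ls1 IH] A /=; first by rewrite lsupp_nil finset.setU0.
by case: ifP => _ //=; rewrite IH // lsupp_cons finset.setUA.
Qed.

Lemma keep_supp A ls : lsupp (keep A ls) \subset lsupp ls.
Proof.
elim: ls A => //= l ls IH A; rewrite lsupp_cons.
case: ifP => _; rewrite ?lsupp_cons ?finset.setUS //.
exact: (fintype.subset_trans (IH _) (finset.subsetUr _ _)).
Qed.

Lemma keep_avoid A ls : ~~ meets A (lsupp ls) -> keep A ls = [::].
Proof.
elim: ls => //= l ls IH; rewrite lsupp_cons => h.
rewrite ifN; last by apply: contra h; apply: meetsS => //; exact: finset.subsetUl.
by rewrite IH //; apply: contra h; apply: meetsS => //; exact: finset.subsetUr.
Qed.

Lemma repr_pi_rot (s : seq V) : exists k, repr (\pi_(loop V) s) = rot k s.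
Proof.
have h : (repr (\pi_(loop V) s)) = s %[mod loop V] by rewrite reprK.
have := introT (eqmodP (cyclic_shift_equiv V) _ _) h; rewrite /= cyclic_shift_sym => /existsP[k /eqP <-].
by exists k.
Qed.

Lemma loop_supp_pi (s : seq V) : loop_supp (\pi_(loop V) s) = [set x in s]%SET.
Proof.
have [k e] := repr_pi_rot s.
by apply/setP => x; rewrite !inE e mem_rot.
Qed.

Lemma chron_erase_cat (eta w1 w2 : seq V) :
  chron_erase eta (w1 ++ w2) =
  let r1 := chron_erase eta w1 in
  let r2 := chron_erase r1.1 w2 in (r2.1, r1.2 ++ r2.2).
Proof.
elim: w1 eta => [|x w1 IH] eta /=; first by case: chron_erase.
case: ifP => _; rewrite IH //=.
case: (chron_erase _ w1) => eta1 ls1 /=.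
by case: (chron_erase _ w2).
Qed.

Lemma chron_erase_rcons (eta w : seq V) x :
  chron_erase eta (rcons w x) =
  let r := chron_erase eta w in
  if x \in r.1 then (take (index x r.1).+1 r.1, rcons r.2 (drop (index x r.1) r.1))
  else (rcons r.1 x, r.2).
Proof.
rewrite -cats1 chron_erase_cat /=; case: chron_erase => eta1 ls1 /=.
by case: ifP => _; rewrite /= ?cats0 ?cats1.
Qed.

Lemma split_index (x : V) s : x \in s ->
  exists s1 s2, [/\ s = s1 ++ x :: s2, x \notin s1,
    take (index x s).+1 s = rcons s1 x & drop (index x s) s = x :: s2].
Proof.
move=> xs; exists (take (index x s) s), (drop (index x s).+1 s).
have hi : (index x s < size s)%N by rewrite index_mem.
have e : drop (index x s) s = x :: drop (index x s).+1 s.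
  by rewrite (drop_nth x hi) nth_index.
split => //.
- by rewrite -e cat_take_drop.
- by rewrite in_take // ltnn.
- by rewrite (take_nth x hi) nth_index.
Qed.

Lemma chron_erase_uniq (eta w : seq V) : uniq eta ->
  uniq (chron_erase eta w).1 /\ all uniq (chron_erase eta w).2.
Proof.
elim: w eta => [|x w IH] eta ue //=; case: ifPn => xe.
  have [s1 [s2 [es xs1 et ed]]] := split_index xe.
  have := IH (take (index x eta).+1 eta) (take_uniq _ ue).
  by case: chron_erase => eta' ls /= [-> ->]; rewrite drop_uniq.
by apply: IH; rewrite rcons_uniq xe.
Qed.

Lemma chron_erase_mem (eta w : seq V) x :
  (x \in (chron_erase eta w).1) || has (fun s => x \in s) (chron_erase eta w).2 =
  (x \in eta) || (x \in w).
Proof.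
elim: w eta => [|y w IH] eta /=; first by [].
case: ifPn => ye; last by rewrite IH mem_rcons !inE -orbA; do !bool_congr.
have [s1 [s2 [es xs1 et ed]]] := split_index ye.
have := IH (take (index y eta).+1 eta).
case: chron_erase => eta' ls /=; rewrite et ed => e.
rewrite orbCA e {1}es mem_rcons !inE mem_cat inE.
by case: (x == y); case: (x \in s1); case: (x \in s2); case: (x \in w).
Qed.

Lemma record_ofE w :
  record_of w = ((chron_erase [::] w).1, [seq \pi_(loop V) s | s <- (chron_erase [::] w).2]).
Proof. by rewrite /record_of; case: chron_erase. Qed.

Lemma mem_lsupp_pi x (ss : seq (seq V)) :
  (x \in lsupp [seq \pi_(loop V) s | s <- ss]) = has (fun s => x \in s) ss.
Proof.
elim: ss => [|s ss IH] /=; first by rewrite lsupp_nil inE.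
by rewrite lsupp_cons inE loop_supp_pi inE IH.
Qed.

Lemma record_supp_of w : record_supp (record_of w) = [set x in w]%SET.
Proof.
apply/setP => x; rewrite record_ofE /record_supp !inE /= -/(lsupp _) mem_lsupp_pi.
by rewrite chron_erase_mem.
Qed.

(* The successive exits of a path from [v]; together with the starting point they
   determine the path, and exchanges of disjoint loops do not change them. *)
Fixpoint exits (v : V) w : seq V :=
  if w is x :: w' then
    if w' is y :: _ then (if x == v then y :: exits v w' else exits v w') else [::]
  else [::].

Lemma exits_cat v w1 x w2 : exits v (w1 ++ x :: w2) = exits v (rcons w1 x) ++ exits v (x :: w2).
Proof.
elim: w1 => [|y w1 IH] //=.
by case: w1 IH => [|z w1] /= IH; case: ifP => _ //=; rewrite IH.
Qed.

Lemma exits_notin v w x : v \notin w -> exits v (rcons w x) = [::].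
Proof.
elim: w => [|y w IH] //=; rewrite inE negb_or => /andP[vy vw].
by case: w IH vw => [|z w] /= IH vw; rewrite eq_sym (negPf vy) // IH.
Qed.

Lemma exits_inj w w' : ohead w = ohead w' -> (forall v, exits v w = exits v w') -> w = w'.
Proof.
elim: w w' => [|x w IH] [|x' w'] //= [<-] {x'}.
case: w IH => [|y w] IH; case: w' => [|y' w'] // e.
- by have := e x; rewrite eqxx.
- by have := e x; rewrite eqxx.
- have := e x; rewrite eqxx => -[ey _]; rewrite -ey in e *.
  congr cons; apply: IH => // v; have := e v.
  by case: ifP => // _ [].
Qed.

(** The exit from v along a simple loop; [next] is cyclic, so the representative does not matter. *)
Definition lexit (v : V) l : seq V := if v \in repr l then [:: next (repr l) v] else [::].

Definition rexits (v : V) (P : record V) := flatten [seq lexit v l | l <- P.2] ++ exits v P.1.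

Lemma next_rcons (x : V) q v : uniq (x :: q) ->
  exits v (x :: rcons q x) = if v \in x :: q then [:: next (x :: q) v] else [::].
Proof.
move=> u; have [vq|vq] := ifPn; last first.
  by rewrite -rcons_cons exits_notin.
have [s1 [s2 [e vs1 _ _]]] := split_index vq.
rewrite -rcons_cons e rcons_cat rcons_cons exits_cat exits_notin //= => {vq}.
have -> : next (s1 ++ v :: s2) v = next (v :: s2 ++ s1) v.
  by rewrite -(next_rot (size s1)) ?rot_size_cat // -e.
have vs2 : v \notin s2.
  by move: u; rewrite e cat_uniq /= => /and4P[].
case: s1 e vs1 => [|y s1] /= [-> _] vs1; case: s2 vs2 => [|z s2] /= vs2; rewrite ?eqxx //.
- by congr cons; exact: (@exits_notin v (z :: s2)).
- by congr cons; exact: (@exits_notin v (z :: s2)).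
Qed.

Lemma lexit_pi v x q : uniq (x :: q) -> lexit v (\pi_(loop V) (x :: q)) = exits v (x :: rcons q x).
Proof.
move=> u; have [k e] := repr_pi_rot (x :: q).
by rewrite /lexit e mem_rot next_rcons // next_rot.
Qed.

(** When x closes a loop, the exits made along it move from the erasure to the list of loops. Their
    order is not disturbed, since by uniqueness a vertex of the loop is absent from the part of the
    erasure before x. *)
Lemma chron_erase_exits v (eta w : seq V) : uniq eta ->
  flatten [seq lexit v (\pi_(loop V) s) | s <- (chron_erase eta w).2]
    ++ exits v (chron_erase eta w).1 = exits v (eta ++ w).
Proof.
elim: w eta => [|x w IH] eta u //=; first by rewrite cats0.
case: ifPn => xe; last by rewrite IH ?cat_rcons // rcons_uniq xe.
have [s1 [s2 [es xs1 et ed]]] := split_index xe.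
have := IH (take (index x eta).+1 eta) (take_uniq _ u).
case: chron_erase => eta' ls /=; rewrite et ed -catA => -> {et ed}.
have u2 : uniq (x :: s2) by move: u; rewrite es cat_uniq => /and3P[].
rewrite lexit_pi // es -catA cat_cons cat_rcons !exits_cat.
have -> : exits v (x :: s2 ++ x :: w) = exits v (x :: rcons s2 x) ++ exits v (x :: w).
  by rewrite -cat_cons exits_cat.
rewrite !catA; congr (_ ++ _).
have [vs|vs] := boolP (v \in x :: s2); last first.
  by rewrite (exits_notin x vs : exits v (x :: rcons s2 x) = _) cats0.
rewrite (exits_notin _ (_ : v \notin s1)) ?cats0 //.
move: u; rewrite es cat_uniq => /and3P[_ /hasPn h _].
by have := h _ vs.
Qed.

Lemma rexits_record_of v w : rexits v (record_of w) = exits v w.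
Proof.
by rewrite record_ofE /rexits /= -map_comp (chron_erase_exits v w (eta := [::])).
Qed.

(** At most one of two disjoint loops leaves v, so an exchange does not reorder the exits from v. *)
Lemma rexits_equiv v (P1 P2 : record V) : record_equiv P1 P2 -> rexits v P1 = rexits v P2.
Proof.
case: P1 P2 => eta1 ls1 [eta2 ls2] [/= <- {eta2}] h; rewrite /rexits /=; congr (_ ++ _).
elim: h => {ls1 ls2} // ls1 l l' ls2 ls dis _ <-.
rewrite !map_cat !flatten_cat /= !catA; congr (_ ++ _).
rewrite -!catA; congr (_ ++ _); rewrite /lexit.
case: ifPn => vl; case: ifPn => vl' //.
move: dis; rewrite disjoint_subset => /fintype.subsetP /(_ v).
by rewrite !inE vl vl' => /(_ isT).
Qed.

Lemma chron_erase_head (eta w : seq V) : ohead (chron_erase eta w).1 = ohead (eta ++ w).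
Proof.
elim: w eta => [|x w IH] eta /=; first by rewrite cats0.
case: ifPn => xe; last by rewrite IH cat_rcons.
have [s1 [s2 [es xs1 et ed]]] := split_index xe.
have := IH (take (index x eta).+1 eta).
case: chron_erase => eta' ls /= ->; rewrite et es.
by case: (s1).
Qed.

(** This makes the choice in [path_of] unambiguous. *)
Lemma record_of_inj w g : record_equiv (record_of w) (record_of g) -> w = g.
Proof.
move=> h; apply: exits_inj; last first.
  by move=> v; rewrite -!rexits_record_of (rexits_equiv v h).
by case: h => h _; move: h; rewrite !record_ofE /= => h;
  rewrite -(chron_erase_head [::] w) -(chron_erase_head [::] g) h.
Qed.

Lemma path_of_record g : path_of (record_of g) = g.
Proof.
rewrite /path_of; case: xgetP => [w -> /= /record_of_inj //|/(_ g) /=].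
by case; split => //; exact: exchange_refl.
Qed.

End Records.

(** * Skeletons, slots and the inverse of insertion *)

Section Entangle.
Variable V : finType.
Implicit Types (A B C R D : {set V}) (w g : seq V).

(** With s read after a visit to x, this says that no return loop at x avoiding A can be split
    off. *)
Fixpoint noret A (x : V) (s : seq V) : bool :=
  if s is y :: s' then (y \in A) || (y != x) && noret A x s' else true.

(* The paths [g] whose record is fixed by [Phi A]. *)
Fixpoint reduced A g : bool :=
  if g is x :: g' then
    if x \in A then reduced A g' else noret A x g' && reduced (x |: A)%SET g'
  else true.

(** At a vertex that is not new, [pred0] forces the list to be empty. *)
Fixpoint slots R A g : seq (pred (seq V)) :=
  if g is x :: g' then
    (if x \in A then (pred0 : pred (seq V)) else first_return_loop (R :\: A)%SET x) :: slots R (x |: A)%SET g'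
  else [::].

Definition fits E (ps : seq (pred E)) (xs : seq (seq E)) : bool :=
  all2 (fun p X => all p X) ps xs.

Lemma all_pred0 E (X : seq E) : all pred0 X = nilp X.
Proof. by case: X. Qed.

Lemma set_cons A x g : (A :|: [set y in x :: g] = (x |: A) :|: [set y in g])%SET.
Proof. by apply/setP => y; rewrite !inE orbCA orbA. Qed.

Lemma fits_slotsP R A g lists :
  fits (slots R A g) lists <->
  size lists = size g /\
  forall (g1 : seq V) (u : V) (g2 : seq V), g = g1 ++ u :: g2 ->
    if (u \in A) || (u \in g1) then nth [::] lists (size g1) == [::]
    else all (first_return_loop (R :\: (A :|: [set x in g1]))%SET u)
             (nth [::] lists (size g1)).
Proof.
elim: g A lists => [|x g IH] A [|X lists] //=.
- by split=> // _; split=> // -[].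
- by split=> // -[].
- by split=> // -[].
split.
- move=> /andP[hX /IH[hs h]]; split=> [|[|y g1] u g2]; first by rewrite hs.
  + move=> [<- _] /=; rewrite orbF; case: ifP hX => _; first by rewrite all_pred0 => /nilP ->.
    suff -> : (A :|: [set y in [::]] = A)%SET by [].
    by apply/setP => y; rewrite !inE orbF.
  + move=> [<- /h] /=; rewrite set_cons !inE orbA (orbC (u \in A)).
    by case: ifP.
- move=> [[hs] h]; apply/andP; split.
    have := h [::] x g erefl; rewrite /= orbF; case: ifP => _; first by move=> /eqP ->.
    suff -> : (A :|: [set y in [::]] = A)%SET by [].
    by apply/setP => y; rewrite !inE orbF.
  apply/IH; split=> // g1 u g2 e; have := h (x :: g1) u g2.
  rewrite e => /(_ erefl) /=; rewrite set_cons !inE orbA (orbC (u \in A)).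
  by case: ifP.
Qed.

Lemma spec_fits R A w g lists :
  first_visit_lists_spec R A w g lists <->
  fits (slots R A g) lists /\ insert_loops (g, lists) = w.
Proof.
split.
- by move=> [hs h hw]; split=> //; apply/fits_slotsP.
- by move=> [/fits_slotsP[hs h] hw].
Qed.

Lemma insert_cons x g X lists :
  insert_loops (x :: g, X :: lists) = flatten X ++ x :: insert_loops (g, lists).
Proof. by rewrite /insert_loops /= cat_rcons. Qed.

Lemma chron_erase_prefix (eta s e : seq V) :
  {in s ++ e, forall y, y \notin eta} ->
  chron_erase (eta ++ s) e = (eta ++ (chron_erase s e).1, (chron_erase s e).2).
Proof.
elim: e s => [|x e IH] s //= h.
have xeta : x \notin eta by apply: h; rewrite mem_cat inE eqxx orbT.
rewrite mem_cat (negPf xeta) /=; case: ifPn => xs; last first.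
  by rewrite rcons_cat IH // => y; rewrite cat_rcons; exact: h.
have [s1 [s2 [es xs1 et ed]]] := split_index xs.
rewrite index_cat (negPf xeta) -addnS takeD take_size_cat // drop_size_cat //.
rewrite (addnC (size eta)) -drop_drop drop_size_cat // et ed IH; last first.
  move=> y hy; apply: h; rewrite es; move: hy.
  by rewrite !mem_cat mem_rcons !inE => /orP[/orP[]|] ->; rewrite ?orbT.
by case: (chron_erase _ e).
Qed.

(** The return to x cuts the erasure back to x, so the excursion leaves behind only erased loops
    made of its own vertices. *)
Lemma chron_erase_return (eta : seq V) x e :
  {in x :: e, forall y, y \notin eta} ->
  exists2 ls, chron_erase (rcons eta x) (rcons e x) = (rcons eta x, ls) &
    forall y, has (fun s => y \in s) ls -> y \in x :: e.
Proof.
move=> h; rewrite -cats1.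
exists (chron_erase [:: x] (rcons e x)).2.
  rewrite chron_erase_prefix; last first.
    by move=> y hy; apply: h; move: hy; rewrite !inE mem_rcons !inE orbA orbb.
  congr pair; congr cat; rewrite chron_erase_rcons /=.
  have := chron_erase_head [:: x] e; case: chron_erase => -[|z s'] ls //= [->].
  by rewrite !inE eqxx /= take0.
move=> y hy; have := chron_erase_mem [:: x] (rcons e x) y.
by rewrite hy orbT !inE mem_rcons !inE orbA orbb => <-.
Qed.

Lemma mem_record w x : has (fun s => x \in s) (chron_erase [::] w).2 -> x \in w.
Proof. by move=> h; have := chron_erase_mem [::] w x; rewrite h orbT /= => <-. Qed.

(* No chain from [A] can pass through the loops erased while [x :: e] is read, since
   they meet neither [A] nor an earlier loop. *)
Lemma Phi_remove A w1 x e w2 : {in x :: e, forall y, y \notin A /\ y \notin w1} ->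
  Phi A (record_of (w1 ++ (x :: e) ++ x :: w2)) = Phi A (record_of (w1 ++ x :: w2)).
Proof.
move=> h; rewrite !Phi_keep !record_ofE /=.
have heta : {in x :: e, forall y, y \notin (chron_erase [::] w1).1}.
  move=> y /h[_]; apply: contra => hy.
  by have := chron_erase_mem [::] w1 y; rewrite hy /= => <-.
have -> : w1 ++ x :: e ++ x :: w2 = w1 ++ (x :: rcons e x) ++ w2.
  by rewrite -cats1 /= -catA.
rewrite chron_erase_cat /=.
rewrite [in RHS]chron_erase_cat /= (negPf (heta x (mem_head _ _))).
have [lsE eE hE] := chron_erase_return heta.
rewrite chron_erase_cat eE /=; congr pair.
case E1 : (chron_erase [::] w1) => [eta1 ls1] /=.
rewrite !map_cat !keep_cat.
rewrite (@keep_avoid _ _ [seq \pi_(loop V) s | s <- lsE]) /=.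
  by rewrite lsupp_nil finset.setU0.
apply/negP => /meetsP[y]; rewrite mem_lsupp_pi => yA /hE /h [yA' yw1].
move: yA; rewrite inE (negPf yA') /= => /(fintype.subsetP (keep_supp _ _)).
by rewrite mem_lsupp_pi => hy; case/negP: yw1; apply: mem_record; rewrite E1.
Qed.

Lemma Phi_remove_list A w1 x (X : seq (seq V)) w2 : x \notin A -> x \notin w1 ->
  all (fun l => (ohead l == Some x) && all (fun y => (y \notin A) && (y \notin w1)) l) X ->
  Phi A (record_of (w1 ++ flatten X ++ x :: w2)) = Phi A (record_of (w1 ++ x :: w2)).
Proof.
move=> xA xw1; elim: X => //= l X IH /andP[/andP[hl al] aX].
case: l hl al => [|z e] //= /eqP [->] /andP[_ /allP ae].
rewrite -IH // -catA /=.
have [w3 ->] : exists w3, flatten X ++ x :: w2 = x :: w3.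
  case: X aX {IH} => [|[|z' e'] X] /=; first by exists w2.
    by [].
  by move=> /andP[/andP[/eqP[-> _]] _]; exists (e' ++ (flatten X ++ x :: w2)); rewrite catA.
apply: (@Phi_remove A w1 x e) => y; rewrite inE => /orP[/eqP -> //|/ae /andP[//]].
Qed.

(** The prefix w1 already read is a parameter of the induction, because the loops inserted later
    avoid it together with A. *)
Lemma Phi_insert R A C w1 g lists : (C = A :|: [set x in w1])%SET ->
  fits (slots R C g) lists ->
  Phi A (record_of (w1 ++ insert_loops (g, lists))) = Phi A (record_of (w1 ++ g)).
Proof.
elim: g C w1 lists => [|x g IH] C w1 [|X lists] //= eC /andP[hX hl].
have eC' : (x |: C = A :|: [set y in rcons w1 x])%SET.
  by rewrite eC; apply/setP => y; rewrite !inE mem_rcons inE orbCA.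
rewrite insert_cons -[in RHS]cat_rcons -(IH _ _ _ eC' hl) cat_rcons.
case: ifPn hX => xC; first by rewrite all_pred0 => /nilP ->.
move: (xC); rewrite eC !inE negb_or => /andP[xA xw1] hX.
apply: Phi_remove_list => //.
apply: sub_all hX => -[|z e] //= /and3P[/eqP -> _ /andP[hx he]].
rewrite eqxx xA xw1 /=; apply/allP => y /(allP he) /=.
by rewrite !inE negb_or => /andP[].
Qed.

Lemma noret_cat_avoid A x s t : all (fun y => (y \notin A) && (y != x)) s ->
  noret A x (s ++ t) = noret A x t.
Proof. by elim: s => //= y s IH /andP[/andP[/negPf -> ->] /IH]. Qed.

Lemma noret_prefix A x s t : noret A x (s ++ t) -> noret A x s.
Proof. by elim: s => //= y s IH /orP[->//|/andP[-> /IH ->]]; rewrite orbT. Qed.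

Lemma reduced_prefix A s t : reduced A (s ++ t) -> reduced A s.
Proof.
elim: s A => //= x s IH A; case: ifP => _; first exact: IH.
by move=> /andP[/noret_prefix -> /IH].
Qed.

(** Here z is first visited after p, and [reduced] forbids a return to z before A or p is
    visited. *)
Lemma reduced_return A p z q t : reduced A (p ++ z :: q ++ z :: t) ->
  z \notin A -> z \notin p -> {in q, forall y, y \notin A /\ y \notin p} ->
  z \in q.
Proof.
elim: p A => [|x p IH] A /=.
  move=> + /negPf zA _ hq; rewrite zA => /andP[+ _]; apply: contraTT => zq.
  rewrite noret_cat_avoid /= ?zA ?eqxx //.
  by apply/allP => y yq; have [-> _] := hq y yq; apply: contraNneq zq => <-.
move=> h zA; rewrite inE negb_or => /andP[zx zp] hq.
have {}h : reduced (x |: A)%SET (p ++ z :: q ++ z :: t).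
  move: h; case: ifP => [xA|_ /andP[//]].
  by rewrite (_ : (x |: A)%SET = A) //; apply/finset.setUidPr; rewrite finset.sub1set.
apply: IH h _ zp _; first by rewrite !inE negb_or zx.
by move=> y /hq; rewrite !inE !negb_or => -[-> /andP[-> ->]].
Qed.

(** The second part of the invariant says that a final piece of the erasure missed by all erased
    loops is the literal end of the path, visited there for the first time. If the next erased loop
    met neither A nor an earlier loop, it would be such a piece, and its closure would be a return
    that [reduced] excludes. *)
Lemma reduced_inv A p : reduced A p -> let r := chron_erase [::] p in
  let ls := [seq \pi_(loop V) s | s <- r.2] in
  keep A ls = ls /\
  (forall eta1 v ys, r.1 = eta1 ++ v :: ys ->
     {in v :: ys, forall y, y \notin lsupp ls} ->
     exists2 p1, p = p1 ++ v :: ys & {in v :: ys, forall y, y \notin p1}).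
Proof.
elim/last_ind: p => [|p z IH] hp; first by split => // -[].
have {}IH := IH (reduced_prefix (_ : reduced A (p ++ [:: z]))).
rewrite cats1 in IH; move: (IH hp) => {IH}.
have um := (chron_erase_uniq p (isT : uniq [::])).1.
have mm := chron_erase_mem [::] p.
rewrite chron_erase_rcons /=; case: (chron_erase [::] p) um mm => eta ls /= ue mm [hk hI].
case: ifPn => zeta /=; last first.
  split=> // eta1 v ys; case/lastP: ys => [|ys y].
    rewrite cats1 => /rcons_inj[_ <-] hz; exists p; first by rewrite cats1.
    move=> y; rewrite inE => /eqP ->.
    by rewrite -mm (negPf zeta) /= -mem_lsupp_pi hz // inE.
  rewrite -rcons_cons -rcons_cat => /rcons_inj[e <-] hz.
  have [|p1 ep hp1] := hI _ _ _ e.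
    by move=> x hx; apply: hz; rewrite mem_rcons inE hx orbT.
  exists p1; first by rewrite ep -rcons_cat.
  move=> x; rewrite mem_rcons inE => /orP[/eqP ->|/hp1//].
  apply/negP => zp1; have := mm z; rewrite (negPf zeta) /= -mem_lsupp_pi.
  rewrite (negPf (hz _ _)); last by rewrite mem_rcons mem_head.
  by rewrite ep mem_cat zp1.
have [s1 [s2 [es xs1 -> ->]]] := split_index zeta.
rewrite map_rcons; split; last first.
  move=> eta1 v ys e hz.
  have zz : z \in v :: ys.
    case/lastP: ys e {hz} => [|ys y].
      by rewrite cats1 => /rcons_inj[_ ->]; rewrite inE.
    by rewrite -rcons_cons -rcons_cat => /rcons_inj[_ ->]; rewrite mem_rcons mem_head.
  have := hz z zz; rewrite -cats1 lsupp_cat lsupp_cons loop_supp_pi.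
  by rewrite !inE eqxx orbT.
rewrite -cats1 keep_cat hk /=; case: ifPn => // hm; exfalso; move: hm; apply/negP.
rewrite negbK; apply/meetsP; apply: contrapT => hn.
have hd y : y \in z :: s2 -> y \notin A /\ y \notin lsupp [seq \pi_(loop V) s | s <- ls].
  move=> hy; apply/andP; rewrite -negb_or -finset.in_setU; apply/negP => hyA; apply: hn.
  by exists y => //; rewrite loop_supp_pi inE.
have [|p1 ep hp1] := hI _ _ _ es; first by move=> y /hd[].
move: hp; rewrite ep -cats1 -catA /= => /reduced_return.
have [zA _] := hd z (mem_head _ _).
move=> /(_ zA (hp1 z (mem_head _ _))).
have hq : {in s2, forall y, y \notin A /\ y \notin p1}.
  move=> y ys2; have ys2' : y \in z :: s2 by rewrite inE ys2 orbT.
  by split; [have [] := hd y ys2'|exact: hp1].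
move=> /(_ hq); apply/negP.
by move: ue; rewrite es cat_uniq => /and3P[_ _ /= /andP[]].
Qed.

Lemma Phi_reduced A g : reduced A g -> Phi A (record_of g) = record_of g.
Proof.
by move=> /reduced_inv[h _]; rewrite Phi_keep record_ofE /= h.
Qed.

Lemma Phi_fits R A g lists : reduced A g -> fits (slots R A g) lists ->
  Phi A (record_of (insert_loops (g, lists))) = record_of g.
Proof.
move=> hg hl; rewrite -(Phi_reduced hg).
apply: (Phi_insert (w1 := [::]) _ hl).
by apply/setP => y; rewrite !inE orbF.
Qed.

(** The inserted loops avoid C, hence both A and x, so the order of the visits to A and to x is
    unchanged. *)
Lemma noret_insert R A C x g lists : x \in C -> A \subset C ->
  fits (slots R C g) lists -> noret A x (insert_loops (g, lists)) = noret A x g.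
Proof.
elim: g C lists => [|y g IH] C [|X lists] //= xC AC /andP[hX hl].
rewrite insert_cons; case: ifPn hX => yC hX.
  move: hX; rewrite all_pred0 => /nilP -> /=.
  rewrite (IH (y |: C)%SET) //; first by rewrite inE xC orbT.
  exact: fintype.subset_trans AC (finset.subsetUr _ _).
rewrite noret_cat_avoid /=; last first.
  apply/allP => z /flattenP[l /(allP hX)]; case: l => [|u e] //= /and3P[_ _ he].
  move=> /(allP (_ : all (mem (R :\: C)%SET) (u :: e))) => /(_ he).
  rewrite !inE => /andP[zC _]; apply/andP; split.
    by apply: contra zC => /(fintype.subsetP AC).
  by apply: contraNneq zC => ->.
rewrite (IH (y |: C)%SET) //; first by rewrite inE xC orbT.
exact: fintype.subset_trans AC (finset.subsetUr _ _).
Qed.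

(** Greedy extraction: as long as [noret] fails, the part up to the next visit to x is a return loop
    avoiding A. *)
Lemma split_returns R A x w : x \notin A -> all (mem R) (x :: w) ->
  exists X w', [/\ x :: w = flatten X ++ x :: w',
    all (first_return_loop (R :\: A)%SET x) X & noret A x w'].
Proof.
move=> xA; have [n] := ubnP (size w); elim: n w => // n IH w hn hR.
have [hx|] := boolP (noret A x w); first by exists [::], w.
have : forall w, ~~ noret A x w -> exists e w', w = e ++ x :: w' /\
    all (fun y => (y \notin A) && (y != x)) e.
  elim=> {w hn hR IH} //= y w IH; rewrite negb_or => /andP[yA]; rewrite negb_and negbK.
  have [<-|yx] /= := eqVneq y x; first by exists [::], w.
  by move=> /IH[e [w' [-> he]]]; exists (y :: e), w'; rewrite /= yA yx.
move=> /[apply] -[e [w' [ew he]]].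
move: hR hn; rewrite ew /= all_cat /= => /and4P[xR eR _ wR] hn.
have [||X [w'' [eX hX hw]]] := IH w'.
- by rewrite -ltnS; apply: leq_trans hn; rewrite size_cat /= addnS !ltnS leq_addl.
- by rewrite /= xR.
exists ((x :: e) :: X), w''; split => //; first by rewrite /= eX -catA.
rewrite /= hX eqxx !inE xA xR andbT /=; apply/andP; split.
  by apply/negP => /(allP he); rewrite eqxx andbF.
apply/allP => y ye; rewrite !inE.
by have /andP[-> _] := allP he _ ye; exact: (allP eR).
Qed.

(** The path is peeled at each new vertex. [noret] is obtained for what remains of the path, and
    [noret_insert] transfers it to the skeleton. *)
Lemma fits_exists R A w : all (mem R) w ->
  exists g lists, [/\ reduced A g, fits (slots R A g) lists,
    insert_loops (g, lists) = w & all (mem R) g].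
Proof.
have [n] := ubnP (size w); elim: n A w => // n IH A [|x w] hn hR.
  by exists [::], [::].
have [xA|xA] := boolP (x \in A).
  have /andP[xR wR] := hR.
  have [//|g [lists [hg hl hw hgR]]] := IH A w _ wR.
  exists (x :: g), ([::] :: lists); split => //=; rewrite ?xA ?hw ?hgR ?andbT //.
  - by rewrite (_ : (x |: A)%SET = A) //; apply/finset.setUidPr; rewrite finset.sub1set.
  - by rewrite insert_cons hw.
have [X [w' [e hX hw]]] := split_returns xA hR.
have /and3P[XR xR wR] : [&& all (mem R) (flatten X), x \in R & all (mem R) w'].
  by move: hR; rewrite e all_cat.
have hn' : (size w' < n)%N.
  rewrite -ltnS; apply: leq_trans hn; rewrite -[(size (x :: w)).+1]/(_.+1) e.
  by rewrite size_cat /= addnS !ltnS leq_addl.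
have [g [lists [hg hl hi hgR]]] := IH (x |: A)%SET w' hn' wR.
exists (x :: g), (X :: lists); split.
- rewrite /= (negPf xA) hg andbT -(noret_insert _ _ hl) ?hi ?finset.subsetUr //.
  by rewrite !inE eqxx.
- by rewrite /= (negPf xA) hX.
- by rewrite insert_cons hi e.
- by rewrite /= hgR andbT.
Qed.

(** A return loop ends at the next visit to x, and a tail satisfying [noret] cannot supply a further
    one; so both decompositions cut and stop at the same places. *)
Lemma returns_uniq R A x X1 X2 t1 t2 :
  all (first_return_loop (R :\: A)%SET x) X1 -> all (first_return_loop (R :\: A)%SET x) X2 ->
  noret A x t1 -> noret A x t2 ->
  flatten X1 ++ x :: t1 = flatten X2 ++ x :: t2 -> X1 = X2 /\ t1 = t2.
Proof.
have bad l X t t' : all (first_return_loop (R :\: A)%SET x) (l :: X) -> noret A x t ->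
    x :: t = flatten (l :: X) ++ x :: t' -> False.
  case: l => [|y e] //= /andP[/and3P[/eqP -> xe /andP[xRA he]] hX] nt [et].
  have [t'' e2] : exists t'', flatten X ++ x :: t' = x :: t''.
    case: X hX {et} => [|[|z e'] X] //=; first by exists t'.
    by move=> /andP[/andP[/eqP -> _] _]; exists ((e' ++ flatten X) ++ x :: t').
  move: nt; rewrite et -catA e2 noret_cat_avoid /= ?eqxx ?orbF.
    by move: xRA; rewrite inE => /andP[/negPf ->].
  apply/allP => z ze; have := allP he _ ze; rewrite !inE => /andP[-> _].
  by apply: contraNneq xe => <-.
elim: X1 X2 => [|l1 X1 IH] [|l2 X2] /=.
- by move=> _ _ _ _ [].
- by move=> _ h n1 _ /(bad l2 X2 _ _ h n1).
- by move=> h _ _ n2 /esym /(bad l1 X1 _ _ h n2).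
case: l1 => [|y1 e1] //=; case: l2 => [|y2 e2] //=.
move=> /andP[/and3P[/eqP -> x1 _] h1] /andP[/and3P[/eqP -> x2 _] h2] n1 n2 [].
rewrite -!catA.
have st X t : all (first_return_loop (R :\: A)%SET x) X ->
    exists t'', flatten X ++ x :: t = x :: t''.
  case: X => [|[|z e'] X] //=; first by exists t.
  by move=> /andP[/andP[/eqP -> _] _]; exists ((e' ++ flatten X) ++ x :: t).
move=> e; have [s1 es1] := st X1 t1 h1; have [s2 es2] := st X2 t2 h2.
move: (e); rewrite es1 es2 => e'.
have ee : e1 = e2.
  elim: e1 e2 x1 x2 e' {e} => [|z1 e1 IHe] [|z2 e2] //=; rewrite ?inE ?negb_or.
  - by move=> _ /andP[/eqP + _] [].
  - by move=> /andP[/eqP + _] _ [] /esym.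
  - by move=> /andP[_ xe1] /andP[_ xe2] [-> /IHe ->].
move: e; rewrite ee => /eqP; rewrite eqseq_cat // => /andP[_ /eqP].
by move=> /(IH _ h1 h2 n1 n2)[-> ->].
Qed.

Lemma fits_uniq R A g L1 L2 : reduced A g ->
  fits (slots R A g) L1 -> fits (slots R A g) L2 ->
  insert_loops (g, L1) = insert_loops (g, L2) -> L1 = L2.
Proof.
elim: g A L1 L2 => [|x g IH] A [|X1 L1] [|X2 L2] //= hg /andP[h1 l1] /andP[h2 l2].
rewrite !insert_cons; case: ifPn hg h1 h2 => xA hg h1 h2.
  move: h1 h2; rewrite !all_pred0 => /nilP -> /nilP -> /= [e].
  have hg' : reduced (x |: A)%SET g.
    by rewrite (_ : (x |: A)%SET = A) //; apply/finset.setUidPr; rewrite finset.sub1set.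
  by rewrite (IH _ _ _ hg' l1 l2 e).
have /andP[nx hg'] := hg.
have n1 : noret A x (insert_loops (g, L1)).
  by rewrite (noret_insert _ _ l1) ?inE ?eqxx ?finset.subsetUr.
have n2 : noret A x (insert_loops (g, L2)).
  by rewrite (noret_insert _ _ l2) ?inE ?eqxx ?finset.subsetUr.
by move=> /(returns_uniq h1 h2 n1 n2)[-> /(IH _ _ _ hg' l1 l2) ->].
Qed.

Lemma path_of_Phi R A g lists : reduced A g -> fits (slots R A g) lists ->
  path_of (Phi A (record_of (insert_loops (g, lists)))) = g.
Proof. by move=> hg hl; rewrite (Phi_fits hg hl) path_of_record. Qed.

Lemma first_visit_lists_fits R A g lists : reduced A g -> fits (slots R A g) lists ->
  first_visit_lists R A (insert_loops (g, lists)) g = lists.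
Proof.
move=> hg hl; rewrite /first_visit_lists; case: xgetP => [l -> /= /spec_fits[h e]|].
  exact: fits_uniq hg h hl e.
by move=> /(_ lists) /=; case; apply/spec_fits.
Qed.

(* The lists of skeletons [gs] that are their own entangled loop-erasure, and the
   families of lists of loops that can be attached to them. *)
Fixpoint greduced C (gs : seq (seq V)) : bool :=
  if gs is g :: gs' then reduced C g && greduced (C :|: [set x in g])%SET gs' else true.

Fixpoint gslots R C (gs : seq (seq V)) : seq (seq (pred (seq V))) :=
  if gs is g :: gs' then slots R C g :: gslots R (C :|: [set x in g])%SET gs' else [::].

Definition gfits E (ps : seq (seq (pred E))) (xs : seq (seq (seq E))) : bool :=
  all2 (@fits E) ps xs.

(** This computes [entangle], which is defined by choices, and hence the layers of an output. *)
Lemma entangle_gfits R C gs Xs : greduced C gs -> gfits (gslots R C gs) Xs ->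
  entangle R C [seq insert_loops s | s <- zip gs Xs] = zip gs Xs.
Proof.
elim: gs C Xs => [|g gs IH] C [|X Xs] //= /andP[hg hgs] /andP[hX hXs].
rewrite (path_of_Phi hg hX) (first_visit_lists_fits hg hX) (Phi_fits hg hX).
by rewrite record_supp_of IH.
Qed.

Lemma gfits_exists R C ws : all (all (mem R)) ws ->
  exists gs Xs, [/\ greduced C gs, gfits (gslots R C gs) Xs,
    [seq insert_loops s | s <- zip gs Xs] = ws & all (all (mem R)) gs].
Proof.
elim: ws C => [|w ws IH] C /=; first by exists [::], [::].
move=> /andP[/(fits_exists C)[g [X [hg hX hw hgR]]]].
move=> /(IH (C :|: [set x in g])%SET)[gs [Xs [hgs hXs hws hgsR]]].
by exists (g :: gs), (X :: Xs); rewrite /= hg hX hw hws hgR.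
Qed.

Lemma entangled_range_foldl R C gs Xs : greduced C gs -> gfits (gslots R C gs) Xs ->
  foldl (fun C w => C :|: record_supp (Phi C (record_of w)))%SET C
    [seq insert_loops s | s <- zip gs Xs] = (C :|: \bigcup_(g <- gs) [set x in g])%SET.
Proof.
elim: gs C Xs => [|g gs IH] C [|X Xs] //=.
  by rewrite big_nil finset.setU0.
move=> /andP[hg hgs] /andP[hX hXs].
by rewrite (Phi_fits hg hX) record_supp_of IH // big_cons finset.setUA.
Qed.

Lemma size_gslots R C gs : size (gslots R C gs) = size gs.
Proof. by elim: gs C => //= g gs IH C; rewrite IH. Qed.

Lemma size_slots R C g : size (slots R C g) = size g.
Proof. by elim: g C => //= x g IH C; rewrite IH. Qed.

Lemma gfits_size E (ps : seq (seq (pred E))) xs : gfits ps xs -> size xs = size ps.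
Proof. by elim: ps xs => [|p ps IH] [|x xs] //= /andP[_ /IH ->]. Qed.

Definition gsupp (gs : seq (seq V)) : {set V} := (\bigcup_(g <- gs) [set x in g])%SET.

Lemma entangled_range_gfits R gs Xs :
  greduced finset.set0 gs -> gfits (gslots R finset.set0 gs) Xs ->
  entangled_range [seq insert_loops s | s <- zip gs Xs] = gsupp gs.
Proof.
by move=> h1 h2; rewrite /entangled_range (entangled_range_foldl h1 h2) finset.set0U.
Qed.

Lemma strands_supp_zip gs (Xs : seq (seq (seq (seq V)))) : size Xs = size gs ->
  strands_supp (zip gs Xs) = gsupp gs.
Proof.
move=> h; rewrite /strands_supp /gsupp -[in RHS](@unzip1_zip _ _ gs Xs) ?h //.
by rewrite big_map.
Qed.

Lemma gfits_inj R C gs1 gs2 Xs1 Xs2 : greduced C gs1 -> gfits (gslots R C gs1) Xs1 ->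
  greduced C gs2 -> gfits (gslots R C gs2) Xs2 ->
  [seq insert_loops s | s <- zip gs1 Xs1] = [seq insert_loops s | s <- zip gs2 Xs2] ->
  gs1 = gs2 /\ Xs1 = Xs2.
Proof.
move=> g1 x1 g2 x2 e; have := entangle_gfits g1 x1; rewrite e (entangle_gfits g2 x2) => ez.
have s1 := gfits_size x1; have s2 := gfits_size x2.
rewrite !size_gslots in s1 s2.
split; [have := congr1 unzip1 ez|have := congr1 unzip2 ez].
  by rewrite !unzip1_zip ?s1 ?s2.
by rewrite !unzip2_zip ?s1 ?s2.
Qed.

End Entangle.

(** * Sums of nonnegative extended reals *)

(* Sums of nonnegative extended reals need no side condition in this semiring. *)
Record ennreal (K : realType) := Ennreal { ev :> \bar K; ev_ge0 : (0 <= ev)%E }.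
HB.instance Definition _ (K : realType) := [isSub for @ev K].
HB.instance Definition _ (K : realType) := [Choice of ennreal K by <:].

Section Ennreal.
Variable K : realType.
Implicit Types (x y z : ennreal K).

Lemma ev_inj x y : ev x = ev y -> x = y.
Proof. exact: val_inj. Qed.

Definition ennreal0 : ennreal K := Ennreal (lexx (0%E : \bar K)).
Definition ennreal1 : ennreal K := Ennreal (@lee01 K).
Definition ennreal_add x y : ennreal K := Ennreal (adde_ge0 (ev_ge0 x) (ev_ge0 y)).
Definition ennreal_mul x y : ennreal K := Ennreal (mule_ge0 (ev_ge0 x) (ev_ge0 y)).

Fact ennreal_addA : associative ennreal_add.
Proof. by move=> x y z; apply: ev_inj; rewrite /= addeA. Qed.
Fact ennreal_addC : commutative ennreal_add.
Proof. by move=> x y; apply: ev_inj; rewrite /= addeC. Qed.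
Fact ennreal_add0 : left_id ennreal0 ennreal_add.
Proof. by move=> x; apply: ev_inj; rewrite /= add0e. Qed.
Fact ennreal_mulA : associative ennreal_mul.
Proof. by move=> x y z; apply: ev_inj; rewrite /= muleA. Qed.
Fact ennreal_mulC : commutative ennreal_mul.
Proof. by move=> x y; apply: ev_inj; rewrite /= muleC. Qed.
Fact ennreal_mul1 : left_id ennreal1 ennreal_mul.
Proof. by move=> x; apply: ev_inj; rewrite /= mul1e. Qed.
Fact ennreal_mulD : left_distributive ennreal_mul ennreal_add.
Proof. by move=> x y z; apply: ev_inj; rewrite /= ge0_muleDl ?ev_ge0. Qed.
Fact ennreal_mul0 : left_zero ennreal0 ennreal_mul.
Proof. by move=> x; apply: ev_inj; rewrite /= mul0e. Qed.
Fact ennreal_1neq0 : ennreal1 != ennreal0.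
Proof. by apply/eqP => /(congr1 (@ev K)) /eqP; rewrite /= onee_eq0. Qed.

HB.instance Definition _ :=
  GRing.isNmodule.Build (ennreal K) ennreal_addA ennreal_addC ennreal_add0.
HB.instance Definition _ :=
  GRing.Nmodule_isComNzSemiRing.Build (ennreal K)
    ennreal_mulA ennreal_mulC ennreal_mul1 ennreal_mulD ennreal_mul0 ennreal_1neq0.

Lemma evD x y : ev (x + y) = (ev x + ev y)%E. Proof. by []. Qed.
Lemma evM x y : ev (x * y) = (ev x * ev y)%E. Proof. by []. Qed.

Lemma ev_prod (I : Type) (r : seq I) (P : pred I) (F : I -> ennreal K) :
  ev (\prod_(i <- r | P i) F i) = (\prod_(i <- r | P i) ev (F i))%E.
Proof. by elim/big_rec2: _ => //= i _ x _ <-. Qed.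

Fact en_subproof (r : K) : (0 <= (Num.max r 0)%:E)%E.
Proof. by rewrite lee_fin le_max lexx orbT. Qed.
(* Negative reals are sent to 0. *)
Definition en (r : K) : ennreal K := Ennreal (en_subproof r).

Lemma ev_en (r : K) : 0 <= r -> ev (en r) = r%:E.
Proof. by move=> h; rewrite /= max_l. Qed.
Lemma en0 : en 0 = 0.
Proof. by apply: ev_inj; rewrite ev_en. Qed.
Lemma en1 : en 1 = 1.
Proof. by apply: ev_inj; rewrite ev_en. Qed.
Lemma enM (a b : K) : 0 <= a -> en (a * b) = en a * en b.
Proof.
move=> a0; apply: ev_inj; rewrite evM (ev_en a0) /= -EFinM; congr EFin.
by rewrite maxr_pMr // mulr0.
Qed.
Lemma enD (a b : K) : 0 <= a -> 0 <= b -> en (a + b) = en a + en b.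
Proof. by move=> a0 b0; apply: ev_inj; rewrite evD !ev_en ?addr_ge0. Qed.
Lemma en_sum (I : Type) (r : seq I) (P : pred I) (F : I -> K) :
  (forall i, P i -> 0 <= F i) -> en (\sum_(i <- r | P i) F i) = \sum_(i <- r | P i) en (F i).
Proof.
move=> F0; elim: r => [|i r IH]; first by rewrite !big_nil en0.
by rewrite !big_cons; case: ifP => // Pi; rewrite enD ?IH ?F0 // sumr_ge0.
Qed.
Lemma en_prod (I : Type) (r : seq I) (P : pred I) (F : I -> K) :
  (forall i, P i -> 0 <= F i) -> en (\prod_(i <- r | P i) F i) = \prod_(i <- r | P i) en (F i).
Proof.
move=> F0; elim: r => [|i r IH]; first by rewrite !big_nil en1.
by rewrite !big_cons; case: ifP => // Pi; rewrite enM ?IH ?F0.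
Qed.
Lemma en_nat (n : nat) : en n%:R = n%:R.
Proof.
by elim: n => [|n IH]; rewrite ?en0 // -[in LHS]natr1 -[in RHS]natr1 enD ?ler0n // IH en1.
Qed.
(** The case n = 0 is covered because the inverse of 0 is 0. *)
Lemma en_natV (n : nat) : en (n%:R^-1) * n%:R = (n != 0%N)%:R.
Proof.
rewrite -en_nat -enM ?invr_ge0 ?ler0n //; case: n => [|n].
  by rewrite invr0 mul0r en0.
by rewrite mulVf ?en1 // pnatr_eq0.
Qed.

Fact isum_subproof (T : choiceType) (f : T -> ennreal K) :
  (0 <= \esum_(t in [set: T]) ev (f t))%E.
Proof. by apply: esum_ge0 => t _; exact: ev_ge0. Qed.
Definition isum (T : choiceType) (f : T -> ennreal K) : ennreal K := Ennreal (isum_subproof f).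

Lemma eq_isum (T : choiceType) (f g : T -> ennreal K) : f =1 g -> isum f = isum g.
Proof. by move=> h; congr isum; apply/funext. Qed.

Lemma isum0 (T : choiceType) (f : T -> ennreal K) : (forall t, f t = 0) -> isum f = 0.
Proof. by move=> h; apply: ev_inj; apply: esum1 => t _; rewrite h. Qed.

Lemma esum_scale_le (T : choiceType) (c : \bar K) (a : T -> \bar K) :
  (0 <= c)%E -> (forall t, 0 <= a t)%E ->
  (\esum_(t in [set: T]) (c * a t) <= c * \esum_(t in [set: T]) a t)%E.
Proof.
move=> c0 a0; apply: ge_ereal_sup => _ [X [finX _] <-].
rewrite fsbig_finite //= -ge0_sume_distrr //.
apply: lee_wpmul2l => //; apply: esum_ge; exists X => //.
by rewrite fsbig_finite.
Qed.

(** One inequality is [esum_scale_le]; for a finite positive constant the other one is the same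
    lemma applied to the inverse. *)
Lemma mulr_isumr (T : choiceType) (c : ennreal K) (f : T -> ennreal K) :
  c * isum f = isum (fun t => c * f t).
Proof.
apply: ev_inj; rewrite evM /=; apply/eqP; rewrite eq_le; apply/andP; split; last first.
  by apply: esum_scale_le => [|t]; exact: ev_ge0.
case: c => -[r| |] //= r0.
  have [->|rn0] := eqVneq r 0; first by rewrite mul0e; apply: esum_ge0 => t _; rewrite mul0e.
  have rp : 0 < r by rewrite lt_neqAle eq_sym rn0 -lee_fin.
  rewrite -lee_pdivlMl //; apply: le_trans (esum_scale_le _ _).
  - by apply: le_esum => t _; rewrite muleA -EFinM mulVf // mul1e.
  - by rewrite lee_fin invr_ge0 ltW.
  - by move=> t; apply: mule_ge0 => //; exact: ev_ge0.
(* For an infinite constant, either all terms vanish or a single nonzero term makes the sum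
   infinite. *)
have [h|/existsNP[t ht]] := pselect (forall t, ev (f t) = 0%E).
  rewrite (_ : \esum_(t in _) _ = 0%E)%E ?mule0; last by apply: esum1.
  by apply: esum_ge0 => t _; apply: mule_ge0 => //; exact: ev_ge0.
have ft0 : (0 < ev (f t))%E by rewrite lt_neqAle ev_ge0 andbT eq_sym; apply/eqP.
apply: esum_ge; exists [set t]%classic; first by split.
by rewrite fsbig_set1 (gt0_mulye ft0) leey.
Qed.

Lemma mulr_isuml (T : choiceType) (c : ennreal K) (f : T -> ennreal K) :
  isum f * c = isum (fun t => f t * c).
Proof. by rewrite mulrC mulr_isumr; apply: eq_isum => t; rewrite mulrC. Qed.

(** The changes of variables below are often bijective only between the supports of the weights. *)
Lemma isum_bij (T T' : choiceType) (A : set T) (B : set T') (e : T' -> T)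
    (f : T -> ennreal K) (g : T' -> ennreal K) :
  set_bij B A e -> (forall t, ~ A t -> f t = 0) -> (forall t, ~ B t -> g t = 0) ->
  (forall t, B t -> g t = f (e t)) -> isum f = isum g.
Proof.
move=> be f0 g0 fg; apply: ev_inj => /=.
transitivity (\esum_(t in A) ev (f t))%E.
  rewrite [RHS]esum_mkcond; apply: eq_esum => t _.
  by case: ifPn => //; rewrite notin_setE => /f0 ->.
rewrite (@reindex_esum _ _ _ B A e) //.
rewrite esum_mkcond; apply: eq_esum => t _.
by case: ifPn => [/set_mem /fg ->|] //; rewrite notin_setE => /g0 ->.
Qed.

Lemma isum_can (T T' : choiceType) (e : T' -> T) (d : T -> T') (f : T -> ennreal K) :
  cancel e d -> cancel d e -> isum f = isum (fun t => f (e t)).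
Proof.
move=> ed de; apply: (@isum_bij _ _ setT setT e) => //; try by move=> t [].
by split=> // [x y _ _ /(can_inj ed) //|x _]; exists (d x).
Qed.

Lemma isum_pair (T T' : choiceType) (f : T -> T' -> ennreal K) :
  isum (fun t => isum (f t)) = isum (fun p : T * T' => f p.1 p.2).
Proof.
apply: ev_inj; rewrite /= esum_esum; last by move=> *; exact: ev_ge0.
by congr esum; apply/seteqP; split.
Qed.

Lemma isum_swap (T T' : choiceType) (f : T -> T' -> ennreal K) :
  isum (fun t => isum (f t)) = isum (fun t' => isum (f^~ t')).
Proof.
rewrite !isum_pair (isum_can (e := fun p => (p.2, p.1)) (d := fun p => (p.2, p.1))) //.
  by move=> [].
by move=> [].
Qed.

Lemma isumD (T : choiceType) (f g : T -> ennreal K) :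
  isum (fun t => f t + g t) = isum f + isum g.
Proof. by apply: ev_inj; rewrite /= esumD // => t _; exact: ev_ge0. Qed.

Lemma isum_sum (T : choiceType) (I : Type) (r : seq I) (P : pred I) (f : I -> T -> ennreal K) :
  isum (fun t => \sum_(i <- r | P i) f i t) = \sum_(i <- r | P i) isum (f i).
Proof.
elim: r => [|i r IH]; first by rewrite big_nil isum0 // => t; rewrite big_nil.
rewrite big_cons -IH; case: ifP => Pi; last by apply: eq_isum => t; rewrite big_cons Pi.
by rewrite -isumD; apply: eq_isum => t; rewrite big_cons Pi.
Qed.

Lemma isum_only (T : choiceType) (t0 : T) (f : T -> ennreal K) :
  (forall t, t != t0 -> f t = 0) -> isum f = f t0.
Proof.
move=> h; apply: ev_inj => /=.
rewrite -(@esum_set1 _ _ t0 (fun t => ev (f t))) ?ev_ge0 //.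
rewrite [RHS]esum_mkcond; apply: eq_esum => t _.
by case: ifPn => //; rewrite notin_setE => /eqP /h ->.
Qed.

Lemma isum_nat (n : nat) (f : nat -> ennreal K) :
  (forall k, (n <= k)%N -> f k = 0) -> isum f = \sum_(k < n) f k.
Proof.
move=> h; transitivity (isum (fun k => \sum_(i < n) if i == k :> nat then f i else 0)).
  apply: eq_isum => k; rewrite -big_mkcond /=; have [kn|/[dup] nk /h ->] := ltnP k n.
    by rewrite (big_pred1 (Ordinal kn)).
  by rewrite big_pred0 // => i; apply/eqP => e; move: (ltn_ord i); rewrite e ltnNge nk.
rewrite isum_sum; apply: eq_bigr => i _; rewrite (isum_only (t0 := val i)) ?eqxx //.
by move=> k; rewrite eq_sym => /negPf ->.
Qed.

Lemma isum_seq (T : choiceType) (f : seq T -> ennreal K) :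
  isum f = f [::] + isum (fun x : T => isum (fun s : seq T => f (x :: s))).
Proof.
rewrite isum_pair.
have -> : isum f = isum (fun s : seq T => (if s is [::] then f [::] else 0) + (if s is _ :: _ then f s else 0)).
  by apply: eq_isum => -[|x s]; rewrite ?addr0 ?add0r.
rewrite isumD (isum_only (t0 := [::])); last by case.
congr (_ + _).
apply: (@isum_bij _ _ [set s | s != [::]]%classic setT (fun p : T * seq T => p.1 :: p.2)) => //; try by move=> t [].
- split => //= [[x s] [y t] _ _ /= [-> ->] //|[|x s] //= _].
  exact: (ex_intro2 _ _ (x, s) I erefl).
- by move=> [|x s] //= [].
Qed.

End Ennreal.

(** * Finite laws and thinning *)

Section FiniteLaws.
Variable K : realType.
Local Notation E0 := (ennreal K).

Definition fint (E : Type) (mu : flaw K E) (f : E -> E0) : E0 := \sum_(p <- mu) en p.1 * f p.2.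

Definition nonnegf (E : Type) (mu : flaw K E) : bool := all (fun p => 0 <= p.1) mu.

Definition supported (E : Type) (S : pred E) (mu : flaw K E) : bool := all (fun p => S p.2) mu.

Lemma fint_ret (E : Type) (x : E) f : fint (flaw_ret K x) f = f x.
Proof. by rewrite /fint big_seq1 en1 mul1r. Qed.

Lemma eq_fint (E : Type) (mu : flaw K E) f g : f =1 g -> fint mu f = fint mu g.
Proof. by move=> h; apply: eq_bigr => p _; rewrite h. Qed.

Lemma eq_fint_on (E : Type) (S : pred E) (mu : flaw K E) f g : supported S mu ->
  (forall x, S x -> f x = g x) -> fint mu f = fint mu g.
Proof.
move=> + h; elim: mu => [|p mu IH] /=; first by rewrite /fint !big_nil.
by move=> /andP[Sp /IH]; rewrite /fint !big_cons h // => ->.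
Qed.

Lemma fint_bind (E F : Type) (mu : flaw K E) (k : E -> flaw K F) f : nonnegf mu ->
  fint (flaw_bind mu k) f = fint mu (fun x => fint (k x) f).
Proof.
elim: mu => [|p mu IH] /=; first by rewrite /fint !big_nil.
move=> /andP[p0 /IH {}IH]; rewrite /fint /flaw_bind /= big_cat /= big_cons.
congr (_ + _); last exact: IH.
by rewrite big_map big_distrr /=; apply: eq_bigr => q _; rewrite enM // mulrA.
Qed.

Lemma nonnegf_ret (E : Type) (x : E) : nonnegf (flaw_ret K x).
Proof. by rewrite /nonnegf /= ler01. Qed.

Lemma nonnegf_bind (E F : Type) (mu : flaw K E) (k : E -> flaw K F) :
  nonnegf mu -> (forall x, nonnegf (k x)) -> nonnegf (flaw_bind mu k).
Proof.
move=> + hk; elim: mu => //= p mu IH /andP[p0 /IH h].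
rewrite /nonnegf /flaw_bind /= all_cat; apply/andP; split; last exact: h.
rewrite all_map; apply: sub_all (hk p.2) => q /=; exact: mulr_ge0.
Qed.

Lemma nonnegf_map (E F : Type) (k : E -> flaw K F) s :
  (forall x, nonnegf (k x)) -> nonnegf (flaw_map k s).
Proof.
move=> hk; elim: s => [|x s IH] /=; first exact: nonnegf_ret.
by apply: nonnegf_bind => // y; apply: nonnegf_bind => // ys; exact: nonnegf_ret.
Qed.

Lemma nonnegf_uniform (E : Type) (s : seq E) : nonnegf (flaw_uniform K s).
Proof.
rewrite /nonnegf /flaw_uniform; have : 0 <= (size s)%:R^-1 :> K by rewrite invr_ge0 ler0n.
by move: (_^-1) => c c0; elim: s => //= x s ->; rewrite c0.
Qed.

Lemma fint_map_cons (E F : Type) (k : E -> flaw K F) x s f : (forall x, nonnegf (k x)) ->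
  fint (flaw_map k (x :: s)) f =
  fint (k x) (fun y => fint (flaw_map k s) (fun ys => f (y :: ys))).
Proof.
move=> hk /=; rewrite fint_bind //; apply: eq_fint => y.
rewrite fint_bind; last exact: nonnegf_map.
by apply: eq_fint => ys; rewrite fint_ret.
Qed.

Lemma supported_ret (E : Type) (S : pred E) x : supported S (flaw_ret K x) = S x.
Proof. by rewrite /supported /= andbT. Qed.

Lemma supported_bind (E F : Type) (S : pred E) (S' : pred F) (mu : flaw K E) (k : E -> flaw K F) :
  supported S mu -> (forall x, S x -> supported S' (k x)) -> supported S' (flaw_bind mu k).
Proof.
move=> + hk; elim: mu => //= p mu IH /andP[/hk p0 /IH h].
rewrite /supported /flaw_bind /= all_cat all_map; apply/andP; split; last exact: h.
exact: p0.
Qed.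

Lemma supported_map (E F : Type) (S : pred E) (S' : E -> pred F) (k : E -> flaw K F) s :
  all S s -> (forall x, S x -> supported (S' x) (k x)) ->
  supported (all2 S' s) (flaw_map k s).
Proof.
move=> + hk; elim: s => [|x s IH] //= /andP[/hk Sx /IH h].
apply: supported_bind Sx _ => y Sy; apply: supported_bind h _ => ys Sys.
by rewrite supported_ret /= Sy.
Qed.

Lemma fint_isum (E : Type) (T : choiceType) (mu : flaw K E) (f : E -> T -> E0) :
  fint mu (fun x => isum (f x)) = isum (fun t => fint mu (f^~ t)).
Proof.
by rewrite /fint isum_sum; apply: eq_bigr => p _; rewrite mulr_isumr.
Qed.

Lemma fint_swap (E F : Type) (mu : flaw K E) (nu : flaw K F) f :
  fint mu (fun x => fint nu (f x)) = fint nu (fun y => fint mu (f^~ y)).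
Proof.
rewrite /fint; under eq_bigr do rewrite big_distrr.
rewrite exchange_big; apply: eq_bigr => q _; rewrite big_distrr /=.
by apply: eq_bigr => p _; rewrite mulrCA.
Qed.

Lemma fintZ (E : Type) (mu : flaw K E) c f : fint mu (fun x => c * f x) = c * fint mu f.
Proof. by rewrite /fint big_distrr; apply: eq_bigr => p _; rewrite mulrCA. Qed.

Definition wint (E : choiceType) (w h : E -> E0) : E0 := isum (fun x => w x * h x).

Lemma eq_wint (E : choiceType) (w h1 h2 : E -> E0) : h1 =1 h2 -> wint w h1 = wint w h2.
Proof. by move=> h; apply: eq_isum => x; rewrite h. Qed.

Lemma eq_wint_on (E : choiceType) (w h1 h2 : E -> E0) :
  (forall x, w x != 0 -> h1 x = h2 x) -> wint w h1 = wint w h2.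
Proof.
by move=> h; apply: eq_isum => x; have [->|/h ->//] := eqVneq (w x) 0; rewrite !mul0r.
Qed.

Lemma wintZ (E : choiceType) (w h : E -> E0) c : wint w (fun x => c * h x) = c * wint w h.
Proof. by rewrite /wint mulr_isumr; apply: eq_isum => x; rewrite mulrCA. Qed.

Lemma wint_swap (E F : choiceType) (w : E -> E0) (v : F -> E0) f :
  wint w (fun x => wint v (f x)) = wint v (fun y => wint w (f^~ y)).
Proof.
rewrite /wint; under eq_isum do rewrite mulr_isumr.
rewrite isum_swap; apply: eq_isum => y; rewrite mulr_isumr.
by apply: eq_isum => x; rewrite mulrCA.
Qed.

Lemma wint_fint (E : choiceType) (F : Type) (w : E -> E0) (mu : flaw K F) f :
  wint w (fun x => fint mu (f x)) = fint mu (fun y => wint w (f^~ y)).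
Proof.
by rewrite fint_isum; apply: eq_isum => x; rewrite fintZ.
Qed.

Fixpoint plist (E : choiceType) (ws : seq (E -> E0)) (xs : seq E) : E0 :=
  match ws, xs with
  | [::], [::] => 1
  | w :: ws', x :: xs' => w x * plist ws' xs'
  | _, _ => 0
  end.

Lemma wint_plist_nil (E : choiceType) (h : seq E -> E0) : wint (plist [::]) h = h [::].
Proof. by rewrite /wint (isum_only (t0 := [::])) ?mul1r // => -[|x s] //= _; rewrite mul0r. Qed.

Lemma wint_plist_cons (E : choiceType) (w : E -> E0) ws (h : seq E -> E0) :
  wint (plist (w :: ws)) h = wint w (fun x => wint (plist ws) (fun xs => h (x :: xs))).
Proof.
rewrite /wint isum_seq /= mul0r add0r; apply: eq_isum => x; rewrite mulr_isumr.
by apply: eq_isum => s; rewrite mulrA.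
Qed.

(** Lifts from one slot to a list of slots the fact that a kernel turns the weight w1 into w3, up to
    the mass of an independent w2. It is used at two levels, for the times of a path and for the
    paths. *)
Lemma plist_flaw_map (A : Type) (E F D : choiceType) (k : E -> flaw K F)
    (w1 : A -> E -> E0) (w2 : A -> D -> E0) (w3 : A -> F -> E0) (xs : seq A) :
  (forall x, nonnegf (k x)) ->
  (forall x h, wint (w1 x) (fun X => fint (k X) h) = wint (w2 x) (fun=> wint (w3 x) h)) ->
  forall H, wint (plist [seq w1 x | x <- xs]) (fun Xs => fint (flaw_map k Xs) H) =
    wint (plist [seq w2 x | x <- xs]) (fun=> wint (plist [seq w3 x | x <- xs]) H).
Proof.
move=> hk hw; elim: xs => [|x xs IH] H; first by rewrite /= !wint_plist_nil fint_ret.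
rewrite !map_cons !wint_plist_cons.
transitivity (wint (w1 x) (fun X => fint (k X) (fun Y =>
    wint (plist [seq w1 x0 | x0 <- xs]) (fun Xs => fint (flaw_map k Xs) (fun Ys => H (Y :: Ys)))))).
  apply: eq_wint => X; rewrite -wint_fint; apply: eq_wint => Xs; exact: fint_map_cons.
rewrite hw; apply: eq_wint => _.
rewrite [RHS]wint_swap; apply: eq_wint => Y; exact: IH.
Qed.

Lemma plist_zip (A : Type) (E F G : choiceType) (op : E -> F -> G)
    (w1 : A -> G -> E0) (w2 : A -> E -> E0) (w3 : A -> F -> E0) (xs : seq A) :
  (forall x h, wint (w2 x) (fun D => wint (w3 x) (fun Y => h (op D Y))) = wint (w1 x) h) ->
  forall H, wint (plist [seq w2 x | x <- xs]) (fun Ds =>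
      wint (plist [seq w3 x | x <- xs]) (fun Ys => H [seq op p.1 p.2 | p <- zip Ds Ys])) =
    wint (plist [seq w1 x | x <- xs]) H.
Proof.
move=> hw; elim: xs => [|x xs IH] H; first by rewrite /= !wint_plist_nil.
rewrite !map_cons !wint_plist_cons -hw; apply: eq_wint => D.
transitivity (wint (plist [seq w2 x0 | x0 <- xs]) (fun Ds => wint (w3 x) (fun Y =>
   wint (plist [seq w3 x0 | x0 <- xs]) (fun Ys => H (op D Y :: [seq op p.1 p.2 | p <- zip Ds Ys]))))).
  by apply: eq_wint => Ds; rewrite wint_plist_cons.
rewrite wint_swap; apply: eq_wint => Y; exact: (IH (fun Ys => H (op D Y :: Ys))).
Qed.

(** A pair of lists is a list with a cut point. *)
Lemma isum_cat (E : choiceType) (G : seq E -> seq E -> E0) :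
  isum (fun D => isum (G D)) =
  isum (fun X : seq E => \sum_(k < (size X).+1) G (take k X) (drop k X)).
Proof.
transitivity (isum (fun X : seq E => isum (fun k : nat =>
    if (k < (size X).+1)%N then G (take k X) (drop k X) else 0))); last first.
  apply: eq_isum => X; rewrite (isum_nat (n := (size X).+1)).
    by apply: eq_bigr => k _; rewrite ltn_ord.
  by move=> k; rewrite leqNgt => /negPf ->.
rewrite !isum_pair; apply/esym.
apply: (@isum_bij _ _ _ [set p : seq E * nat | (p.2 < (size p.1).+1)%N]%classic setT
   (fun p : seq E * seq E => (p.1 ++ p.2, size p.1))) => //=.
- split => [[D Y] _ /=|[D Y] [D' Y'] _ _ /= []|[X k] /= hk].
  + by rewrite size_cat ltnS leq_addr.
  + by move=> + hs => /eqP; rewrite eqseq_cat // => /andP[/eqP -> /eqP ->].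
  + by exists (take k X, drop k X) => //=; rewrite cat_take_drop size_takel.
- by move=> [X k] /= /negP/negPf ->.
- by move=> [D Y] _ /=; rewrite size_cat ltnS leq_addr take_size_cat // drop_size_cat.
Qed.

Section Slots.
Variables (E : choiceType) (q : E -> E0).

(** The coefficient depends only on the length, so a stands for the power series with coefficients a
    n, and concatenation of independent lists multiplies the series. *)
Definition lweight (a : nat -> E0) (p : pred E) (X : seq E) : E0 :=
  (all p X)%:R * (\prod_(l <- X) q l) * a (size X).

Lemma wint_lweight_cat (a b : nat -> E0) p (h : seq E -> seq E -> E0) :
  wint (lweight a p) (fun D => wint (lweight b p) (h D)) =
  wint (lweight (fun=> 1) p) (fun X => \sum_(k < (size X).+1)
     a k * b (size X - k)%N * h (take k X) (drop k X)).
Proof.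
rewrite /wint; under eq_isum do rewrite mulr_isumr.
rewrite isum_cat; apply: eq_isum => X; rewrite big_distrr; apply: eq_bigr => k _ /=.
have hk : (k <= size X)%N by rewrite -ltnS.
move: (nat_of_ord k) hk => {}k hk.
have e1 : all p X = all p (take k X) && all p (drop k X) by rewrite -all_cat cat_take_drop.
have e2 : \prod_(l <- X) q l = (\prod_(l <- take k X) q l) * \prod_(l <- drop k X) q l.
  by rewrite -big_cat cat_take_drop.
rewrite /lweight e1 e2 size_drop size_takel // -mulnb natrM; ring.
Qed.

End Slots.

Lemma risingS (x : K) n : rising x n.+1 = rising x n * (x + n%:R).
Proof. by rewrite /rising big_ord_recr. Qed.

Lemma rising_ge0 (x : K) n : 0 <= x -> 0 <= rising x n.
Proof. by move=> x0; apply: prodr_ge0 => i _; rewrite addr_ge0 ?ler0n. Qed.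

(* The coefficients of (1 - t)^-x. *)
Definition rcoef (x : K) n : K := rising x n / n`!%:R.

Lemma rcoef0 x : rcoef x 0 = 1.
Proof. by rewrite /rcoef /rising big_ord0 fact0 divr1. Qed.

Lemma rcoefS x n : n.+1%:R * rcoef x n.+1 = (x + n%:R) * rcoef x n.
Proof.
rewrite /rcoef risingS factS natrM.
have h1 : (n.+1%:R : K) != 0 by rewrite pnatr_eq0.
have h2 : (n`!%:R : K) != 0 by rewrite pnatr_eq0 -lt0n fact_gt0.
move: (n.+1%:R) h1 (n`!%:R) h2 => c h1 e h2.
by field; rewrite h1 h2.
Qed.

Lemma rcoef_ge0 x n : 0 <= x -> 0 <= rcoef x n.
Proof. by move=> x0; rewrite divr_ge0 ?rising_ge0 ?ler0n. Qed.

(** The product f of (1 - t)^-x and (1 - t)^-y satisfies (1 - t) f' = (x + y) f; this is that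
    equation on coefficients. *)
Lemma rcoef_conv x y d :
  d.+1%:R * (\sum_(k < d.+2) rcoef x k * rcoef y (d.+1 - k)%N) =
  (x + y + d%:R) * \sum_(k < d.+1) rcoef x k * rcoef y (d - k)%N.
Proof.
(* Writing d.+1 as k + (d.+1 - k) differentiates one factor or the other. *)
transitivity (\sum_(k < d.+2) k%:R * rcoef x k * rcoef y (d.+1 - k)%N +
  \sum_(k < d.+2) rcoef x k * ((d.+1 - k)%N%:R * rcoef y (d.+1 - k)%N)).
  rewrite big_distrr -big_split; apply: eq_bigr => k _ /=.
  rewrite -mulrA [rcoef x k * (_ * _)]mulrCA -mulrDl -natrD subnKC //.
  by rewrite -ltnS.
have -> : \sum_(k < d.+2) k%:R * rcoef x k * rcoef y (d.+1 - k)%N =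
    \sum_(k < d.+1) k.+1%:R * rcoef x k.+1 * rcoef y (d - k)%N.
  by rewrite big_ord_recl /= !mul0r add0r.
have -> : \sum_(k < d.+2) rcoef x k * ((d.+1 - k)%N%:R * rcoef y (d.+1 - k)%N) =
    \sum_(k < d.+1) rcoef x k * ((d.+1 - k)%N%:R * rcoef y (d.+1 - k)%N).
  by rewrite big_ord_recr /= subnn mul0r mulr0 addr0.
rewrite -big_split big_distrr; apply: eq_bigr => k _ /=.
have hk : (k <= d)%N by rewrite -ltnS.
rewrite rcoefS subSn // rcoefS natrB //.
move: (rcoef x k) (rcoef y _) (k%:R) (d%:R) => c e u v; ring.
Qed.

(** For x + y = 1 the recursion [rcoef_conv] says that consecutive coefficients of the product are
    equal. *)
Lemma thinning_sum (lambda : K) d :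
  \sum_(k < d.+1) thinning_weight lambda d k = 1.
Proof.
rewrite [LHS](_ : _ = \sum_(k < d.+1) rcoef lambda k * rcoef (1 - lambda) (d - k)%N) //.
elim: d => [|d IH]; first by rewrite big_ord1 !rcoef0 mulr1.
have h : (d.+1%:R : K) != 0 by rewrite pnatr_eq0.
apply: (mulfI h); rewrite rcoef_conv IH; rewrite -natr1; ring.
Qed.

Section Thinning.
Variables (E : choiceType) (q : E -> E0) (lambda : K).
Hypothesis lambda_bounds : 0 <= lambda <= 1.

Let l0 : 0 <= lambda. Proof. by case/andP: lambda_bounds. Qed.
Let l1 : 0 <= 1 - lambda. Proof. by rewrite subr_ge0; case/andP: lambda_bounds. Qed.

Definition deleted n : E0 := en (rcoef lambda n).
Definition retained n : E0 := en (rcoef (1 - lambda) n).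

Lemma en_thinning d k : en (thinning_weight lambda d k) = deleted k * retained (d - k)%N.
Proof. by rewrite /deleted /retained -enM ?rcoef_ge0. Qed.

Lemma nonnegf_thin (X : seq E) : nonnegf (thin_list lambda X).
Proof.
rewrite /nonnegf all_map; apply/allP => k _ /=.
by rewrite mulr_ge0 ?(rcoef_ge0 _ l0) ?(rcoef_ge0 _ l1).
Qed.

Lemma fint_thin (X : seq E) h :
  fint (thin_list lambda X) h =
  \sum_(k < (size X).+1) deleted k * retained (size X - k)%N * h (drop k X).
Proof.
rewrite /fint /thin_list big_map -[iota _ _]/(index_iota 0 (size X).+1) big_mkord.
by apply: eq_bigr => k _; rewrite en_thinning.
Qed.

(* Thinning makes the deleted and the retained loops independent. *)
Lemma thin_split p h :
  wint (lweight q (fun=> 1) p) (fun X => fint (thin_list lambda X) h) =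
  wint (lweight q deleted p) (fun=> wint (lweight q retained p) h).
Proof.
by rewrite wint_lweight_cat; apply: eq_wint => X; rewrite fint_thin.
Qed.

(** The thinning weights sum to 1, so concatenation restores the coefficient 1 at every length. *)
Lemma thin_merge p h :
  wint (lweight q deleted p) (fun D => wint (lweight q retained p) (fun Y => h (D ++ Y))) =
  wint (lweight q (fun=> 1) p) h.
Proof.
rewrite wint_lweight_cat; apply: eq_wint => X.
under eq_bigr do rewrite cat_take_drop -en_thinning.
rewrite -big_distrl /= -en_sum ?thinning_sum ?en1 ?mul1r // => k _.
by rewrite mulr_ge0 ?(rcoef_ge0 _ l0) ?(rcoef_ge0 _ l1).
Qed.

End Thinning.

End FiniteLaws.

(** * Poisson soups *)

Section Soup.
Variable K : realType.
Local Notation E0 := (ennreal K).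

Fixpoint iint (E : choiceType) (w : E -> E0) (m : nat) (H : seq E -> E0) : E0 :=
  if m is m'.+1 then wint w (fun x => iint w m' (fun s => H (x :: s))) else H [::].

(* The Poisson process of intensity [w], without its normalization. *)
Definition soup (E : choiceType) (w : E -> E0) (phi : seq E -> E0) : E0 :=
  isum (fun m => en (m`!%:R^-1) * iint w m phi).

Lemma eq_iint_on (E : choiceType) (w : E -> E0) m f g :
  (forall s, all (fun x => w x != 0) s -> f s = g s) -> iint w m f = iint w m g.
Proof.
elim: m f g => [|m IH] f g h /=; first exact: h.
by apply: eq_wint_on => x wx; apply: IH => s hs; apply: h; rewrite /= wx.
Qed.

Lemma eq_soup_on (E : choiceType) (w : E -> E0) f g :
  (forall s, all (fun x => w x != 0) s -> f s = g s) -> soup w f = soup w g.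
Proof. by move=> h; apply: eq_isum => m; rewrite (eq_iint_on _ h). Qed.

Lemma eq_iint (E : choiceType) (w : E -> E0) m f g : f =1 g -> iint w m f = iint w m g.
Proof. by move=> h; apply: eq_iint_on. Qed.

Lemma eq_soup (E : choiceType) (w : E -> E0) f g : f =1 g -> soup w f = soup w g.
Proof. by move=> h; apply: eq_soup_on. Qed.

Lemma iintZ (E : choiceType) (w : E -> E0) m c f :
  iint w m (fun s => c * f s) = c * iint w m f.
Proof.
elim: m f => //= m IH f; rewrite -wintZ; apply: eq_wint => x; exact: IH.
Qed.

Lemma soupZ (E : choiceType) (w : E -> E0) c f : soup w (fun s => c * f s) = c * soup w f.
Proof. by rewrite /soup mulr_isumr; apply: eq_isum => m; rewrite iintZ mulrCA. Qed.

Lemma iint_isum (E T : choiceType) (w : E -> E0) m (f : seq E -> T -> E0) :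
  iint w m (fun s => isum (f s)) = isum (fun t => iint w m (f^~ t)).
Proof.
elim: m f => //= m IH f; rewrite /wint isum_swap; apply: eq_isum => x.
by rewrite IH mulr_isumr.
Qed.

Lemma iint_wint (E F : choiceType) (w : E -> E0) (v : F -> E0) m f :
  iint w m (fun s => wint v (f s)) = wint v (fun y => iint w m (f^~ y)).
Proof. by rewrite /wint iint_isum; apply: eq_isum => y; rewrite iintZ. Qed.

Lemma iint_fint (E : choiceType) (F : Type) (w : E -> E0) (mu : flaw K F) m f :
  iint w m (fun s => fint mu (f s)) = fint mu (fun y => iint w m (f^~ y)).
Proof. by elim: m f => //= m IH f; rewrite -wint_fint; apply: eq_wint => x; exact: IH. Qed.

Lemma soup_fint (E : choiceType) (F : Type) (w : E -> E0) (mu : flaw K F) f :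
  soup w (fun s => fint mu (f s)) = fint mu (fun y => soup w (f^~ y)).
Proof.
rewrite /soup fint_isum; apply: eq_isum => m.
by rewrite iint_fint fintZ.
Qed.

Lemma soup0 (E : choiceType) (w : E -> E0) f : (forall x, w x = 0) -> soup w f = f [::].
Proof.
move=> h; rewrite /soup (isum_only (t0 := 0%N)) /=; first by rewrite invr1 en1 mul1r.
move=> [|m] //= _; rewrite /wint isum0 ?mulr0 // => x; by rewrite h mul0r.
Qed.

Definition restrict (E : Type) (p : pred E) (w : E -> E0) (x : E) : E0 := (p x)%:R * w x.

Lemma wint_restrict (E : choiceType) (p : pred E) (w : E -> E0) h :
  wint w h = wint (restrict p w) h + wint (restrict (predC p) w) h.
Proof.
rewrite /wint -isumD; apply: eq_isum => x; rewrite /restrict /=.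
by case: (p x); rewrite /= ?mul0r ?mul1r ?addr0 ?add0r.
Qed.

Lemma eq_wint_restrict (E : choiceType) (p : pred E) (w : E -> E0) h1 h2 :
  (forall x, p x -> h1 x = h2 x) -> wint (restrict p w) h1 = wint (restrict p w) h2.
Proof.
move=> h; apply: eq_isum => x; rewrite /restrict.
by have [/h ->//|] := boolP (p x); rewrite !mul0r.
Qed.

(** Pascal's rule, according to whether the first point satisfies p. *)
Lemma iint_split (E : choiceType) (p : pred E) (w : E -> E0) m (F : seq E -> seq E -> E0) :
  iint w m (fun s => F (seq.filter p s) (seq.filter (predC p) s)) =
  \sum_(j < m.+1) 'C(m, j)%:R *
    iint (restrict p w) j (fun s1 => iint (restrict (predC p) w) (m - j)%N (F s1)).
Proof.
elim: m F => [|m IH] F; first by rewrite big_ord1 bin0 mul1r.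
rewrite [LHS]/= (wint_restrict p).
set A := fun j k => iint (restrict p w) j (fun s1 => iint (restrict (predC p) w) k (F s1)).
have -> : wint (restrict p w) (fun x => iint w m (fun s =>
      F (if p x then x :: seq.filter p s else seq.filter p s)
        (if ~~ p x then x :: seq.filter (predC p) s else seq.filter (predC p) s))) =
    \sum_(j < m.+1) 'C(m, j)%:R * A j.+1 (m - j)%N.
  transitivity (wint (restrict p w) (fun x => \sum_(j < m.+1) 'C(m, j)%:R *
      iint (restrict p w) j (fun s1 => iint (restrict (predC p) w) (m - j)%N (F (x :: s1))))).
    by apply: eq_wint_restrict => x ->; rewrite (IH (fun s => F (x :: s))).
  rewrite /wint; under eq_isum do rewrite big_distrr.
  rewrite isum_sum; apply: eq_bigr => j _; rewrite /A /= /wint mulr_isumr.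
  by apply: eq_isum => x /=; rewrite mulrCA.
have -> : wint (restrict (predC p) w) (fun x => iint w m (fun s =>
      F (if p x then x :: seq.filter p s else seq.filter p s)
        (if ~~ p x then x :: seq.filter (predC p) s else seq.filter (predC p) s))) =
    \sum_(j < m.+1) 'C(m, j)%:R * A j (m - j).+1.
  transitivity (wint (restrict (predC p) w) (fun x => \sum_(j < m.+1) 'C(m, j)%:R *
      iint (restrict p w) j (fun s1 => iint (restrict (predC p) w) (m - j)%N
        (fun s2 => F s1 (x :: s2))))).
    apply: eq_wint_restrict => x /= /negPf ->.
    by rewrite (IH (fun s1 s2 => F s1 (x :: s2))).
  rewrite /wint; under eq_isum do rewrite big_distrr.
  rewrite isum_sum; apply: eq_bigr => j _; rewrite /A /= iint_wint /wint mulr_isumr.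
  by apply: eq_isum => x /=; rewrite mulrCA.
change (\sum_(j < m.+1) 'C(m, j)%:R * A j.+1 (m - j)%N +
  \sum_(j < m.+1) 'C(m, j)%:R * A j (m - j).+1 =
  \sum_(j < m.+2) 'C(m.+1, j)%:R * A j (m.+1 - j)%N).
move: A => A; rewrite [RHS]big_ord_recl /= bin0 subn0.
rewrite [X in _ + X = _]big_ord_recl /= bin0 subn0 addrCA; congr (_ + _).
transitivity (\sum_(j < m.+1) 'C(m, j)%:R * A j.+1 (m - j)%N +
   \sum_(j < m.+1) 'C(m, j.+1)%:R * A j.+1 (m - j)%N).
  congr (_ + _); rewrite big_ord_recr /= bin_small // mul0r addr0.
  by apply: eq_bigr => j _; rewrite /bump /= add1n subnSK.
rewrite -big_split; apply: eq_bigr => j _ /=.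
by rewrite /bump /= add1n binS subSS addnC natrD mulrDl.
Qed.

Lemma isum_conv (G : nat -> nat -> E0) :
  isum (fun j => isum (G j)) = isum (fun m => \sum_(j < m.+1) G j (m - j)%N).
Proof.
transitivity (isum (fun m : nat => isum (fun j : nat =>
    if (j < m.+1)%N then G j (m - j)%N else 0))); last first.
  apply: eq_isum => m; rewrite (isum_nat (n := m.+1)).
    by apply: eq_bigr => j _; rewrite ltn_ord.
  by move=> j; rewrite leqNgt => /negPf ->.
rewrite !isum_pair; apply/esym.
apply: (@isum_bij _ _ _ [set p : nat * nat | (p.2 < p.1.+1)%N]%classic setT
   (fun p : nat * nat => ((p.1 + p.2)%N, p.1))) => //=.
- split => [[j k] _ /=|[j k] [j' k'] _ _ /= []|[m j] /= hj].
  + by rewrite ltnS leq_addr.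
  + by move=> + hj => /eqP; rewrite hj eqn_add2l => /eqP ->.
  + by exists (j, m - j)%N => //=; rewrite subnKC.
- by move=> [m j] /= /negP/negPf ->.
- by move=> [j k] _ /=; rewrite ltnS leq_addr addKn.
Qed.

(** Independence of the Poisson points in complementary sets: dividing the binomial coefficient by
    m! leaves the two factorials of the separate exponential series. *)
Lemma soup_split (E : choiceType) (p : pred E) (w : E -> E0) (F : seq E -> seq E -> E0) :
  soup w (fun s => F (seq.filter p s) (seq.filter (predC p) s)) =
  soup (restrict p w) (fun s1 => soup (restrict (predC p) w) (F s1)).
Proof.
rewrite /soup.
under [RHS]eq_isum => j do rewrite iint_isum mulr_isumr.
rewrite isum_conv; apply: eq_isum => m; rewrite iint_split big_distrr.
apply: eq_bigr => j _ /=; rewrite iintZ !mulrA; congr (_ * _).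
have jm : (j <= m)%N by rewrite -ltnS.
have h n : (n`!%:R : K) != 0 by rewrite pnatr_eq0 -lt0n fact_gt0.
rewrite -en_nat -!enM ?invr_ge0 ?ler0n //; congr en.
rewrite -(bin_fact jm) !natrM !invfM mulrAC mulVf ?mul1r //.
by rewrite pnatr_eq0 -lt0n bin_gt0.
Qed.

(** Kernels that read disjoint parts of the soup have independent outputs. The index [idx] makes the
    parts disjoint, and together they carry the whole intensity. *)
Lemma soup_flaw_map (A : eqType) (E F : choiceType) (idx : A -> nat) (p : A -> pred E)
    (kern : A -> seq E -> flaw K F) (wx : A -> F -> E0) (w : E -> E0) (xs : seq A) :
  (forall x c, nonnegf (kern x c)) ->
  (forall x c, kern x c = kern x (seq.filter (p x) c)) ->
  uniq (map idx xs) ->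
  (forall x y l, p x l -> p y l -> idx x = idx y) ->
  (forall l, w l != 0 -> has (p^~ l) xs) ->
  (forall x h, x \in xs ->
     soup (restrict (p x) w) (fun c => fint (kern x c) h) = wint (wx x) h) ->
  forall H, soup w (fun c => fint (flaw_map (kern^~ c) xs) H) = wint (plist (map wx xs)) H.
Proof.
move=> hk hp + hidx; elim: xs w => [|x xs IH] w /=.
  move=> _ w0 _ H; rewrite wint_plist_nil soup0 ?fint_ret // => l.
  by apply/eqP; apply: contraT => /w0.
move=> /andP[xxs uxs] hw hx H; rewrite wint_plist_cons.
have disj y l : y \in xs -> p y l -> ~~ p x l.
  move=> yxs py; apply: contra xxs => px; rewrite (hidx _ _ _ px py).
  by apply/mapP; exists y.
pose q := p x.
pose G c1 c2 := fint (kern x c1) (fun Y =>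
    fint (flaw_map (kern^~ c2) xs) (fun Ys => H (Y :: Ys))).
transitivity (soup w (fun c => G (seq.filter q c) (seq.filter (predC q) c))).
  apply: eq_soup => c; rewrite /G -(hp x c).
  have := fint_map_cons x xs H (hk ^~ c) => /= ->; apply: eq_fint => Y.
  congr fint; elim: (xs) disj => // y ys IHy dj /=.
  rewrite IHy; last by move=> z l zys; apply: dj; rewrite inE zys orbT.
  congr flaw_bind; rewrite hp [RHS]hp -filter_predI; congr kern; apply: eq_filter => l /=.
  by case py : (p y l) => //=; rewrite (dj y l) ?inE ?eqxx.
rewrite soup_split /G.
transitivity (soup (restrict q w) (fun c1 => fint (kern x c1) (fun Y =>
   wint (plist (map wx xs)) (fun Ys => H (Y :: Ys))))).
  apply: eq_soup => c1; rewrite soup_fint; apply: eq_fint => Y.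
  apply: IH => //.
  - move=> l; rewrite /restrict /=; case pxl : (q l); first by rewrite mul0r eqxx.
    by rewrite mul1r => /hw; rewrite /= -/q pxl.
  - move=> y h yxs; rewrite -(hx y h) ?inE ?yxs ?orbT //; congr soup.
    apply/funext => l; rewrite /restrict /=; case py : (p y l); last by rewrite !mul0r.
    by rewrite (disj y l) ?mul1r.
by rewrite -hx // inE eqxx.
Qed.

(** The marking theorem for Poisson processes, with k applied independently to each point. *)
Lemma soup_transfer (E F : choiceType) (w : E -> E0) (k : E -> flaw K F) (v : F -> E0) :
  (forall x, nonnegf (k x)) ->
  (forall h, wint w (fun x => fint (k x) h) = wint v h) ->
  forall H, soup w (fun c => fint (flaw_map k c) H) = soup v H.
Proof.
move=> hk hw H; apply: eq_isum => m; congr (_ * _).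
elim: m H => [|m IH] H; first by rewrite /= fint_ret.
rewrite [RHS]/= -hw; apply: eq_wint => x /=.
transitivity (iint w m (fun s => fint (k x) (fun y => fint (flaw_map k s) (fun ys => H (y :: ys))))).
  apply: eq_iint => s; exact: fint_map_cons.
by rewrite iint_fint; apply: eq_fint => y; exact: IH.
Qed.

Lemma iint_map (E F : choiceType) (w : E -> E0) (v : F -> E0) (f : E -> F) m :
  (forall h, wint w (fun x => h (f x)) = wint v h) ->
  forall H, iint w m (fun s => H (map f s)) = iint v m H.
Proof.
move=> hw; elim: m => [|m IH] H //=; rewrite -hw; apply: eq_wint => x.
exact: (IH (fun s => H (f x :: s))).
Qed.

(** In this form a permutation of the points is a change of variables. *)
Lemma iint_tuple (E : choiceType) (w : E -> E0) m H :
  iint w m H = isum (fun t : m.-tuple E => (\prod_(i < m) w (tnth t i)) * H t).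
Proof.
elim: m H => [|m IH] H /=.
  rewrite (isum_only (t0 := [tuple])) ?big_ord0 ?mul1r // => t.
  by rewrite tuple0 eqxx.
rewrite /wint; under eq_isum => x do rewrite IH mulr_isumr.
rewrite isum_pair; apply/esym.
rewrite (isum_can (e := fun p : E * m.-tuple E => [tuple of p.1 :: p.2])
  (d := fun t : m.+1.-tuple E => (thead t, [tuple of behead t]))).
- apply: eq_isum => -[x t] /=; rewrite big_ord_recl tnth0 mulrA; congr (_ * _ * _).
  by apply: eq_bigr => i _; rewrite tnthS.
- move=> [x t] /=; rewrite theadE; congr pair; exact: val_inj.
- by move=> t; rewrite [RHS]tuple_eta.
Qed.

Lemma big_arrangements (E : eqType) (s : seq E) m (e : size s = m) (t : m.-tuple E) (g : seq E -> E0) :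
  tval t = s ->
  \sum_(x <- arrangements s) g x = \sum_(p : 'S_m) g [seq tnth t (p i) | i <- enum 'I_m].
Proof.
case: m / e t => t et; rewrite /arrangements big_map big_enum /=.
apply: eq_bigr => p _; congr g; apply: eq_map => i.
by congr tnth; apply: val_inj.
Qed.

Lemma size_arrangements (E : Type) (s : seq E) : size (arrangements s) = (size s)`!.
Proof. by rewrite size_map -cardE card_Sn. Qed.

(** The product weight is symmetric, so each of the m! permutations contributes the same
    integral. *)
Lemma iint_arrangements (E : choiceType) (w : E -> E0) m G :
  iint w m (fun s => fint (flaw_uniform K (arrangements s)) G) = iint w m G.
Proof.
rewrite !iint_tuple.
transitivity (\sum_(p : 'S_m) en (m`!%:R^-1) *
    isum (fun t : m.-tuple E => (\prod_(i < m) w (tnth t i)) * G t)).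
  transitivity (isum (fun t : m.-tuple E => \sum_(p : 'S_m) en (m`!%:R^-1) *
     ((\prod_(i < m) w (tnth t i)) * G [tuple tnth t (p i) | i < m]))).
    apply: eq_isum => t; rewrite /fint big_map size_arrangements size_tuple -big_distrr /=.
    rewrite (big_arrangements (size_tuple t) (t := t)) // -big_distrr /= -big_distrr /= mulrCA.
    by [].
  rewrite isum_sum; apply: eq_bigr => p _; rewrite -mulr_isumr; congr (_ * _).
  rewrite [RHS](isum_can (e := fun t : m.-tuple E => [tuple tnth t (p i) | i < m])
    (d := fun t : m.-tuple E => [tuple tnth t ((p^-1)%g i) | i < m])).
  - apply: eq_isum => t; congr (_ * _); rewrite (reindex_inj (@perm_inj _ p)).
    by apply: eq_bigr => i _; rewrite tnth_mktuple.
  - by move=> t; apply: eq_from_tnth => i; rewrite !tnth_mktuple permKV.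
  - by move=> t; apply: eq_from_tnth => i; rewrite !tnth_mktuple permK.
rewrite -big_distrl /= sumr_const card_Sn -[X in X *+ _]mulr1 -mulrnAr en_natV.
by rewrite -lt0n fact_gt0 mul1r.
Qed.

Fixpoint cuts (m n : nat) : K :=
  if m is m'.+1 then \sum_(j < n) j.+1%:R^-1 * cuts m' (n - j.+1)%N else (n == 0%N)%:R.

Lemma cuts_ge0 m n : 0 <= cuts m n.
Proof.
elim: m n => [|m IH] n /=; first by rewrite ler0n.
by apply: sumr_ge0 => j _; rewrite mulr_ge0 ?invr_ge0 ?ler0n.
Qed.

Lemma cuts_small m n : (n < m)%N -> cuts m n = 0.
Proof.
elim: m n => // m IH n nm /=; apply: big1 => j _; rewrite IH ?mulr0 //.
by have := ltn_ord j; lia.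
Qed.

(** For L = - log (1 - t) this is the coefficient of t^n in t (L^(m+1))' = (m + 1) L^m t / (1 -
    t). *)
Lemma cuts_rec m n : n%:R * cuts m.+1 n = m.+1%:R * \sum_(j < n) cuts m (n - j.+1)%N.
Proof.
elim: m n => [|m IH] n.
  rewrite [cuts 1 n]/= big_distrr big_distrr; apply: eq_bigr => j _ /=.
  rewrite mul1r; case: eqP => [h|]; rewrite ?mulr0 // !mulr1.
  have e : n = j.+1 by have := ltn_ord j; lia.
  by rewrite (congr1 (fun k => k%:R) e) mulfV ?pnatr_eq0.
pose S := \sum_(j < n) cuts m.+1 (n - j.+1)%N.
transitivity (S + \sum_(j < n) j.+1%:R^-1 * ((n - j.+1)%N%:R * cuts m.+1 (n - j.+1)%N)).
  rewrite [cuts m.+2 n]/= -[in LHS]/(cuts m.+1) big_distrr /S -big_split.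
  apply: eq_bigr => j _ /=.
  rewrite [X in X * _](_ : n%:R = j.+1%:R + (n - j.+1)%N%:R); last by rewrite -natrD subnKC.
  have h : (j.+1%:R : K) != 0 by rewrite pnatr_eq0.
  by rewrite mulrDl mulVKf // [X in _ + X]mulrCA.
rewrite -/S -natr1 mulrDl mul1r addrC; congr (_ + _).
under eq_bigr => j _ do rewrite IH mulrCA.
rewrite -big_distrr /=; congr (_ * _); rewrite /S /=.
under eq_bigr => j _ do rewrite big_distrr.
under [RHS]eq_bigr => j _ do rewrite -/(cuts m).
pose f (i j : nat) : K := if (i + j.+1 < n)%N then j.+1%:R^-1 * cuts m (n - j.+1 - i.+1)%N else 0.
transitivity (\sum_(j < n) \sum_(i < n) f i j).
  apply: eq_bigr => j _; rewrite (big_ord_widen n (fun i => _ * cuts m (n - j.+1 - i.+1)%N)).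
    rewrite big_mkcond; apply: eq_bigr => i _; rewrite /f ltn_subRL addnC.
    by [].
  by rewrite leq_subr.
rewrite exchange_big; apply: eq_bigr => i _.
rewrite [RHS](big_ord_widen n (fun k => k.+1%:R^-1 * cuts m (n - i.+1 - k.+1)%N)); last by rewrite leq_subr.
rewrite [RHS]big_mkcond; apply: eq_bigr => j _; rewrite /f ltn_subRL.
have -> : (i + j.+1 < n)%N = (i.+1 + j < n)%N by rewrite addnS.
by case: ifP => // _; congr (_ * cuts m _); lia.
Qed.

(* [cuts m n] is the coefficient of t^n in (- log (1 - t))^m. *)
Lemma cuts_exp (x : K) n : \sum_(m < n.+1) x ^+ m / m`!%:R * cuts m n = rcoef x n.
Proof.
(* The terms with m > n vanish by [cuts_small]; a common bound N allows the sums over m and over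
   coefficients to be exchanged. *)
suff H : forall N, (n <= N)%N -> \sum_(m < N.+1) x ^+ m / m`!%:R * cuts m n = rcoef x n.
  exact: H.
elim/ltn_ind: n => -[|n] IH N nN.
  rewrite big_ord_recl big1 => [|i _]; last by rewrite cuts_small ?mulr0.
  by rewrite rcoef0 /= fact0 expr0 divr1 mulr1 addr0.
have g0 : (n.+1%:R : K) != 0 by rewrite pnatr_eq0.
apply: (mulfI g0); rewrite rcoefS.
have -> : n.+1%:R * (\sum_(m < N.+1) x ^+ m / m`!%:R * cuts m n.+1) =
    x * \sum_(j < n.+1) rcoef x (n - j)%N.
  rewrite big_ord_recl [cuts 0 _]/= mulr0 add0r big_distrr.
  case: N nN => // N nN.
  have -> : \sum_(j < n.+1) rcoef x (n - j)%N =
      \sum_(j < n.+1) \sum_(m < N.+1) x ^+ m / m`!%:R * cuts m (n - j)%N.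
    apply: eq_bigr => j _; rewrite IH ?ltnS ?leq_subr //.
    by rewrite ltnS in nN; exact: leq_trans (leq_subr _ _) nN.
  rewrite exchange_big big_distrr /=.
  apply: eq_bigr => m _; rewrite /bump /= add1n mulrCA cuts_rec.
  rewrite factS natrM exprS.
  have h : (m.+1%:R : K) != 0 by rewrite pnatr_eq0.
  have h2 : (m`!%:R : K) != 0 by rewrite pnatr_eq0 -lt0n fact_gt0.
  rewrite -big_distrr /= add0n.
  have -> : \sum_(j < n.+1) cuts m (n.+1 - j.+1) = \sum_(j < n.+1) cuts m (n - j).
    by apply: eq_bigr => j _; rewrite subSS.
  move: (\sum_(j < n.+1) _) => e.
  by move: (m.+1%:R) h (m`!%:R) h2 => c h f h2; field; rewrite h h2.
(* Both sides are x times the coefficient of (1 - t)^-(x+1), whose coefficients are the partial sums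
   of those of (1 - t)^-x. *)
have Hc : forall n, x * (\sum_(j < n.+1) rcoef x (n - j)%N) = (x + n%:R) * rcoef x n.
  elim=> [|k IHk]; first by rewrite big_ord1 addr0.
  rewrite big_ord_recl subn0 mulrDr [X in _ + X](_ : _ = x * \sum_(j < k.+1) rcoef x (k - j)%N).
    by rewrite IHk -rcoefS mulrDl.
  by congr (_ * _); apply: eq_bigr => j _; rewrite /bump /= add1n subSS.
exact: Hc.
Qed.

End Soup.

(** * Loops assigned to a first-visit time *)

Section PathWeights.
Variables (K : realType) (V : finType) (Q : V -> V -> K).
Local Notation pw := (path_weight Q).

Lemma path_weight_cons x y s : pw (x :: y :: s) = Q x y * pw (y :: s).
Proof. by rewrite /path_weight /= big_cons. Qed.

Lemma path_weight1 x : pw [:: x] = 1.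
Proof. by rewrite /path_weight /= big_nil. Qed.

Lemma path_weight_cat s1 x s2 : pw (s1 ++ x :: s2) = pw (rcons s1 x) * pw (x :: s2).
Proof.
elim: s1 => [|y [|z s1] IH]; first by rewrite /= path_weight1 mul1r.
  by rewrite /= !path_weight_cons path_weight1 mulr1.
by rewrite /= !path_weight_cons -mulrA; congr (_ * _); exact: IH.
Qed.

(** In this cyclic form a rotation of the loop only permutes the factors. *)
Definition loop_weight (l : seq V) : K := \prod_(e <- zip l (rot 1 l)) Q e.1 e.2.

Lemma loop_weightE x p : loop_weight (x :: p) = pw (rcons (x :: p) x).
Proof.
have H (s t : seq V) y : size s = size t -> zip (rcons s y) t = zip s t.
  by elim: s t => [|z s IH] [|z' t] //= [] /IH ->.
by rewrite /loop_weight /path_weight rot1_cons H //= size_rcons.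
Qed.

Lemma zip_rot k (s t : seq V) : size s = size t -> zip (rot k s) (rot k t) = rot k (zip s t).
Proof.
move=> h; rewrite /rot zip_cat ?size_drop ?h //; congr (_ ++ _).
  elim: k s t h => [|k IH] [|x s] [|y t] //= [h]; rewrite ?drop0 //; exact: IH.
elim: k s t h => [|k IH] [|x s] [|y t] //= [h]; rewrite IH //.
Qed.

Lemma loop_weight_rot k l : loop_weight (rot k l) = loop_weight l.
Proof.
rewrite /loop_weight rot_rot zip_rot ?size_rot //.
by apply: perm_big; rewrite perm_rot.
Qed.

Hypothesis Q_ge0 : forall x y, 0 <= Q x y.

Lemma path_weight_ge0 s : 0 <= pw s.
Proof. by apply: prodr_ge0. Qed.

Lemma loop_weight_ge0 l : 0 <= loop_weight l.
Proof. by apply: prodr_ge0. Qed.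

Lemma path_weight_flatten u (b : seq (seq V)) : all (fun l => ohead l == Some u) b ->
  pw (rcons (flatten b) u) = \prod_(l <- b) loop_weight l.
Proof.
elim: b => [|l b IH] /=; first by rewrite path_weight1 big_nil.
move=> /andP[hl hb]; rewrite big_cons -IH //; case: l hl => // x l /eqP[->].
have [t et] : exists t, rcons (flatten b) u = u :: t.
  case: b hb {IH} => [|[|y l'] b] /=; first by exists [::].
    by [].
  by move=> /andP[/eqP[->] _]; exists (rcons (l' ++ flatten b) u).
by rewrite rcons_cat et path_weight_cat loop_weightE.
Qed.

Lemma loop_weight_flatten u (b : seq (seq V)) : b != [::] ->
  all (fun l => ohead l == Some u) b ->
  loop_weight (flatten b) = \prod_(l <- b) loop_weight l.
Proof.
move=> b0 hb; have := path_weight_flatten hb.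
case: b b0 hb => // -[|x l] b _ //= /andP[/eqP[->] _] <-.
by rewrite loop_weightE.
Qed.

End PathWeights.

(** * Rooting a loop and cutting it at its returns *)

Section Rootings.
Variable V : finType.
Implicit Types (s : seq V) (u : V).

Definition rots s := [seq rot k s | k <- iota 0 (size s)].

Lemma perm_rots1 s : perm_eq (rots (rot 1 s)) (rots s).
Proof.
case: s => [|x s] //; rewrite /rots size_rot.
have -> : [seq rot k (rot 1 (x :: s)) | k <- iota 0 (size (x :: s))] =
    [seq rot k (x :: s) | k <- iota 1 (size (x :: s))].
  rewrite [in RHS](iotaDl 1 0) -map_comp; apply/eq_in_map => k; rewrite mem_iota => /andP[_ hk].
  rewrite add0n in hk; rewrite /= rot_rot add1n. exact/esym/rotS.
have -> : iota 1 (size (x :: s)) = rcons (iota 1 (size s)) (size (x :: s)).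
  by rewrite [size _]/= -[(size s).+1]addn1 iotaD cats1 add1n addn1.
by rewrite map_rcons rot_size perm_rcons [size _]/= /= rot0.
Qed.

Lemma perm_rots j s : (j <= size s)%N -> perm_eq (rots (rot j s)) (rots s).
Proof.
elim: j => [|j IH] hj; first by rewrite rot0.
by rewrite rotS // (perm_trans (perm_rots1 _)) ?IH // ltnW.
Qed.

(** The rotations are counted with multiplicity, one for each time of the loop, so periodic loops
    need no special treatment. *)
Lemma repr_pi_rots s : perm_eq (rots (repr (\pi_(loop V) s))) (rots s).
Proof.
have [k ->] := repr_pi_rot s.
have [ks|sk] := leqP k (size s); first exact: perm_rots.
by rewrite rot_oversize // ltnW.
Qed.

Lemma rootings_pi u s :
  perm_eq (rootings u (\pi_(loop V) s)) [seq x <- rots s | ohead x == Some u].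
Proof. by apply: perm_filter; exact: repr_pi_rots. Qed.

Lemma size_rots_filter u s : size [seq x <- rots s | ohead x == Some u] = count_mem u s.
Proof.
rewrite size_filter /rots count_map -[in RHS](mkseq_nth u s) /mkseq count_map.
apply: eq_in_count => k; rewrite mem_iota => /andP[_ hk] /=.
by rewrite /rot (drop_nth u hk) /=.
Qed.

Lemma pi_rot k s : \pi_(loop V) (rot k s) = \pi_(loop V) s.
Proof.
have [ks|sk] := leqP k (size s); last by rewrite rot_oversize // ltnW.
apply/esym/(eqmodP (cyclic_shift_equiv V)) => /=.
by apply/existsP; exists (Ordinal (ks : (k < (size s).+1)%N)).
Qed.

Definition returns u (l : seq V) := if l is x :: e then (x == u) && (u \notin e) else false.

(** The fold opens a new block only in front of a block that starts at u, so a stretch without u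
    stays in one block. *)
Lemma cut_at_notin u e (b : seq (seq V)) : e != [::] -> u \notin e -> all (returns u) b ->
  foldr (fun x acc => if acc is e :: acc' then
             if head u e == u then [:: x] :: acc else (x :: e) :: acc'
           else [:: [:: x]]) b e = e :: b.
Proof.
move=> + + hb; elim: e => // x e IH _; rewrite inE negb_or => /andP[ux ue] /=.
case: e IH ue => [|y e] IH ue /=.
  case: b hb {IH} => [|[|z l] b] //= /andP[/andP[/eqP -> _] _].
  by rewrite eqxx.
rewrite -[foldr _ b (y :: e)]/(foldr _ _ _) in IH *.
have := IH isT ue; rewrite /= => ->.
by move: ue; rewrite inE negb_or eq_sym => /andP[/negPf /= -> _].
Qed.

Lemma cut_at_flatten u (b : seq (seq V)) : all (returns u) b -> cut_at u (flatten b) = b.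
Proof.
elim: b => // l b IH /= /andP[hl hb]; rewrite /cut_at foldr_cat -/(cut_at u _) IH //.
case: l hl => // x e /andP[/eqP -> ue] /=.
have [->|e0] := eqVneq e [::].
  case: b hb {IH} => [|[|z l] b] //= /andP[/andP[/eqP -> _] _].
  by rewrite eqxx.
rewrite cut_at_notin //; case: e e0 ue => // y e _ /=.
by rewrite inE negb_or eq_sym => /andP[/negPf -> _].
Qed.

Lemma cut_exists u l : exists pre b, [/\ l = pre ++ flatten b, u \notin pre & all (returns u) b].
Proof.
elim: l => [|x l [pre [b [-> up hb]]]]; first by exists [::], [::].
have [->|xu] := eqVneq x u; first by exists [::], ((u :: pre) :: b); rewrite /= eqxx up.
by exists (x :: pre), b; rewrite /= inE negb_or eq_sym xu.
Qed.

Lemma cut_at_head u l : ohead l = Some u -> flatten (cut_at u l) = l /\ all (returns u) (cut_at u l).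
Proof.
have [pre [b [el up hb]]] := cut_exists u l; rewrite el.
case: pre el up => [|x pre] _ /=; first by rewrite cut_at_flatten.
by rewrite inE negb_or => /andP[/eqP xu _] [/esym].
Qed.

Lemma returns_count u (b : seq (seq V)) : all (returns u) b -> count_mem u (flatten b) = size b.
Proof.
elim: b => //= l b IH /andP[hl /IH hb]; rewrite count_cat hb; case: l hl => // x e.
by move=> /andP[/eqP -> ue] /=; rewrite eqxx (count_memPn ue).
Qed.

Lemma returns_head u b : all (returns u) b -> all (fun l => ohead l == Some u) b.
Proof. by apply: sub_all => -[|x e] //= /andP[/eqP ->]. Qed.

Lemma first_returnE (D : {set V}) u : first_return_loop D u =1 predI (returns u) (all (mem D)).
Proof. by case => //= x e; rewrite andbA. Qed.

Lemma all_first_return (D : {set V}) u (b : seq (seq V)) :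
  all (first_return_loop D u) b = all (returns u) b && all (mem D) (flatten b).
Proof.
rewrite (eq_all (first_returnE D u)) all_predI; congr (_ && _).
by elim: b => //= l b ->; rewrite all_cat.
Qed.

End Rootings.

(** * From the soup loops at one address to a list of return loops *)

Section Leaf.
Variables (K : realType) (V : finType) (Q : V -> V -> K) (lambda : K).
Hypothesis Q_ge0 : forall x y, 0 <= Q x y.
Hypothesis lambda_bounds : 0 <= lambda <= 1.
Local Notation E0 := (ennreal K).

Let l0 : 0 <= lambda. Proof. by case/andP: lambda_bounds. Qed.

Definition lw (l : seq V) : E0 := en (loop_weight Q l).

Definition loop_int (R : {set V}) (l : loop V) : E0 :=
  isum (fun s => (\pi_(loop V) s == l)%:R * en (lambda * rooted_loop_mass Q R s)).

Lemma wint_loop_int R (P : pred (loop V)) (h : loop V -> E0) :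
  wint (restrict P (loop_int R)) h =
  isum (fun s => (P (\pi_(loop V) s))%:R * en (lambda * rooted_loop_mass Q R s) * h (\pi_(loop V) s)).
Proof.
transitivity (isum (fun l => isum (fun s =>
  (\pi_(loop V) s == l)%:R * ((P l)%:R * en (lambda * rooted_loop_mass Q R s) * h l)))).
  apply: eq_isum => l; rewrite /restrict /loop_int -mulrA mulr_isuml mulr_isumr.
  by apply: eq_isum => s; ring.
rewrite isum_swap; apply: eq_isum => s.
rewrite (isum_only (t0 := \pi_(loop V) s)) ?eqxx ?mul1r // => l.
by rewrite eq_sym => /negPf ->; rewrite mul0r.
Qed.

Lemma fint_uniform (E : Type) (s : seq E) (h : E -> E0) :
  fint (flaw_uniform K s) h = en (size s)%:R^-1 * \sum_(x <- s) h x.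
Proof. by rewrite /fint big_map big_distrr. Qed.

(** For each k, rotation by k is a bijection of the lists longer than k. The factor [size s] will
    cancel the 1/n of the rooted loop measure. *)
Lemma isum_rots (g : seq V -> E0) :
  isum (fun s => \sum_(x <- rots s) g x) = isum (fun s => (size s)%:R * g s).
Proof.
transitivity (isum (fun s => isum (fun k : nat => if (k < size s)%N then g (rot k s) else 0))).
  apply: eq_isum => s; rewrite /rots big_map -[X in iota 0 X]subn0 -/(index_iota _ _) big_mkord.
  rewrite (isum_nat (n := size s)); first by apply: eq_bigr => k _; rewrite ltn_ord.
  by move=> k; rewrite leqNgt => /negPf ->.
transitivity (isum (fun s => isum (fun k : nat => if (k < size s)%N then g s else 0))).
  rewrite !isum_pair.
  apply: (@isum_bij _ _ _ [set p : seq V * nat | (p.2 < size p.1)%N]%classic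
    [set p : seq V * nat | (p.2 < size p.1)%N]%classic
    (fun p : seq V * nat => (rotr p.2 p.1, p.2))) => /=.
  - split => [[s k] /=|[s k] [s' k'] _ _ /= [] + ek|[s k] /= hk].
    + by rewrite size_rotr.
    + by rewrite ek => /rotr_inj ->.
    + by exists (rot k s, k) => /=; rewrite ?size_rot ?rotK.
  - by move=> [s k] /= /negP/negPf ->.
  - by move=> [s k] /= /negP/negPf ->.
  - by move=> [s k] /= hk; rewrite size_rotr hk rotrK.
apply: eq_isum => s; rewrite (isum_nat (n := size s)).
  under eq_bigr => k _ do rewrite ltn_ord.
  by rewrite sumr_const card_ord mulr_natl.
by move=> k; rewrite leqNgt => /negPf ->.
Qed.

Lemma rooted_loop_massE R (s : seq V) : s != [::] ->
  rooted_loop_mass Q R s = (all (mem R) s)%:R * loop_weight Q s / (size s)%:R.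
Proof.
case: s => // x p _; rewrite /rooted_loop_mass loop_weightE.
by case: ifP => _; rewrite ?mul1r ?mul0r.
Qed.

Lemma all_rot (T : Type) (p : pred T) k (s : seq T) : all p (rot k s) = all p s.
Proof. by rewrite /rot all_cat andbC -all_cat cat_take_drop. Qed.

Lemma count_rot (T : Type) (p : pred T) k (s : seq T) : count p (rot k s) = count p s.
Proof. by rewrite /rot count_cat addnC -count_cat cat_take_drop. Qed.

Lemma rooted_loop_mass_rot R k (s : seq V) :
  rooted_loop_mass Q R (rot k s) = rooted_loop_mass Q R s.
Proof.
have [->|s0] := eqVneq s [::]; first by rewrite /rot.
rewrite !rooted_loop_massE ?loop_weight_rot ?size_rot ?all_rot //.
by rewrite -size_eq0 size_rot size_eq0.
Qed.

(* A uniform rooting of a loop at one of its visits to [u] weights the rooted loop by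
   the inverse of its number of visits to [u], whatever its period. *)
Definition rooted_weight (R : {set V}) (P : pred (loop V)) u (r : seq V) : E0 :=
  ((P (\pi_(loop V) r) && (ohead r == Some u)) && all (mem R) r)%:R * en lambda * lw r *
    en (count_mem u r)%:R^-1.

Lemma wint_rootings R (P : pred (loop V)) u h :
  wint (restrict P (loop_int R)) (fun l => fint (flaw_uniform K (rootings u l)) h) =
  wint (rooted_weight R P u) h.
Proof.
rewrite wint_loop_int.
pose g r := (P (\pi_(loop V) r))%:R * en (lambda * rooted_loop_mass Q R r) *
  en (count_mem u r)%:R^-1 * ((ohead r == Some u)%:R * h r).
transitivity (isum (fun s => \sum_(x <- rots s) g x)).
  apply: eq_isum => s; rewrite fint_uniform (perm_size (rootings_pi u s)) size_rots_filter.
  rewrite (perm_big _ (rootings_pi u s)) /= big_filter big_mkcond /= mulrA big_distrr /=.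
  rewrite /rots !big_map; apply: eq_bigr => k _; rewrite /g pi_rot rooted_loop_mass_rot.
  rewrite count_rot.
  by case: ifP => _; rewrite ?mul1r ?mul0r.
rewrite isum_rots; apply: eq_isum => s; rewrite /g /rooted_weight.
have [->|s0] := eqVneq s [::]; first by rewrite mul0r /= andbF !mul0r.
rewrite rooted_loop_massE // (enM _ l0) -mulrA.
have := en_natV K (size s); rewrite size_eq0 s0 /= => e1.
case: (all _ s); rewrite ?andbT ?andbF /= ?mul0r ?en0 ?mulr0 ?mul0r ?mulr0 //.
rewrite mul1r (enM _ (loop_weight_ge0 Q_ge0 s)) -mulnb natrM /lw.
transitivity ((en (size s)%:R^-1 * (size s)%:R) * ((P (\pi_(loop V) s))%:R * (ohead s == Some u)%:R *
  en lambda * en (loop_weight Q s) * en (count_mem u s)%:R^-1 * h s)); first by ring.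
by rewrite e1 mul1r.
Qed.

Section Address.
Variables (R D : {set V}) (P : pred (loop V)) (u : V) (fresh : bool).
Hypothesis DR : D \subset R.
Hypothesis PE : forall r : seq V, all (mem R) r -> ohead r = Some u ->
  P (\pi_(loop V) r) = fresh && all (mem D) r.

(** [fresh] tells whether u is first visited at this time; otherwise the address receives no loop
    rooted at u and its list is empty. *)
Definition slot : pred (seq V) := if fresh then first_return_loop D u else (pred0 : pred (seq V)).

(** A soup loop with n visits to u is cut into n return loops, and its uniform rooting gives 1/n:
    these are the coefficients of - lambda log (1 - t). *)
Definition block_coef (n : nat) : E0 := (n != 0%N)%:R * en lambda * en n%:R^-1.

(** Cutting at u is a bijection from the loops rooted at u onto the nonempty lists of return loops,
    with [flatten] as inverse. *)
Lemma wint_cut h : wint (rooted_weight R P u) (fun r => h (cut_at u r)) =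
  wint (lweight lw block_coef slot) h.
Proof.
have PE' r : (P (\pi_(loop V) r) && (ohead r == Some u)) && all (mem R) r =
    [&& fresh, ohead r == Some u & all (mem D) r].
  have [rR|rR] := boolP (all (mem R) r); rewrite ?andbF ?andbT.
    have [ru|_] := eqVneq (ohead r) (Some u); first by rewrite /= andbT; exact: PE.
    by rewrite andbF; case: (fresh).
  case: (fresh) => //=; apply/esym/negbTE; rewrite negb_and; apply/orP; right.
  by apply: contra rR; apply: sub_all => x; apply: (fintype.subsetP DR).
have slot_all b : all slot b = nilp b || [&& fresh, all (returns u) b & all (mem D) (flatten b)].
  case: b => //= l b; rewrite /slot; case: fresh; last by [].
  by rewrite -[_ && _]/(all (first_return_loop D u) (l :: b)) all_first_return.
rewrite /wint /rooted_weight /lweight /block_coef.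
case ef : fresh PE' slot_all => PE' slot_all; last first.
  rewrite !isum0 // => [b|r].
    by rewrite slot_all orbF; case: b => [|l b] /=; rewrite !(mul0r, mulr0).
  by rewrite PE' !mul0r.
apply: (@isum_bij _ _ _ [set r : seq V | ohead r == Some u]%classic
   [set b : seq (seq V) | all (returns u) b && (b != [::])]%classic flatten) => /=.
- split => [b /= /andP[hb b0]|b b' /[!inE] /= /andP[hb _] /andP[hb' _] e|r /= /eqP hr].
  + case: b hb b0 => // -[|x e] b //= /andP[/andP[/eqP -> _] _] _.
    by rewrite eqxx.
  + by rewrite -(cut_at_flatten hb) e cut_at_flatten.
  + have [h1 h2] := cut_at_head hr; exists (cut_at u r) => //=; rewrite h2 /=.
    by apply/eqP => e; move: h1 hr; rewrite e /= => <-.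
- by move=> r /negP/negPf hr; rewrite PE' hr !mul0r.
- move=> b; rewrite slot_all; case: b => [|l b] /=; first by rewrite !mul0r mulr0 mul0r.
  by move=> /negP/negPf; rewrite andbT => ->; rewrite !mul0r.
- move=> b /andP[hb b0]; rewrite slot_all PE' hb cut_at_flatten // returns_count //.
  have -> : ohead (flatten b) == Some u.
    case: b hb b0 => // -[|x e] b //= /andP[/andP[/eqP -> _] _] _.
    by rewrite eqxx.
  rewrite /nilp size_eq0 (negPf b0) /= mul1r /lw.
  rewrite (loop_weight_flatten Q b0 (returns_head hb)) en_prod; last by move=> *; exact: loop_weight_ge0.
  by ring.
Qed.

Definition cut_coef m n : E0 := en (lambda ^+ m * cuts K m n).

Lemma iint_flatten m h : iint (lweight lw block_coef slot) m (fun bs => h (flatten bs)) =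
  wint (lweight lw (cut_coef m) slot) h.
Proof.
elim: m h => [|m IH] h /=.
  rewrite /wint (isum_only (t0 := [::])) => [|X X0].
    by rewrite /lweight /cut_coef /= big_nil expr0 !mul1r en1 mul1r.
  by rewrite /lweight /cut_coef /= size_eq0 (negPf X0) mulr0 en0 mulr0 mul0r.
under eq_wint => b do rewrite (IH (fun X => h (b ++ X))).
rewrite wint_lweight_cat /wint; apply: eq_isum => X.
under eq_bigr do rewrite cat_take_drop.
rewrite -big_distrl /= mulrA; congr (_ * _); rewrite /lweight mulr1; congr (_ * _).
rewrite big_ord_recl {1}/block_coef /= !mul0r add0r /cut_coef /= big_distrr /=.
rewrite en_sum; last by move=> *; rewrite !mulr_ge0 ?exprn_ge0 ?invr_ge0 ?ler0n ?cuts_ge0.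
apply: eq_bigr => j _; rewrite /block_coef /bump /= add1n mul1r -!enM ?invr_ge0 ?ler0n ?mulr_ge0 //.
by congr en; rewrite exprS; ring.
Qed.

(** The sum over the number m of soup loops is an exponential series in - lambda log (1 - t);
    [cuts_exp] identifies its coefficients with those of the deleted list. *)
Lemma soup_blocks h : soup (lweight lw block_coef slot) (fun bs => h (flatten bs)) =
  wint (lweight lw (deleted lambda) slot) h.
Proof.
rewrite /soup; under eq_isum do rewrite iint_flatten /wint mulr_isumr.
rewrite isum_swap; apply: eq_isum => X.
transitivity ((all slot X)%:R * (\prod_(l <- X) lw l) * h X *
    isum (fun m => en m`!%:R^-1 * cut_coef m (size X))).
  by rewrite mulr_isumr; apply: eq_isum => m; rewrite /lweight; ring.
rewrite (isum_nat (n := (size X).+1)); last first.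
  by move=> m hm; rewrite /cut_coef cuts_small // mulr0 en0 mulr0.
rewrite /lweight /deleted -cuts_exp en_sum; last first.
  by move=> m _; rewrite !mulr_ge0 ?exprn_ge0 ?invr_ge0 ?ler0n ?cuts_ge0.
rewrite mulrAC; congr (_ * _ * _); apply: eq_bigr => m _.
rewrite /cut_coef -enM ?invr_ge0 ?ler0n //; congr en.
by rewrite mulrCA mulrA.
Qed.

Lemma iint_bind_arrangements (E : choiceType) (w : E -> E0) (G : seq E -> E0) :
  soup w (fun s => fint (flaw_uniform K (arrangements s)) G) = soup w G.
Proof. by apply: eq_isum => m; rewrite iint_arrangements. Qed.

Lemma soup_assigned lys n i t h : (forall l, P l = (address lys l == (n, i, t))) ->
  soup (restrict P (loop_int R)) (fun c => fint (assigned K lys c n i t u) h) =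
  wint (lweight lw (deleted lambda) slot) h.
Proof.
move=> hP.
transitivity (soup (restrict P (loop_int R)) (fun c =>
   fint (flaw_map (fun l => flaw_uniform K (rootings u l)) c) (fun r =>
     fint (flaw_uniform K (arrangements r)) (fun o => h (flatten (map (cut_at u) o)))))).
  apply: eq_soup_on => c hc; rewrite /assigned fint_bind; last first.
    by apply: nonnegf_map => l; exact: nonnegf_uniform.
  rewrite (_ : [seq l <- c | _] = c).
    apply: eq_fint => r; rewrite fint_bind ?nonnegf_uniform //; apply: eq_fint => o.
    by rewrite fint_ret.
  apply/all_filterP; apply: sub_all hc => l; rewrite -hP /restrict.
  by apply: contraNT => /negPf ->; rewrite mul0r.
rewrite (soup_transfer (v := rooted_weight R P u)); last 2 first.
- by move=> l; exact: nonnegf_uniform.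
- exact: wint_rootings.
rewrite iint_bind_arrangements -soup_blocks.
by apply: eq_isum => m; rewrite (iint_map m wint_cut (fun bs => h (flatten bs))).
Qed.

End Address.

End Leaf.

(** * Runs and their resampling *)

Section Runs.
Variables (V : finType) (B : {set V}).
Implicit Types (s z : seq V) (zs : seq (seq V)) (L : seq (seq V)).

Definition starts_out s := if s is x :: _ then x \notin B else true.

Definition run z := (z != [::]) && all (mem B) z.

(** Reads a list as vertices outside B and maximal runs in B; maximality of z is expressed by
    [starts_out s]. *)
Lemma run_ind (P : seq V -> Prop) : P [::] ->
  (forall x s, x \notin B -> P s -> P (x :: s)) ->
  (forall z s, run z -> starts_out s -> P s -> P (z ++ s)) ->
  forall s, P s.
Proof.
move=> P0 P1 P2 s; have [n] := ubnP (size s); elim: n s => // n IH [|x s] // hn.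
have [xB|xB] := boolP (x \in B); last by apply: P1 => //; apply: IH.
have [z [t [est hz ht]]] : exists z t, [/\ s = z ++ t, all (mem B) z & starts_out t].
  elim: (s) => [|y s' [z [t [-> hz ht]]]]; first by exists [::], [::].
  have [yB|yB] := boolP (y \in B); first by exists (y :: z), t; rewrite /= yB.
  by exists [::], (y :: z ++ t).
rewrite est -cat_cons; apply: P2 => //; first by rewrite /run /= xB.
by apply: IH; move: hn; rewrite est /= size_cat ltnS; apply: leq_ltn_trans; rewrite leq_addl.
Qed.

Lemma runs_out x s : x \notin B -> runs B [::] (x :: s) = runs B [::] s.
Proof. by move=> /= /negPf ->. Qed.

Lemma runs_acc acc z s : all (mem B) z -> runs B acc (z ++ s) = runs B (acc ++ z) s.
Proof.
elim: z acc => [|x z IH] acc /=; first by rewrite cats0.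
by move=> /andP[xB hz]; rewrite xB IH // cat_rcons.
Qed.

Lemma runs_end acc s : acc != [::] -> starts_out s -> runs B acc s = acc :: runs B [::] s.
Proof.
case: s => [|x s] /=; first by case: acc.
by move=> + /negPf ->; case: acc.
Qed.

Lemma runs_cat z s : run z -> starts_out s -> runs B [::] (z ++ s) = z :: runs B [::] s.
Proof. by move=> /andP[z0 hz] hs; rewrite runs_acc //= runs_end. Qed.

Lemma fill_out x s zs b : x \notin B -> fill_runs B b (x :: s) zs = x :: fill_runs B false s zs.
Proof. by move=> /= /negPf ->. Qed.

Lemma fill_true z s zs : all (mem B) z -> fill_runs B true (z ++ s) zs = fill_runs B true s zs.
Proof. by elim: z => //= x z IH /andP[-> /IH]. Qed.

Lemma fill_true_false s zs : starts_out s -> fill_runs B true s zs = fill_runs B false s zs.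
Proof. by case: s => //= x s /negPf ->. Qed.

Lemma fill_cat z s zs : run z -> starts_out s ->
  fill_runs B false (z ++ s) zs = head [::] zs ++ fill_runs B false s (behead zs).
Proof.
case: z => // x z /andP[_ /= /andP[xB hz]] hs; rewrite xB fill_true //.
by rewrite fill_true_false.
Qed.

Local Notation runs0 := (runs B [::]).
Local Notation fill := (fill_runs B false).

Lemma starts_out_fill s zs : starts_out s -> starts_out (fill s zs).
Proof. by case: s => //= x s xB; rewrite (negPf xB). Qed.

Lemma runs_run s : all run (runs0 s).
Proof.
elim/run_ind: s => // [x s xB|z s hz hs] IH; first by rewrite runs_out.
by rewrite runs_cat //= hz.
Qed.

Lemma fill_runsK s : fill s (runs0 s) = s.
Proof.
elim/run_ind: s => // [x s xB|z s hz hs] IH; first by rewrite runs_out // fill_out // IH.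
by rewrite runs_cat // fill_cat // IH.
Qed.

Lemma runs_fill s zs : all run zs -> size zs = size (runs0 s) -> runs0 (fill s zs) = zs.
Proof.
elim/run_ind: s zs => [[] //|x s xB IH zs|z s hz hs IH zs].
  by rewrite runs_out // fill_out // => hzs es; rewrite runs_out // IH.
rewrite runs_cat //; case: zs => // z' zs /= /andP[hz' hzs] [es].
by rewrite fill_cat // runs_cat ?starts_out_fill // IH.
Qed.

Lemma fill_fill s zs zs' : all run zs -> size zs = size (runs0 s) ->
  fill (fill s zs) zs' = fill s zs'.
Proof.
elim/run_ind: s zs zs' => [|x s xB IH zs zs'|z s hz hs IH zs zs'] //.
  by rewrite runs_out // !fill_out // => hzs es; rewrite IH.
rewrite runs_cat //; case: zs => // z1 zs /= /andP[hz1 hzs] [es].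
by rewrite !fill_cat ?starts_out_fill // IH.
Qed.

Lemma runs_rcons s u : u \notin B -> runs0 (rcons s u) = runs0 s.
Proof.
move=> uB; elim/run_ind: s => [|x s xB IH|z s hz hs IH].
- by rewrite /= (negPf uB).
- by rewrite rcons_cons !runs_out.
- rewrite rcons_cat !runs_cat ?IH //; by case: (s) hs.
Qed.

Lemma fill_rcons s u zs : u \notin B -> size zs = size (runs0 s) ->
  fill (rcons s u) zs = rcons (fill s zs) u.
Proof.
move=> uB; elim/run_ind: s zs => [|x s xB IH|z s hz hs IH] zs.
- by rewrite /= (negPf uB).
- by rewrite runs_out // rcons_cons !fill_out // => /IH ->.
- rewrite runs_cat //; case: zs => // z' zs [es].
  rewrite rcons_cat !fill_cat ?IH ?rcons_cat //; by case: (s) hs.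
Qed.

Lemma fill_all (p : pred V) s zs : size zs = size (runs0 s) ->
  all (all p) zs -> {in s, forall x, x \notin B -> p x} -> all p (fill s zs).
Proof.
elim/run_ind: s zs => [|x s xB IH|z s hz hs IH] zs //.
  rewrite runs_out // fill_out //= => es hp h; rewrite h ?mem_head //=.
  by apply: IH => // y ys; apply: h; rewrite inE ys orbT.
rewrite runs_cat //; case: zs => // z' zs [es] /= /andP[hz' hzs] h.
rewrite fill_cat // all_cat hz' /=; apply: IH => // y ys; apply: h.
by rewrite mem_cat ys orbT.
Qed.

Definition path_ends z : option (V * V) := if z is x :: p then Some (x, last x p) else None.

Section Weights.
Variables (K : realType) (Q : V -> V -> K).
Local Notation pw := (path_weight Q).

(** What remains of the path weight when the runs are taken out: edges inside B count 1, and an edge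
    into or out of a run sees only an endpoint of it. *)
Definition out_weight s : K :=
  \prod_(e <- zip s (behead s)) (if (e.1 \in B) && (e.2 \in B) then 1 else Q e.1 e.2).

Lemma out_weight_cons x y s :
  out_weight (x :: y :: s) = (if (x \in B) && (y \in B) then 1 else Q x y) * out_weight (y :: s).
Proof. by rewrite /out_weight /= big_cons. Qed.

Lemma out_weight1 x : out_weight [:: x] = 1.
Proof. by rewrite /out_weight /= big_nil. Qed.

Lemma out_weight_run x z s : all (mem B) (x :: z) ->
  out_weight (x :: z ++ s) = out_weight (last x z :: s).
Proof.
elim: z x => //= y z IH x /and3P[xB yB hz].
by rewrite out_weight_cons xB yB mul1r; apply: IH; rewrite /= yB.
Qed.

(** The condition on a prevents a run at the start of s from extending back to a. *)
Lemma path_weight_split a s : (if s is x :: _ then (a \notin B) || (x \notin B) else true) ->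
  pw (a :: s) = out_weight (a :: s) * \prod_(z <- runs0 s) pw z.
Proof.
elim/run_ind: s a => [|x s xB IH|z s hz hs IH] a.
- by rewrite out_weight1 path_weight1 big_nil mulr1.
- rewrite runs_out // path_weight_cons out_weight_cons (negPf xB) andbF => _.
  by rewrite IH ?mulrA //; case: (s) => // y t; rewrite xB.
rewrite runs_cat // big_cons; case: z hz => // x z /andP[_ hz] /=.
have xB : x \in B by case/andP: hz.
rewrite xB orbF => aB.
rewrite path_weight_cons out_weight_cons (negPf aB) /= out_weight_run //.
have -> : pw (x :: z ++ s) = pw (x :: z) * pw (last x z :: s).
  case/lastP: z hz => [|z y] hz; first by rewrite path_weight1 mul1r.
  by rewrite last_rcons cat_rcons -cat_cons path_weight_cat rcons_cons.
rewrite IH; last by case: (s) hs => //= y t ->; rewrite orbT.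
by ring.
Qed.

Lemma out_weight_fill a s zs : (if s is x :: _ then (a \notin B) || (x \notin B) else true) ->
  all run zs -> map path_ends zs = map path_ends (runs0 s) ->
  out_weight (a :: fill s zs) = out_weight (a :: s).
Proof.
elim/run_ind: s zs a => [|x s xB IH|z s hz hs IH] zs a //.
  rewrite runs_out // fill_out // !out_weight_cons => _ hzs e; rewrite IH //.
  by case: (s) => // y t; rewrite xB.
rewrite runs_cat //; case: zs => // z' zs + /= /andP[hz' hzs] [ez ezs].
rewrite fill_cat //; case: z hz ez => // x z /andP[_ hz] + h.
case: z' hz' => // x' z' /andP[_ hz'] [ex el]; rewrite ex in hz' el *.
rewrite !cat_cons !out_weight_cons !out_weight_run // el IH //.
by case: (s) hs => //= y t ->; rewrite orbT.
Qed.

End Weights.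

Definition segs L : seq (seq V) := flatten (map runs0 L).

Definition fills L zs : seq (seq V) :=
  [seq fill p.1 p.2 | p <- zip L (reshape [seq size (runs0 l) | l <- L] zs)].

Lemma fills_cons l L zs :
  fills (l :: L) zs = fill l (take (size (runs0 l)) zs) :: fills L (drop (size (runs0 l)) zs).
Proof. by []. Qed.

Lemma segs_cons l L : segs (l :: L) = runs0 l ++ segs L.
Proof. by []. Qed.

Lemma size_fills L zs : size (fills L zs) = size L.
Proof. by elim: L zs => // l L IH zs; rewrite fills_cons /= IH. Qed.

Lemma segs_run L : all run (segs L).
Proof. by elim: L => // l L IH; rewrite segs_cons all_cat runs_run. Qed.

Lemma fills_segs L : fills L (segs L) = L.
Proof.
elim: L => // l L IH; rewrite segs_cons fills_cons take_size_cat // drop_size_cat //.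
by rewrite fill_runsK IH.
Qed.

Lemma all_take (T : Type) (p : pred T) n (s : seq T) : all p s -> all p (take n s).
Proof. by move=> h; move: h; rewrite -{1}(cat_take_drop n s) all_cat => /andP[]. Qed.

Lemma all_drop (T : Type) (p : pred T) n (s : seq T) : all p s -> all p (drop n s).
Proof. by move=> h; move: h; rewrite -{1}(cat_take_drop n s) all_cat => /andP[]. Qed.

Lemma size_split l L zs : size zs = size (segs (l :: L)) ->
  size (take (size (runs0 l)) zs) = size (runs0 l) /\
  size (drop (size (runs0 l)) zs) = size (segs L).
Proof.
rewrite segs_cons size_cat => e; rewrite size_drop size_takel e ?leq_addr //.
by split=> //; rewrite addKn.
Qed.

Lemma segs_fills L zs : all run zs -> size zs = size (segs L) -> segs (fills L zs) = zs.
Proof.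
elim: L zs => [|l L IH] zs hzs es; first by case: zs es {hzs}.
have [e1 e2] := size_split es.
by rewrite fills_cons segs_cons runs_fill ?all_take // IH ?all_drop // cat_take_drop.
Qed.

Lemma fills_fills L zs zs' : all run zs -> size zs = size (segs L) ->
  fills (fills L zs) zs' = fills L zs'.
Proof.
elim: L zs zs' => [|l L IH] zs zs' hzs es //.
have [e1 e2] := size_split es.
rewrite !fills_cons runs_fill ?all_take // e1.
by rewrite fill_fill ?all_take // IH ?all_drop.
Qed.

Lemma segs_cat L1 L2 : segs (L1 ++ L2) = segs L1 ++ segs L2.
Proof. by rewrite /segs map_cat flatten_cat. Qed.

Lemma fills_cat L1 L2 zs :
  fills (L1 ++ L2) zs = fills L1 (take (size (segs L1)) zs) ++ fills L2 (drop (size (segs L1)) zs).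
Proof.
elim: L1 zs => [|l L1 IH] zs; first by rewrite drop0.
rewrite cat_cons !fills_cons IH segs_cons size_cat cat_cons take_takel ?leq_addr //.
by rewrite take_drop drop_drop (addnC (size (segs L1))).
Qed.

(** One operation at three depths: [fills] acts on a list of loops, [refill1] on the lists of one
    path, [refillN] on those of a tuple of paths. *)
Definition refill1 (Xs : seq (seq (seq V))) zs := reshape (shape Xs) (fills (flatten Xs) zs).

Definition refillN (Y : seq (seq (seq (seq V)))) zs :=
  reshape (shape Y) (refill1 (flatten Y) zs).

Definition segsN (Y : seq (seq (seq (seq V)))) := segs (flatten (flatten Y)).

Lemma refillE (st : seq (strand V)) zs :
  refill B st zs = zip (unzip1 st) (refillN (unzip2 st) zs).
Proof. by []. Qed.

Lemma segmentsE (st : seq (strand V)) : segments B st = segsN (unzip2 st).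
Proof. by []. Qed.

Lemma size_shape (T : Type) (ss : seq (seq T)) : sumn (shape ss) = size (flatten ss).
Proof. by rewrite size_flatten. Qed.

Lemma flatten_refill1 Xs zs : flatten (refill1 Xs zs) = fills (flatten Xs) zs.
Proof. by rewrite reshapeKr // size_fills size_shape. Qed.

Lemma shape_refill1 Xs zs : shape (refill1 Xs zs) = shape Xs.
Proof. by rewrite reshapeKl // size_fills size_shape. Qed.

Lemma size_refill1 Xs zs : size (refill1 Xs zs) = size Xs.
Proof. by rewrite -(size_map size) -/(shape _) shape_refill1 size_map. Qed.

Lemma flatten_refillN Y zs : flatten (refillN Y zs) = refill1 (flatten Y) zs.
Proof. by rewrite reshapeKr // size_refill1 size_shape. Qed.

Lemma shape_refillN Y zs : shape (refillN Y zs) = shape Y.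
Proof. by rewrite reshapeKl // size_refill1 size_shape. Qed.

Lemma flatten2_refillN Y zs : flatten (flatten (refillN Y zs)) = fills (flatten (flatten Y)) zs.
Proof. by rewrite flatten_refillN flatten_refill1. Qed.

Lemma refillN_refillN Y zs zs' : all run zs -> size zs = size (segsN Y) ->
  refillN (refillN Y zs) zs' = refillN Y zs'.
Proof.
move=> hz es; rewrite {1}/refillN shape_refillN /refill1 flatten_refillN shape_refill1.
by rewrite flatten_refill1 fills_fills.
Qed.

Lemma refillN_segs Y : refillN Y (segsN Y) = Y.
Proof. by rewrite /refillN /refill1 fills_segs !flattenK. Qed.

Lemma segsN_refillN Y zs : all run zs -> size zs = size (segsN Y) -> segsN (refillN Y zs) = zs.
Proof. by move=> hz es; rewrite /segsN flatten2_refillN segs_fills. Qed.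

(** Such a slot does not see the content of the runs; the root outside B keeps a run from wrapping
    around the root. *)
Definition stable_slot (p : pred (seq V)) : Prop := forall l, p l ->
  (if l is x :: _ then x \notin B else false) /\
  forall zs, all run zs -> size zs = size (runs0 l) -> p (fill l zs).

Lemma all_fills (p : pred (seq V)) X zs : stable_slot p -> all run zs ->
  size zs = size (segs X) -> all p X -> all p (fills X zs).
Proof.
move=> hp; elim: X zs => // l X IH zs hz es; rewrite fills_cons => /= /andP[pl pX].
have [e1 e2] := size_split es.
rewrite (hp _ pl).2 ?all_take //=; apply: IH => //; exact: all_drop.
Qed.

Lemma refill1_cons X Xs zs : refill1 (X :: Xs) zs =
  fills X (take (size (segs X)) zs) :: refill1 Xs (drop (size (segs X)) zs).
Proof.
rewrite /refill1 [flatten _]/= fills_cat /=.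
by rewrite take_size_cat ?size_fills // drop_size_cat ?size_fills.
Qed.

Fixpoint stable_slots (ps : seq (pred (seq V))) : Prop :=
  if ps is p :: ps' then stable_slot p /\ stable_slots ps' else True.

Lemma stable_slots_cat ps1 ps2 :
  stable_slots (ps1 ++ ps2) <-> stable_slots ps1 /\ stable_slots ps2.
Proof. by elim: ps1 => [|p ps1 IH] /=; [tauto|rewrite IH; tauto]. Qed.

Lemma fits_refill1 ps Xs zs : stable_slots ps -> all run zs ->
  size zs = size (segs (flatten Xs)) -> fits ps Xs -> fits ps (refill1 Xs zs).
Proof.
elim: ps Xs zs => [|p ps IH] [|X Xs] zs; rewrite ?refill1_cons //= => -[hp hps] hz.
rewrite segs_cat size_cat => es /andP[pX pXs].
rewrite all_fills ?all_take //=; last by rewrite size_takel // es leq_addr.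
by apply: IH => //; rewrite ?all_drop // size_drop es addKn.
Qed.

Lemma fits_cat (E : Type) (ps1 ps2 : seq (pred E)) xs1 xs2 : size ps1 = size xs1 ->
  fits (ps1 ++ ps2) (xs1 ++ xs2) = fits ps1 xs1 && fits ps2 xs2.
Proof. by elim: ps1 xs1 => [|p ps1 IH] [|x xs1] //= [/IH ->]; rewrite andbA. Qed.

Lemma fits_size (E : Type) (ps : seq (pred E)) xs : fits ps xs -> size xs = size ps.
Proof. by elim: ps xs => [|p ps IH] [|x xs] //= /andP[_ /IH ->]. Qed.

Lemma gfits_flatten (E : Type) (ss : seq (seq (pred E))) Y :
  gfits ss Y = (shape Y == shape ss) && fits (flatten ss) (flatten Y).
Proof.
elim: ss Y => [|ps ss IH] [|Xs Y] //=.
rewrite IH eqseq_cons; case: (eqVneq (size Xs) (size ps)) => [e|e] /=.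
  by rewrite fits_cat // andbCA.
by apply/negP => /andP[/fits_size e' _]; rewrite e' eqxx in e.
Qed.

Lemma gfits_refillN ss Y zs : stable_slots (flatten ss) -> all run zs ->
  size zs = size (segsN Y) -> gfits ss Y -> gfits ss (refillN Y zs).
Proof.
move=> hs hz es; rewrite !gfits_flatten shape_refillN flatten_refillN => /andP[-> h] /=.
exact: fits_refill1.
Qed.

Lemma fits_rooted ps Xs : stable_slots ps -> fits ps Xs ->
  all (fun l => if l is x :: _ then x \notin B else false) (flatten Xs).
Proof.
elim: ps Xs => [|p ps IH] [|X Xs] //= [hp hps] /andP[pX /(IH _ hps) h].
rewrite all_cat h andbT; apply: sub_all pX => l /hp[]; by case: l.
Qed.

Section LoopWeights.
Variables (K : realType) (Q : V -> V -> K).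
Hypothesis Q_ge0 : forall x y, 0 <= Q x y.
Local Notation E0 := (ennreal K).

Definition out_loop (l : seq V) : E0 :=
  if l is x :: p then en (out_weight Q (x :: rcons p x)) else 1.

Definition pwE (z : seq V) : E0 := en (path_weight Q z).

Lemma out_weight_ge0 s : 0 <= out_weight Q s.
Proof. by apply: prodr_ge0 => e _; case: ifP. Qed.

Lemma lw_split l : (if l is x :: _ then x \notin B else false) ->
  lw Q l = out_loop l * \prod_(z <- runs0 l) pwE z.
Proof.
case: l => // x p xB; rewrite /lw loop_weightE rcons_cons path_weight_split; last first.
  by case: (rcons p x) => // y t; rewrite xB.
rewrite (enM _ (out_weight_ge0 _)) runs_rcons // -en_prod; last by move=> z _; exact: path_weight_ge0.
by rewrite runs_out.
Qed.

Lemma out_loop_fill l zs : (if l is x :: _ then x \notin B else false) ->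
  all run zs -> map path_ends zs = map path_ends (runs0 l) -> out_loop (fill l zs) = out_loop l.
Proof.
case: l => // x p xB hz; rewrite runs_out // => e.
have es : size zs = size (runs0 p) by rewrite -(size_map path_ends) e size_map.
rewrite fill_out //= -fill_rcons // out_weight_fill ?runs_rcons //.
by case: (rcons p x) => // y t; rewrite xB.
Qed.

Lemma lws_split L : all (fun l => if l is x :: _ then x \notin B else false) L ->
  \prod_(l <- L) lw Q l = (\prod_(l <- L) out_loop l) * \prod_(z <- segs L) pwE z.
Proof.
elim: L => [|l L IH] /=; first by rewrite !big_nil mul1r.
move=> /andP[hl hL]; rewrite segs_cons !big_cons big_cat /= lw_split // IH //; ring.
Qed.

Lemma out_loops_fills L zs : all (fun l => if l is x :: _ then x \notin B else false) L ->
  all run zs -> map path_ends zs = map path_ends (segs L) ->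
  \prod_(l <- fills L zs) out_loop l = \prod_(l <- L) out_loop l.
Proof.
elim: L zs => // l L IH zs /= /andP[hl hL] hz; rewrite segs_cons map_cat => e.
have es : size zs = size (segs (l :: L)).
  by rewrite -(size_map path_ends) e segs_cons !size_cat !size_map.
have [e1 e2] := size_split es.
have /eqP : map path_ends (take (size (runs0 l)) zs) ++ map path_ends (drop (size (runs0 l)) zs) =
    map path_ends (runs0 l) ++ map path_ends (segs L) by rewrite -map_cat cat_take_drop.
rewrite eqseq_cat ?size_map // => /andP[/eqP f1 /eqP f2].
by rewrite fills_cons !big_cons out_loop_fill ?all_take // IH ?all_drop.
Qed.

Lemma plist_fits (a : nat -> E0) ps Xs :
  plist [seq lweight (lw Q) a p | p <- ps] Xs =
  (fits ps Xs)%:R * (\prod_(l <- flatten Xs) lw Q l) * \prod_(n <- shape Xs) a n.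
Proof.
elim: ps Xs => [|p ps IH] [|X Xs] //=; rewrite ?mul0r ?big_nil ?mulr1 //.
rewrite IH /lweight big_cat big_cons -mulnb natrM /=; ring.
Qed.

Definition plistN (a : nat -> E0) (ss : seq (seq (pred (seq V)))) :=
  plist [seq plist [seq lweight (lw Q) a p | p <- ps] | ps <- ss].

Lemma plistN_gfits a ss Y :
  plistN a ss Y =
  (gfits ss Y)%:R * (\prod_(l <- flatten (flatten Y)) lw Q l) * \prod_(n <- shape (flatten Y)) a n.
Proof.
elim: ss Y => [|ps ss IH] [|Xs Y] //=; rewrite ?mul0r ?big_nil ?mulr1 //.
have -> : plistN a (ps :: ss) (Xs :: Y) =
  plist [seq lweight (lw Q) a p | p <- ps] Xs * plistN a ss Y by [].
rewrite IH plist_fits flatten_cat big_cat /= /shape map_cat big_cat -mulnb natrM /=.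
ring.
Qed.

Definition paths_in (R : {set V}) (ab : seq (option (V * V))) (ws : seq (seq V)) : bool :=
  (map path_ends ws == ab) && all (fun w => (w != [::]) && all (mem R) w) ws.

Definition paths_weight (R : {set V}) ab (ws : seq (seq V)) : E0 :=
  (paths_in R ab ws)%:R * \prod_(w <- ws) pwE w.

(** A label for the endpoints of z, again a run when z is one, so that it can be put in its
    place. *)
Definition canon z := if z is x :: p then [:: x; last x p] else [::].

Lemma canon_run z : run z -> run (canon z) /\ path_ends (canon z) = path_ends z.
Proof.
case: z => // x p /andP[_ hz]; rewrite /run /=; split => //.
have xB : x \in B by case/andP: hz.
by rewrite xB andbT; apply: (allP hz); exact: mem_last.
Qed.

Lemma canon_ends z z' : path_ends z = path_ends z' -> canon z = canon z'.
Proof. by case: z => [|x p]; case: z' => [|x' p'] //= [-> ->]. Qed.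

Lemma map_canon_ends zs zs' : map path_ends zs = map path_ends zs' -> map canon zs = map canon zs'.
Proof. by elim: zs zs' => [|z zs IH] [|z' zs'] //= [/canon_ends -> /IH ->]. Qed.

Lemma map_canon_run zs : all run zs -> all run (map canon zs) /\
  map path_ends (map canon zs) = map path_ends zs.
Proof. by elim: zs => //= z zs IH /andP[/canon_run[-> ->] /IH[-> ->]]. Qed.

(** A normal form for replacing runs by runs with the same endpoints. *)
Definition skeleton Y := refillN Y (map canon (segsN Y)).

Lemma skeleton_eq Y Y0 : skeleton Y = skeleton Y0 ->
  Y = refillN Y0 (segsN Y) /\ map path_ends (segsN Y) = map path_ends (segsN Y0).
Proof.
have [h1 h2] := map_canon_run (segs_run (flatten (flatten Y))).
have [h3 h4] := map_canon_run (segs_run (flatten (flatten Y0))).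
rewrite -/(segsN _) in h1 h2 h3 h4.
move=> e; have ec : map canon (segsN Y) = map canon (segsN Y0).
  by rewrite -(segsN_refillN (Y := Y) h1) ?size_map // -/(skeleton Y) e segsN_refillN // size_map.
have ez : size (segsN Y) = size (segsN Y0).
  by rewrite -(size_map canon) ec size_map.
split; last by rewrite -h2 ec h4.
rewrite -{1}(refillN_segs Y) -(refillN_refillN (zs := map canon (segsN Y))) ?size_map //.
by rewrite -/(skeleton Y) e /skeleton refillN_refillN // size_map.
Qed.

Lemma skeleton_refillN Y zs : all run zs -> map path_ends zs = map path_ends (segsN Y) ->
  skeleton (refillN Y zs) = skeleton Y.
Proof.
move=> hz e; have es : size zs = size (segsN Y) by rewrite -(size_map path_ends) e size_map.
by rewrite /skeleton segsN_refillN // refillN_refillN ?size_map // (map_canon_ends e).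
Qed.

(* Given the skeleton, which keeps only the endpoints of the runs, the runs are weighted
   as independent walks in [B]. *)
Lemma resample a ss (KK : seq (seq V) -> (seq (seq V) -> E0) -> E0) (N : E0) :
  stable_slots (flatten ss) ->
  (forall ab h, wint (paths_weight B ab) (KK^~ h) = N * wint (paths_weight B ab) h) ->
  forall H, wint (plistN a ss) (fun Y => KK (segsN Y) (fun zs => H (refillN Y zs))) =
    N * wint (plistN a ss) H.
Proof.
move=> hss hKK H.
(* The integral is taken fibre by fibre over the skeletons. *)
have part Phi : wint (plistN a ss) Phi =
    isum (fun k => isum (fun Y => (skeleton Y == k)%:R * (plistN a ss Y * Phi Y))).
  rewrite isum_swap; apply: eq_isum => Y.
  rewrite (isum_only (t0 := skeleton Y)) ?eqxx ?mul1r // => k.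
  by rewrite eq_sym => /negPf ->; rewrite mul0r.
rewrite !part mulr_isumr; apply: eq_isum => k.
have [[Y0 [fY0 <-]]|nY] := pselect (exists Y0, gfits ss Y0 /\ skeleton Y0 = k); last first.
  rewrite !isum0 ?mulr0 // => Y; rewrite plistN_gfits.
    have [eY|] := eqVneq (skeleton Y) k; last by rewrite mul0r.
    by case fY : (gfits ss Y); rewrite ?mul0r ?mulr0 //; case: nY; exists Y.
  have [eY|] := eqVneq (skeleton Y) k; last by rewrite mul0r.
  by case fY : (gfits ss Y); rewrite ?mul0r ?mulr0 //; case: nY; exists Y.
pose ab := map path_ends (segsN Y0).
pose W0 := (\prod_(l <- flatten (flatten Y0)) out_loop l) * \prod_(n <- shape (flatten Y0)) a n.
have pinP zs : paths_in B ab zs -> all run zs /\ map path_ends zs = map path_ends (segsN Y0).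
  by move=> /andP[/eqP e h].
(* Over a fixed skeleton the tuples of runs are exactly the tuples of paths in B with endpoints
   [ab]; all other factors form the constant [W0]. *)
have fib Phi : isum (fun Y => (skeleton Y == skeleton Y0)%:R * (plistN a ss Y * Phi Y)) =
    W0 * wint (paths_weight B ab) (fun zs => Phi (refillN Y0 zs)).
  rewrite /wint mulr_isumr.
  apply: (@isum_bij _ _ _ [set Y | gfits ss Y /\ skeleton Y = skeleton Y0]%classic
     [set zs | paths_in B ab zs]%classic (refillN Y0)) => /=.
  - split => [zs /= /pinP[hz e]|zs zs' /set_mem /pinP[hz e] /set_mem /pinP[hz' e'] ee|Y /= [fY eY]].
    + have es : size zs = size (segsN Y0) by rewrite -(size_map path_ends) e size_map.
      by rewrite skeleton_refillN //; split => //; exact: gfits_refillN.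
    + have es : size zs = size (segsN Y0) by rewrite -(size_map path_ends) e size_map.
      have es' : size zs' = size (segsN Y0) by rewrite -(size_map path_ends) e' size_map.
      by rewrite -(segsN_refillN hz es) ee segsN_refillN.
    + have [e1 e2] := skeleton_eq eY; exists (segsN Y) => //=.
      by rewrite /paths_in e2 eqxx /=; exact: segs_run.
  - move=> Y hY; rewrite plistN_gfits; have [eY|_] := eqVneq (skeleton Y) (skeleton Y0); last by rewrite mul0r.
    by case fY : (gfits ss Y); rewrite ?mul0r ?mulr0 //; case: hY.
  - by move=> zs /negP/negPf hzs; rewrite /paths_weight hzs !(mul0r, mulr0).
  - move=> zs hzs; have [hz e] := pinP _ hzs.
    have es : size zs = size (segsN Y0) by rewrite -(size_map path_ends) e size_map.
    rewrite skeleton_refillN // eqxx mul1r plistN_gfits gfits_refillN // mul1r.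
    have rt : all (fun l => if l is x :: _ then x \notin B else false) (flatten (flatten Y0)).
      by apply: (fits_rooted hss); move: fY0; rewrite gfits_flatten => /andP[].
    have rt' : all (fun l => if l is x :: _ then x \notin B else false)
        (flatten (flatten (refillN Y0 zs))).
      apply: (fits_rooted hss); have := gfits_refillN hss hz es fY0.
      by rewrite gfits_flatten => /andP[].
    rewrite lws_split // flatten2_refillN segs_fills // out_loops_fills //.
    rewrite flatten_refillN shape_refill1 /paths_weight hzs mul1r /W0; ring.
rewrite !fib mulrCA -hKK; congr (_ * _).
apply: eq_wint_on => zs; rewrite /paths_weight; have [hzs _|] := boolP (paths_in B ab zs); last first.
  by rewrite mul0r eqxx.
have [hz e] := pinP _ hzs.
have es : size zs = size (segsN Y0) by have := congr1 size e; rewrite !size_map.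
rewrite segsN_refillN //; congr KK; apply/funext => zs'.
by rewrite refillN_refillN.
Qed.

End LoopWeights.

End Runs.

(** * Decomposition of a tuple of paths *)

Section Insertion.
Variables (V : finType) (R : {set V}).
Implicit Types (A : {set V}) (g : seq V).

Lemma last_insert x0 g X : size X = size g -> last x0 (insert_loops (g, X)) = last x0 g.
Proof.
elim: g X x0 => [|x g IH] [|X0 X] x0 //= [e].
by rewrite insert_cons last_cat /= IH.
Qed.

Lemma slot_returns A x (X : seq (seq V)) :
  all (if x \in A then (pred0 : pred (seq V)) else first_return_loop (R :\: A)%SET x) X ->
  all (returns x) X /\ all (mem R) (flatten X).
Proof.
case: ifP => _; first by rewrite all_pred0 => /nilP ->.
rewrite all_first_return => /andP[-> h]; split=> //.
by apply: sub_all h => y /=; rewrite inE => /andP[].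
Qed.

Lemma insert_head A x g X0 X : fits (slots R A (x :: g)) (X0 :: X) ->
  exists t, insert_loops (x :: g, X0 :: X) = x :: t.
Proof.
move=> /= /andP[/slot_returns[h _] _]; rewrite insert_cons.
case: X0 h => [|[|y e] X0] //=; first by eexists.
by move=> /andP[/andP[/eqP -> _] _]; eexists.
Qed.

Lemma path_ends_insert A g X : fits (slots R A g) X ->
  path_ends (insert_loops (g, X)) = path_ends g.
Proof.
case: g X => [|x g] [|X0 X] // h; have [t et] := insert_head h.
rewrite et; have := @last_insert x (x :: g) (X0 :: X).
rewrite et /= => -> //; have := fits_size h; by rewrite size_slots.
Qed.

Lemma all_insert A g X : fits (slots R A g) X ->
  all (mem R) (insert_loops (g, X)) = all (mem R) g.
Proof.
elim: g A X => [|x g IH] A [|X0 X] //= /andP[/slot_returns[_ h] hX].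
by rewrite insert_cons all_cat h /= (IH _ _ hX).
Qed.

Lemma insert_nil A g X : fits (slots R A g) X -> (insert_loops (g, X) == [::]) = (g == [::]).
Proof. by case: g X => [|x g] [|X0 X] // h; have [t ->] := insert_head h. Qed.

Lemma paths_in_insert C gs Y ab : gfits (gslots R C gs) Y ->
  paths_in R ab [seq insert_loops s | s <- zip gs Y] = paths_in R ab gs.
Proof.
rewrite /paths_in => h; congr (_ && _).
  congr (_ == _); elim: gs C Y h => [|g gs IH] C [|X Y] //= /andP[hX /IH ->].
  by rewrite (path_ends_insert hX).
elim: gs C Y h => [|g gs IH] C [|X Y] //= /andP[hX /IH ->].
by rewrite (insert_nil hX) (all_insert hX).
Qed.

Section Weight.
Variables (K : realType) (Q : V -> V -> K).
Hypothesis Q_ge0 : forall x y, 0 <= Q x y.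

Lemma path_weight_insert A g X : fits (slots R A g) X ->
  path_weight Q (insert_loops (g, X)) = path_weight Q g * \prod_(l <- flatten X) loop_weight Q l.
Proof.
elim: g A X => [|x g IH] A [|X0 X] //=; first by rewrite big_nil mulr1.
move=> /andP[/slot_returns[h0 _] hX].
rewrite insert_cons path_weight_cat (path_weight_flatten _ (returns_head h0)) big_cat /=.
rewrite [RHS]mulrCA; congr (_ * _).
case: g X IH hX => [|y g] [|X1 X] IH hX //.
  by rewrite /insert_loops /= big_nil mulr1.
have [t et] := insert_head hX.
have := IH _ _ hX; rewrite et !path_weight_cons => ->.
by rewrite mulrA.
Qed.

Lemma pwE_insert C gs Y : gfits (gslots R C gs) Y ->
  \prod_(w <- [seq insert_loops s | s <- zip gs Y]) pwE Q w =
  (\prod_(g <- gs) pwE Q g) * \prod_(l <- flatten (flatten Y)) lw Q l.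
Proof.
elim: gs C Y => [|g gs IH] C [|X Y] //=; first by rewrite !big_nil mulr1.
move=> /andP[hX hY]; rewrite !big_cons (IH _ _ hY) flatten_cat big_cat /=.
rewrite {1}/pwE (path_weight_insert hX) enM ?path_weight_ge0 // -/(pwE _ _).
rewrite en_prod; last by move=> l _; exact: loop_weight_ge0.
ring.
Qed.

Definition skel_weight ab (gs : seq (seq V)) : ennreal K :=
  (greduced finset.set0 gs && paths_in R ab gs)%:R * \prod_(g <- gs) pwE Q g.

(** Existence of the decomposition is [gfits_exists] and uniqueness is [gfits_inj];
    [paths_in_insert] passes endpoints and region to the skeletons. *)
Lemma wint_decompose ab F :
  wint (paths_weight Q R ab) F =
  wint (skel_weight ab) (fun gs => wint (plistN Q (fun=> 1) (gslots R finset.set0 gs))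
    (fun Y => F [seq insert_loops s | s <- zip gs Y])).
Proof.
rewrite /wint; under [RHS]eq_isum do rewrite mulr_isumr.
rewrite isum_pair.
apply: (@isum_bij _ _ _ [set ws | paths_in R ab ws]%classic
  [set p : seq (seq V) * seq (seq (seq (seq V))) |
     [&& greduced finset.set0 p.1, paths_in R ab p.1 & gfits (gslots R finset.set0 p.1) p.2]]%classic
  (fun p => [seq insert_loops s | s <- zip p.1 p.2])) => /=.
- split => [[gs Y] /= /and3P[hg hp hY]|[gs Y] [gs' Y'] /set_mem /= /and3P[hg _ hY]
     /set_mem /= /and3P[hg' _ hY'] e|ws /= hws].
  + by rewrite (paths_in_insert _ hY).
  + by have [-> ->] := gfits_inj hg hY hg' hY' e.
  + have hR : all (all (mem R)) ws.
      by case/andP: hws => _; apply: sub_all => w /andP[].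
    have [gs [Y [hg hY e _]]] := gfits_exists finset.set0 hR.
    by exists (gs, Y); rewrite //= hg hY -(paths_in_insert _ hY) e hws.
- by move=> ws /negP/negPf h; rewrite /paths_weight h !mul0r.
- move=> [gs Y] /= h; rewrite /skel_weight plistN_gfits.
  case: (boolP (greduced _ _)) h => hg /=; last by rewrite !mul0r.
  case: (boolP (paths_in _ _ _)) => hp /=; last by rewrite !mul0r.
  by move=> /negP/negPf ->; rewrite !(mul0r, mulr0).
- move=> [gs Y] /= /and3P[hg hp hY]; rewrite /skel_weight /paths_weight plistN_gfits.
  rewrite (paths_in_insert _ hY) hp hg hY (pwE_insert hY) /=.
  rewrite big1_eq; ring.
Qed.

End Weight.

End Insertion.

(** * Layers *)

Section Levels.
Variables (K : realType) (V : finType) (Q : V -> V -> K) (lambda : K).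
Hypothesis Q_ge0 : forall x y, 0 <= Q x y.
Hypothesis lambda_bounds : 0 <= lambda <= 1.
Local Notation E0 := (ennreal K).
Implicit Types (R B C A : {set V}) (gs ws zs : seq (seq V)).

Local Notation plistQ := (plistN Q).
Local Notation del := (deleted lambda).
Local Notation ret := (retained lambda).

Definition cat1 (X Y : seq (seq (seq V))) := [seq p.1 ++ p.2 | p <- zip X Y].
Definition catN (X Y : seq (seq (seq (seq V)))) := [seq cat1 p.1 p.2 | p <- zip X Y].

Lemma plistN_thin ss G :
  wint (plistQ (fun=> 1) ss) (fun Y => fint (flaw_map (flaw_map (@thin_list K lambda _)) Y) G) =
  wint (plistQ del ss) (fun=> wint (plistQ ret ss) G).
Proof.
rewrite /plistN.
have hk X : nonnegf (flaw_map (@thin_list K lambda (seq V)) X).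
  by apply: nonnegf_map => x; exact: nonnegf_thin.
rewrite (plist_flaw_map (w2 := fun ps => plist [seq lweight (lw Q) del p | p <- ps])
  (w3 := fun ps => plist [seq lweight (lw Q) ret p | p <- ps])) // => ps h.
rewrite (plist_flaw_map (w2 := lweight (lw Q) del) (w3 := lweight (lw Q) ret)) //.
- by move=> X; exact: nonnegf_thin.
- by move=> p h'; exact: thin_split.
Qed.

Lemma plistN_merge ss h :
  wint (plistQ del ss) (fun D => wint (plistQ ret ss) (fun Y => h (catN D Y))) =
  wint (plistQ (fun=> 1) ss) h.
Proof.
rewrite /plistN /catN.
rewrite (plist_zip (op := cat1) (w1 := fun ps => plist [seq lweight (lw Q) (fun=> 1) p | p <- ps])) //.
move=> ps h'; rewrite /cat1.
rewrite (plist_zip (op := cat) (w1 := lweight (lw Q) (fun=> 1))) // => p h''.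
exact: thin_merge.
Qed.

Lemma nonnegf_thin_strand (s : strand V) : nonnegf (thin_strand lambda s).
Proof.
apply: nonnegf_bind => [|x]; last exact: nonnegf_ret.
by apply: nonnegf_map => X; exact: nonnegf_thin.
Qed.

Lemma fint_thin_strands gs Y F : size Y = size gs ->
  fint (flaw_map (fun s => thin_strand lambda s) (zip gs Y)) F =
  fint (flaw_map (flaw_map (@thin_list K lambda _)) Y) (fun Ys => F (zip gs Ys)).
Proof.
have hk X : nonnegf (flaw_map (@thin_list K lambda (seq V)) X).
  by apply: nonnegf_map => x; exact: nonnegf_thin.
elim: gs Y F => [|g gs IH] [|X Y] F //=; first by rewrite !fint_ret.
move=> [e]; have := fint_map_cons (g, X) (zip gs Y) F nonnegf_thin_strand => /= ->.
have := fint_map_cons X Y (fun Ys => F (zip (g :: gs) Ys)) hk => /= ->.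
rewrite fint_bind //; apply: eq_fint => X'; rewrite fint_ret.
exact: (IH Y (fun ys => F ((g, X') :: ys))).
Qed.

(** Every outcome of thinning is a final part of the list; this suffices for tracking
    admissibility. *)
Definition dropped (E : eqType) (X X' : seq E) := X' == drop (size X - size X')%N X.

Lemma all_dropped (E : eqType) (p : pred E) X X' : dropped X X' -> all p X -> all p X'.
Proof. by move=> /eqP -> h; exact: all_drop. Qed.

Lemma supported_thin (E : eqType) (X : seq E) : supported (dropped X) (thin_list lambda X).
Proof.
rewrite /supported /thin_list all_map; apply/allP => k; rewrite mem_iota ltnS => /andP[_ kX] /=.
by rewrite /dropped size_drop subKn.
Qed.

Lemma supported_thin_strand (s : strand V) :
  supported (fun s' : strand V => (s'.1 == s.1) && all2 (@dropped _) s.2 s'.2) (thin_strand lambda s).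
Proof.
apply: (supported_bind (S := all2 (@dropped _) s.2)).
  by apply: (supported_map (S := predT)) => [|X _]; rewrite ?all_predT //; exact: supported_thin.
by move=> X hX; rewrite supported_ret eqxx.
Qed.

Lemma fits_dropped (E : eqType) (ps : seq (pred E)) X X' : all2 (@dropped _) X X' -> fits ps X -> fits ps X'.
Proof.
elim: ps X X' => [|p ps IH] [|x X] [|x' X'] //= /andP[hx hX] /andP[px pX].
by rewrite (all_dropped hx px) (IH _ _ hX pX).
Qed.

Lemma gfits_dropped gs ss Y (kept : seq (strand V)) : size gs = size ss ->
  all2 (fun s s' : strand V => (s'.1 == s.1) && all2 (@dropped _) s.2 s'.2) (zip gs Y) kept ->
  gfits ss Y -> kept = zip gs (unzip2 kept) /\ gfits ss (unzip2 kept).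
Proof.
elim: gs ss Y kept => [|g gs IH] [|ps ss] [|X Y] [|[g' X'] kept] //= [e].
move=> /andP[/andP[/eqP -> hX] hY] /andP[fX fY].
by have [<- ->] := IH _ _ _ e hY fY; rewrite (fits_dropped hX fX).
Qed.

Lemma nonnegf_construct n R ws : nonnegf (construct_rec lambda n R ws).
Proof.
elim: n R ws => [|n IH] R ws /=; first exact: nonnegf_ret.
apply: nonnegf_bind => [|kept]; first by apply: nonnegf_map => s; exact: nonnegf_thin_strand.
apply: nonnegf_bind => [|zs]; last exact: nonnegf_ret.
by case: segments => [|z zs]; [exact: nonnegf_ret|exact: IH].
Qed.

Lemma mem_gsupp x gs : (x \in gsupp gs) = has (fun g => x \in g) gs.
Proof.
rewrite /gsupp; elim: gs => [|g gs IH]; first by rewrite big_nil inE.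
by rewrite big_cons !inE IH.
Qed.

Lemma gsupp_cons g gs : gsupp (g :: gs) = ([set x in g] :|: gsupp gs)%SET.
Proof. by rewrite /gsupp big_cons. Qed.

(** Vertices of B are neither in C nor on g, so new runs can neither visit the root nor leave the
    domain of a first-return loop. *)
Lemma stable_slots_slots R B C g : B \subset R ->
  {in B, forall x, x \notin C /\ x \notin g} -> stable_slots B (slots R C g).
Proof.
move=> BR; elim: g C => [|x g IH] C h //=.
have xB : x \notin B by apply/negP => /h[_]; rewrite mem_head.
split; last first.
  apply: IH => y /h[yC]; rewrite in_cons negb_or => /andP[yx yg].
  by rewrite !inE negb_or yx.
case: ifP => xC l //=; case: l => // y e /= /and3P[/eqP -> xe /andP[xRC hl]].
split=> // zs hz; rewrite (negPf xB) /= => es; rewrite eqxx xRC /=.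
have : all (fun z => (z != x) && (z \in (R :\: C)%SET)) (fill_runs B false e zs).
  apply: fill_all => // [|z ze _].
    apply: sub_all hz => w /andP[_]; apply: sub_all => z zB.
    have [zC zxg] := h z zB; rewrite /= !inE zC (fintype.subsetP BR _ zB) !andbT.
    by apply: contraNneq xB => <-.
  have zx : z != x by apply: contraNneq xe => <-.
  by rewrite zx /=; exact: (allP hl).
rewrite all_predI => /andP[h1 h2]; apply/andP; split; last exact: h2.
by apply/negP => /(allP h1); rewrite eqxx.
Qed.

Lemma stable_gslots R B C gs : B \subset R ->
  {in B, forall x, x \notin C /\ x \notin gsupp gs} -> stable_slots B (flatten (gslots R C gs)).
Proof.
move=> BR; elim: gs C => [|g gs IH] C h //=.
apply/stable_slots_cat; split.
  apply: stable_slots_slots => // x /h[xC]; rewrite gsupp_cons finset.in_setU negb_or inE.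
  by move=> /andP[].
apply: IH => x /h[xC]; rewrite gsupp_cons finset.in_setU negb_or => /andP[xg xgs].
by rewrite finset.in_setU negb_or xC xg.
Qed.

Lemma stable_gslots0 R gs :
  stable_slots (R :\: gsupp gs)%SET (flatten (gslots R finset.set0 gs)).
Proof.
apply: stable_gslots; first exact: finset.subsetDl.
by move=> x; rewrite !inE => /andP[].
Qed.

Lemma paths_in_segs B (L : seq (seq V)) : paths_in B (map (@path_ends V) (segs B L)) (segs B L).
Proof. by rewrite /paths_in eqxx; exact: segs_run. Qed.

Lemma paths_in_run B ab zs (L : seq (seq V)) : ab = map (@path_ends V) (segs B L) -> paths_in B ab zs ->
  all (run B) zs /\ size zs = size (segs B L).
Proof.
by move=> -> /andP[/eqP e h]; split => //; have := congr1 size e; rewrite !size_map.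
Qed.

Definition ext_construct n B zs : flaw K (seq (seq V)) :=
  if zs is [::] then flaw_ret K [::] else construct_rec lambda n B zs.

(** Thinning keeps the skeletons, recursive calls keep the endpoints of the runs, and insertion
    keeps those of the skeletons. *)
Lemma supported_construct n R ab ws : paths_in R ab ws ->
  supported (paths_in R ab) (construct_rec lambda n R ws).
Proof.
elim: n R ab ws => [|n IH] R ab ws hws.
  by change (is_true (supported (paths_in R ab) (flaw_ret K ws))); rewrite supported_ret.
rewrite [construct_rec _ _ _ _]/=.
have hR : all (all (mem R)) ws by case/andP: hws => _; apply: sub_all => w /andP[].
have [gs [Y [hg hY e _]]] := gfits_exists finset.set0 hR.
have hgs : paths_in R ab gs by rewrite -(paths_in_insert _ hY) e.
rewrite -e entangle_gfits // (entangled_range_gfits hg hY).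
have sg : size gs = size (gslots R finset.set0 gs) by rewrite size_gslots.
set B := (R :\: _)%SET.
apply: (supported_bind (S := all2 (fun s s' : strand V =>
    (s'.1 == s.1) && all2 (@dropped _) s.2 s'.2) (zip gs Y))).
  by apply: (supported_map (S := predT)) => [|s _]; rewrite ?all_predT //; exact: supported_thin_strand.
move=> kept /(gfits_dropped sg)/(_ hY)[ek hk]; rewrite ek.
move: (unzip2 kept) hk => Yk hk {ek}.
have sk : size Yk = size gs by rewrite (gfits_size hk) sg.
rewrite segmentsE unzip2_zip ?sk //.
pose ab' := map (@path_ends V) (segsN B Yk).
apply: (supported_bind (S := paths_in B ab')).
  have ext zs ab0 : paths_in B ab0 zs -> supported (paths_in B ab0) (ext_construct n B zs).
    by case: zs => [|z zs] h; [rewrite supported_ret|exact: IH].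
  exact: ext (paths_in_segs B (flatten (flatten Yk))).
move=> zs hzs; have [hz es] := paths_in_run erefl hzs.
rewrite supported_ret refillE unzip1_zip ?unzip2_zip ?sk //.
by rewrite (paths_in_insert (C := finset.set0)) ?gfits_refillN //; exact: stable_gslots0.
Qed.

Lemma supported_ext_construct n R ab ws : paths_in R ab ws ->
  supported (paths_in R ab) (ext_construct n R ws).
Proof.
case: ws => [|w ws]; last exact: supported_construct.
move=> h; change (is_true (supported (paths_in R ab) (flaw_ret K [::]))).
by rewrite supported_ret.
Qed.

Lemma fint_construct n R gs Y F :
  greduced finset.set0 gs -> gfits (gslots R finset.set0 gs) Y ->
  let B := (R :\: gsupp gs)%SET in
  fint (construct_rec lambda n.+1 R [seq insert_loops s | s <- zip gs Y]) F =
  fint (flaw_map (flaw_map (@thin_list K lambda _)) Y) (fun Ys =>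
    fint (ext_construct n B (segments B (zip gs Ys))) (fun zs =>
      F [seq insert_loops s | s <- refill B (zip gs Ys) zs])).
Proof.
move=> hg hY /=.
rewrite entangle_gfits // (entangled_range_gfits hg hY).
rewrite fint_bind; last by apply: nonnegf_map => s; exact: nonnegf_thin_strand.
rewrite fint_thin_strands; last by rewrite (gfits_size hY) size_gslots.
apply: eq_fint => Ys; rewrite fint_bind; last first.
  by case: segments => [|z zs]; [exact: nonnegf_ret|exact: nonnegf_construct].
by apply: eq_fint => zs; rewrite fint_ret.
Qed.

Definition ext_layers n B zs : seq (layer V) :=
  if zs is [::] then [::] else layers_rec n B zs.

Lemma layers_gfits n R gs Y : greduced finset.set0 gs -> gfits (gslots R finset.set0 gs) Y ->
  let B := (R :\: gsupp gs)%SET in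
  layers_rec n.+1 R [seq insert_loops s | s <- zip gs Y] =
  (zip gs Y, B) :: ext_layers n B (segsN B Y).
Proof.
move=> hg hY; have sY : size Y = size gs by rewrite (gfits_size hY) size_gslots.
move=> B; rewrite [LHS]/= entangle_gfits // strands_supp_zip // -/B segmentsE.
by rewrite unzip2_zip ?sY.
Qed.

Definition avoids (S : {set V}) (l : loop V) := [disjoint loop_supp l & S].

Lemma address_cons (ly : layer V) lys l :
  address (ly :: lys) l =
  if avoids (strands_supp ly.1) l then let: (n, i, t) := address lys l in (n.+1, i, t)
  else let gs := unzip1 ly.1 in let i := find (has (mem (loop_supp l))) gs in
    (0%N, i, find (mem (loop_supp l)) (nth [::] gs i)).
Proof. by rewrite /address /avoids /=; case: [disjoint _ & _]. Qed.

(** Inner layers receive only soup loops avoiding the first layer, at addresses shifted by one. *)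
Lemma assigned_shift ly lys c n i t u :
  assigned K (ly :: lys) c n.+1 i t u =
  assigned K lys [seq l <- c | avoids (strands_supp ly.1) l] n i t u.
Proof.
rewrite /assigned -filter_predI; congr (flaw_bind (flaw_map _ _) _).
apply: eq_filter => l; rewrite address_cons /predI inE.
case: (address lys l) => -[n' i'] t'; case: ifP => _; last by rewrite andbF !xpair_eqE.
by rewrite andbT !xpair_eqE eqSS.
Qed.

Lemma rebuild_shift ly lys c n rest :
  rebuild K (ly :: lys) c n.+1 rest =
  rebuild K lys [seq l <- c | avoids (strands_supp ly.1) l] n rest.
Proof.
elim: rest n => // -[st B] rest IH n /=; rewrite IH; congr flaw_bind; apply/funext => zs.
congr flaw_bind; congr (flaw_map _ _); apply/funext => p.
by congr (flaw_map _ _); apply/funext => q; rewrite assigned_shift.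
Qed.

Lemma nonnegf_assigned lys c n i t u : nonnegf (assigned K (V := V) lys c n i t u).
Proof.
apply: nonnegf_bind => [|r]; first by apply: nonnegf_map => l; exact: nonnegf_uniform.
by apply: nonnegf_bind => [|o]; [exact: nonnegf_uniform|exact: nonnegf_ret].
Qed.

Lemma nonnegf_assigned_strand lys c n i g : nonnegf (assigned_strand K (V := V) lys c n i g).
Proof. by apply: nonnegf_map => p; exact: nonnegf_assigned. Qed.

Lemma nonnegf_rebuild lys c n rest : nonnegf (rebuild K (V := V) lys c n rest).
Proof.
elim: rest n => [|[st B] rest IH] n /=; first exact: nonnegf_ret.
apply: nonnegf_bind => // zs; apply: nonnegf_bind => [|added]; last exact: nonnegf_ret.
by apply: nonnegf_map => p; exact: nonnegf_assigned_strand.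
Qed.

Lemma flaw_map_map (A E F : Type) (f : A -> E) (k : E -> flaw K F) s :
  flaw_map k (map f s) = flaw_map (fun x => k (f x)) s.
Proof. by elim: s => //= x s ->. Qed.

Lemma eq_in_flaw_map (A : eqType) (F : Type) (k k' : A -> flaw K F) s :
  {in s, k =1 k'} -> flaw_map k s = flaw_map k' s.
Proof.
elim: s => //= x s IH h; rewrite h ?mem_head // IH // => y ys; apply: h.
by rewrite inE ys orbT.
Qed.

Lemma zip_iota (E : Type) (x0 : E) s :
  zip (iota 0 (size s)) s = [seq (i, nth x0 s i) | i <- iota 0 (size s)].
Proof.
rewrite -{2}(mkseq_nth x0 s) /mkseq -{1}(map_id (iota 0 (size s))).
by rewrite zip_map.
Qed.

Lemma gslotsE R C gs : gslots R C gs =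
  [seq slots R (C :|: gsupp (take i gs))%SET (nth [::] gs i) | i <- iota 0 (size gs)].
Proof.
elim: gs C => //= g gs IH C; rewrite /gsupp big_nil finset.setU0 IH; congr (_ :: _).
rewrite (iotaDl 1 0) -map_comp; apply: eq_map => i /=.
by rewrite /gsupp big_cons finset.setUA.
Qed.

Lemma slotsE R A g u0 : slots R A g =
  [seq slot (R :\: (A :|: [set x in take t g]))%SET (nth u0 g t)
     (nth u0 g t \notin (A :|: [set x in take t g])%SET) | t <- iota 0 (size g)].
Proof.
elim: g A => //= x g IH A.
have -> : (A :|: [set y in [::]] = A)%SET by apply/setP => y; rewrite !inE orbF.
rewrite IH /slot; congr (_ :: _); first by case: (x \in A).
rewrite (iotaDl 1 0) -map_comp; apply: eq_map => i /=.
by rewrite set_cons.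
Qed.

Lemma find_eq (E : Type) (a : pred E) s x0 i : (i < size s)%N -> a (nth x0 s i) ->
  (find a s == i) = ~~ has a (take i s).
Proof.
move=> hi ai; rewrite has_take_leq ?(ltnW hi) // -leqNgt eqn_leq.
suff -> : (find a s <= i)%N by [].
by rewrite leqNgt; apply/negP => /(before_find x0); rewrite ai.
Qed.

(** * Soup loops assigned to the first layer *)

Section Level0.
Variables (R : {set V}) (gs : seq (seq V)) (st : seq (strand V)) (B0 : {set V})
  (lys' : seq (layer V)).
Hypothesis gsE : unzip1 st = gs.
Let lys := (st, B0) :: lys'.
Let S := gsupp gs.

Lemma strands_suppE : strands_supp st = S.
Proof. by rewrite /S -gsE /strands_supp /gsupp big_map. Qed.

Lemma address0 l : ~~ avoids S l ->
  address lys l = (0%N, find (has (mem (loop_supp l))) gs,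
    find (mem (loop_supp l)) (nth [::] gs (find (has (mem (loop_supp l))) gs))).
Proof. by move=> h; rewrite address_cons /= strands_suppE (negPf h) gsE. Qed.

Lemma address0_meets l i t : address lys l = (0%N, i, t) -> ~~ avoids S l.
Proof.
by rewrite address_cons /= strands_suppE; case: ifP.
Qed.

Lemma meets_has l : (~~ avoids S l) = has (has (mem (loop_supp l))) gs.
Proof.
apply/idP/hasP => [/pred0Pn[x /andP[/= xl]]|[g ggs /hasP[x xg xl]]].
  rewrite mem_gsupp => /hasP[g ggs xg]; exists g => //; apply/hasP; exists x => //.
apply/pred0Pn; exists x; apply/andP; split => //=.
by rewrite mem_gsupp; apply/hasP; exists g.
Qed.

(** An address is the first meeting, so it is (0, i, t) when r avoids all that precedes: the earlier
    skeletons and the earlier vertices of this one, which form A. Since r starts at u, this includes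
    that u is new. *)
Lemma address0E i t (r : seq V) u : (i < size gs)%N -> (t < size (nth [::] gs i))%N ->
  nth u (nth [::] gs i) t = u ->
  let A := (finset.set0 :|: gsupp (take i gs) :|: [set x in take t (nth [::] gs i)])%SET in
  all (mem R) r -> ohead r = Some u ->
  (address lys (\pi_(loop V) r) == (0%N, i, t)) = (u \notin A) && all (mem (R :\: A)%SET) r.
Proof.
move=> hi ht hu A hR hr; rewrite finset.set0U in A *.
have ur : u \in r by case: (r) hr => // x e [<-]; rewrite mem_head.
have lE : loop_supp (\pi_(loop V) r) = [set x in r]%SET by exact: loop_supp_pi.
have a1 : has (mem (loop_supp (\pi_(loop V) r))) (nth [::] gs i).
  by apply/hasP; exists u; [rewrite -hu mem_nth|rewrite /= lE inE].
have ms : ~~ avoids S (\pi_(loop V) r).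
  rewrite meets_has; apply/hasP; exists (nth [::] gs i) => //; exact: mem_nth.
rewrite address0 // !xpair_eqE eqxx /=.
have -> : (u \notin A) && all (mem (R :\: A)%SET) r = ~~ has (mem A) r.
  apply/andP/hasPn => [[_ /allP h] x /h|h]; first by rewrite /= inE => /andP[].
  split; first exact: h.
  apply/allP => x xr; have xR : x \in R := allP hR x xr.
  by rewrite /= finset.in_setD xR andbT; exact: h.
have -> : has (mem A) r = has (has (mem [set x in r]%SET)) (take i gs) ||
    has (mem [set x in r]%SET) (take t (nth [::] gs i)).
  apply/hasP/orP => [[x xr]|[/hasP[g gi /hasP[x xg]]|/hasP[x xt]]] /=.
  - rewrite /A !inE mem_gsupp => /orP[/hasP[g gi xg]|xt]; [left|right].
      by apply/hasP; exists g => //; apply/hasP; exists x; rewrite //= inE.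
    by apply/hasP; exists x; rewrite //= inE.
  - rewrite inE => xr; exists x => //; rewrite /A !inE mem_gsupp.
    by apply/orP; left; apply/hasP; exists g.
  - by rewrite inE => xr; exists x; rewrite // /A !inE xt orbT.
rewrite negb_or -lE -(find_eq hi a1).
have [e|//] := eqVneq (find _ gs) i; rewrite e /=.
by apply: (@find_eq _ _ _ u _ ht); rewrite hu /= lE inE.
Qed.

Lemma restrict_restrict (E : Type) (p q : pred E) (w : E -> E0) :
  (forall x, p x -> q x) -> restrict p (restrict q w) = restrict p w.
Proof.
move=> h; apply/funext => x; rewrite /restrict; case px : (p x); last by rewrite !mul0r.
by rewrite (h _ px) !mul1r.
Qed.

Definition level0 c := flaw_map (fun p : nat * strand V => assigned_strand K lys c 0 p.1 p.2.1)
  (zip (iota 0 (size st)) st).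

Lemma level0E c : level0 c =
  flaw_map (fun i => assigned_strand K lys c 0 i (nth [::] gs i)) (iota 0 (size gs)).
Proof.
rewrite /level0 (zip_iota ([::], [::])) flaw_map_map -gsE size_map.
apply: eq_in_flaw_map => i; rewrite mem_iota => /andP[_ hi] /=.
by rewrite (nth_map ([::], [::])).
Qed.

Lemma assigned_strandE c i g u0 : assigned_strand K lys c 0 i g =
  flaw_map (fun t => assigned K lys c 0 i t (nth u0 g t)) (iota 0 (size g)).
Proof. by rewrite /assigned_strand (zip_iota u0) flaw_map_map. Qed.

Lemma assigned_filter c i t u (p : pred (loop V)) :
  (forall l, address lys l = (0%N, i, t) -> p l) ->
  assigned K lys c 0 i t u = assigned K lys [seq l <- c | p l] 0 i t u.
Proof.
move=> h; rewrite /assigned -filter_predI; congr (flaw_bind (flaw_map _ _) _).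
apply: eq_filter => l /=; case: eqP => // e; by rewrite h.
Qed.

Lemma soup_strand i h : (i < size gs)%N ->
  soup (restrict (fun l => ~~ avoids S l && (find (has (mem (loop_supp l))) gs == i))
    (loop_int Q lambda R)) (fun c => fint (assigned_strand K lys c 0 i (nth [::] gs i)) h) =
  wint (plist [seq lweight (lw Q) del p |
    p <- slots R (finset.set0 :|: gsupp (take i gs))%SET (nth [::] gs i)]) h.
Proof.
move=> hi; set w := restrict _ _.
(* An empty skeleton gives no default vertex for [nth]; no loop can meet it, so this part of the
   soup has intensity 0. *)
have [u0 _|] := pickP (mem (nth [::] gs i)); last first.
  move=> h0; have g0 : nth [::] gs i = [::].
    by case: (nth [::] gs i) h0 => // x g /(_ x); rewrite /= mem_head.
  rewrite g0 /= wint_plist_nil /assigned_strand /=.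
  rewrite soup0 ?fint_ret // => l; rewrite /w /restrict.
  case: (boolP (~~ _ && _)) => [/andP[hl /eqP hf]|]; last by rewrite mul0r.
  have := nth_find [::] (_ : has (has (mem (loop_supp l))) gs).
  by rewrite -meets_has hf g0 => /(_ hl).
rewrite (slotsE R _ _ u0) -map_comp; under eq_soup do rewrite (assigned_strandE _ _ _ u0).
apply: (soup_flaw_map (idx := id) (p := fun t l => address lys l == (0%N, i, t))
   (kern := fun t c => assigned K lys c 0 i t (nth u0 (nth [::] gs i) t))).
- by move=> t c; exact: nonnegf_assigned.
- by move=> t c; apply: assigned_filter => l ->.
- by rewrite map_id iota_uniq.
- by move=> t t' l /eqP -> /eqP[].
- move=> l; rewrite /w /restrict; case: (boolP (~~ _ && _)) => [/andP[hl /eqP hf] _|]; last first.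
    by rewrite mul0r eqxx.
  apply/hasP; exists (find (mem (loop_supp l)) (nth [::] gs i)); last by rewrite address0 // hf.
  rewrite mem_iota /= -has_find -hf; apply: nth_find.
  by rewrite -meets_has.
- move=> t h'; rewrite mem_iota => /andP[_ ht].
  rewrite /w restrict_restrict; last first.
    move=> l /eqP e; have hl := address0_meets e; rewrite hl /=.
    by move: e; rewrite address0 // => -[-> _].
  rewrite /=; apply: (soup_assigned Q_ge0 lambda_bounds (P := fun l => address lys l == (0%N, i, t))) => //.
  + exact: finset.subsetDl.
  + move=> r hR hr; apply: address0E => //.
    by rewrite (set_nth_default u0).
Qed.

(** The soup is partitioned by the skeleton first met, and in [soup_strand] by the time of the
    meeting; [soup_flaw_map] turns each partition into a product. *)
Lemma soup_level0 h :
  soup (restrict (fun l => ~~ avoids S l) (loop_int Q lambda R)) (fun c => fint (level0 c) h) =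
  wint (plistQ del (gslots R finset.set0 gs)) h.
Proof.
under eq_soup do rewrite level0E.
rewrite /plistN gslotsE -map_comp.
apply: (soup_flaw_map (idx := id)
   (p := fun i l => ~~ avoids S l && (find (has (mem (loop_supp l))) gs == i))
   (kern := fun i c => assigned_strand K lys c 0 i (nth [::] gs i))).
- by move=> i c; exact: nonnegf_assigned_strand.
- move=> i c; congr (flaw_map _ _); apply/funext => q; apply: assigned_filter => l e.
  have hl := address0_meets e; rewrite hl /=.
  by move: e; rewrite address0 // => -[-> _].
- by rewrite map_id iota_uniq.
- by move=> i j l /andP[_ /eqP ->] /andP[_ /eqP].
- move=> l; rewrite /restrict /=; case: (boolP (~~ avoids S l)) => [hl _|_]; last by rewrite mul0r eqxx.
  apply/hasP; exists (find (has (mem (loop_supp l))) gs); last by rewrite /= eqxx.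
  by rewrite mem_iota /= -has_find -meets_has.
- move=> i h'; rewrite mem_iota => /andP[_ hi].
  rewrite restrict_restrict; last by move=> l /andP[].
  exact: soup_strand.
Qed.

Lemma fint_map_mass (A : eqType) (F : Type) (k : A -> flaw K F) s :
  (forall x, nonnegf (k x)) -> {in s, forall x, fint (k x) (fun=> 1) = 1} ->
  fint (flaw_map k s) (fun=> 1) = 1.
Proof.
move=> hk; elim: s => [|x s IH] h; first by rewrite fint_ret.
rewrite fint_map_cons // IH ?h ?mem_head // => z zs.
by apply: h; rewrite inE zs orbT.
Qed.

Lemma fint_uniform_mass (E : Type) (s : seq E) : (0 < size s)%N ->
  fint (flaw_uniform K s) (fun=> 1) = 1.
Proof.
move=> hs; rewrite fint_uniform big_const_seq count_predT iter_addr_0.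
by rewrite en_natV -lt0n hs.
Qed.

(** [flaw_uniform] has mass 0 on an empty list, so the point to check is that an assigned loop
    visits the vertex at its address. *)
Lemma level0_mass c : fint (level0 c) (fun=> 1) = 1.
Proof.
rewrite level0E; apply: fint_map_mass => [i|i]; first exact: nonnegf_assigned_strand.
rewrite mem_iota => /andP[_ hi].
have [u0 _|h0] := pickP (mem (nth [::] gs i)); last first.
  have -> : nth [::] gs i = [::].
    by case: (nth [::] gs i) h0 => // x g /(_ x); rewrite /= mem_head.
  by rewrite /assigned_strand fint_ret.
rewrite (assigned_strandE _ _ _ u0); apply: fint_map_mass => [t|t]; first exact: nonnegf_assigned.
rewrite mem_iota => /andP[_ ht].
rewrite /assigned fint_bind; last by apply: nonnegf_map => l; exact: nonnegf_uniform.
have e2 (r : seq (seq V)) : fint (flaw_bind (flaw_uniform K (arrangements r)) (fun o =>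
    flaw_ret K (flatten [seq cut_at (nth u0 (nth [::] gs i) t) l | l <- o]))) (fun=> 1) = 1.
  rewrite fint_bind ?nonnegf_uniform // -[RHS](fint_uniform_mass (s := arrangements r)).
    by apply: eq_fint => o; rewrite fint_ret.
  by rewrite size_arrangements fact_gt0.
under eq_fint do rewrite e2.
apply: fint_map_mass => [l|l]; first exact: nonnegf_uniform.
rewrite mem_filter => /andP[/eqP el _]; apply: fint_uniform_mass.
have hl := address0_meets el; move: el; rewrite address0 // => -[ei].
rewrite ei => et; have hf : has (mem (loop_supp l)) (nth [::] gs i).
  by rewrite has_find et.
have := nth_find u0 hf; rewrite et /= inE => hu.
rewrite -[l]reprK (perm_size (rootings_pi _ _)) size_rots_filter -has_count has_pred1.
exact: hu.
Qed.

End Level0.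

End Levels.

(** * Recovery *)

Section Recovery.
Variables (K : realType) (V : finType) (Q : V -> V -> K) (lambda : K).
Hypothesis Q_ge0 : forall x y, 0 <= Q x y.
Hypothesis lambda_bounds : 0 <= lambda <= 1.
Local Notation E0 := (ennreal K).
Implicit Types (R B : {set V}) (gs ws zs : seq (seq V)).

Local Notation plistQ := (plistN Q).
Local Notation del := (deleted lambda).
Local Notation ret := (retained lambda).
Local Notation loop_intQ := (loop_int Q lambda).

Definition soup_mass R : E0 := soup (loop_intQ R) (fun=> 1).

Lemma soup_cst (E : choiceType) (w : E -> E0) a : soup w (fun=> a) = soup w (fun=> 1) * a.
Proof. by rewrite mulrC -soupZ; apply: eq_soup => c; rewrite mulr1. Qed.

Lemma wint_cst (E : choiceType) (w : E -> E0) a : wint w (fun=> a) = wint w (fun=> 1) * a.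
Proof. by rewrite mulrC -wintZ; apply: eq_wint => c; rewrite mulr1. Qed.

Lemma loop_int_avoids R (S : {set V}) :
  restrict (avoids S) (loop_intQ R) = loop_intQ (R :\: S)%SET.
Proof.
apply/funext => l; rewrite /restrict /loop_int mulr_isumr; apply: eq_isum => s.
have [<-|_] := eqVneq (\pi_(loop V) s) l; last by rewrite !mul0r mulr0.
rewrite !mul1r; have [->|s0] := eqVneq s [::]; first by rewrite /= mulr0 en0 mulr0.
rewrite !rooted_loop_massE // /avoids loop_supp_pi.
have -> : all (mem (R :\: S)%SET) s = [disjoint [set x in s]%SET & S] && all (mem R) s.
  apply/allP/andP => [h|[dis /allP h] x xs].
    split; last by apply/allP => x /h /=; rewrite inE => /andP[].
    rewrite disjoint_subset; apply/fintype.subsetP => x; rewrite !inE => /h /=.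
    by rewrite inE => /andP[].
  have xR : x \in R := h x xs.
  rewrite /= finset.in_setD xR andbT; move: dis; rewrite disjoint_subset => /fintype.subsetP /(_ x).
  by rewrite !inE; exact.
by case: [disjoint _ & _]; rewrite /= ?mul1r // !mul0r mulr0 en0.
Qed.

Lemma prepend_zip gs D Y : size D = size gs -> size Y = size gs ->
  [seq insert_loops (prepend_lists p.1 p.2) | p <- zip D (zip gs Y)] =
  [seq insert_loops s | s <- zip gs (catN D Y)] :> seq (seq V).
Proof.
elim: gs D Y => [|g gs IH] [|d D] [|y Y] //= [e1] [e2].
by rewrite (IH _ _ e1 e2).
Qed.

(** [soup_level0] is integrated against 1, the assignment having mass 1 by [level0_mass]. *)
Lemma soup_mass_split R gs :
  soup_mass R = soup_mass (R :\: gsupp gs)%SET * wint (plistQ del (gslots R finset.set0 gs)) (fun=> 1).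
Proof.
(* Addresses depend on the skeletons alone, so the strands may carry empty lists. *)
have gsE : unzip1 ([seq (g, [::]) | g <- gs] : seq (strand V)) = gs.
  by elim: gs => //= g gs ->.
rewrite -(soup_level0 Q_ge0 lambda_bounds R finset.set0 [::] gsE).
under [X in _ = _ * X]eq_soup do rewrite (level0_mass K finset.set0 [::] gsE).
rewrite /soup_mass -loop_int_avoids -soup_cst.
exact: (soup_split (avoids (gsupp gs)) _ (fun _ _ => 1)).
Qed.

Definition rebuilt (lys : seq (layer V)) R h : E0 :=
  soup (loop_intQ R) (fun c => fint (rebuild K lys c 0 lys) h).

Lemma level0_filter gs st B0 lys' c (gsE : unzip1 st = gs) :
  level0 K st B0 lys' c = level0 K st B0 lys' [seq l <- c | ~~ avoids (gsupp gs) l].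
Proof.
congr (flaw_map _ _); apply/funext => p; congr (flaw_map _ _); apply/funext => q.
apply: assigned_filter => l; exact: (address0_meets gsE).
Qed.

(** The loops avoiding the skeletons form a soup in B, which rebuilds the inner layers; the others
    are independent of them and supply the prepended lists D. *)
Lemma rebuilt_gfits R gs Y lys' h : gfits (gslots R finset.set0 gs) Y ->
  let B := (R :\: gsupp gs)%SET in
  rebuilt ((zip gs Y, B) :: lys') R h =
  rebuilt lys' B (fun zs => wint (plistQ del (gslots R finset.set0 gs)) (fun D =>
    h [seq insert_loops s | s <- zip gs (catN D (refillN B Y zs))])).
Proof.
move=> hY B; have sY : size Y = size gs by rewrite (gfits_size hY) size_gslots.
have gsE : unzip1 (zip gs Y) = gs by rewrite unzip1_zip ?sY.
pose S := gsupp gs.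
pose Z c1 zs := fint (level0 K (zip gs Y) B lys' c1) (fun added =>
  h [seq insert_loops (prepend_lists p.1 p.2) | p <- zip added (refill B (zip gs Y) zs)]).
pose F c2 c1 := fint (rebuild K lys' c2 0 lys') (Z c1).
transitivity (soup (loop_intQ R) (fun c =>
    F (seq.filter (avoids S) c) (seq.filter (predC (avoids S)) c))).
  apply: eq_soup => c; rewrite [rebuild _ _ _ _ _]/= fint_bind; last exact: nonnegf_rebuild.
  rewrite rebuild_shift /= strands_supp_zip //; apply: eq_fint => zs.
  rewrite fint_bind; last by apply: nonnegf_map => p; exact: nonnegf_assigned_strand.
  rewrite /Z -(level0_filter B lys' c gsE).
  by apply: eq_fint => added; rewrite fint_ret.
rewrite soup_split loop_int_avoids -/B; apply: eq_soup => c2.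
rewrite /F soup_fint; apply: eq_fint => zs; rewrite /Z.
rewrite (soup_level0 Q_ge0 lambda_bounds R B lys' gsE).
apply: eq_wint_on => D; rewrite plistN_gfits.
have [hD _|] := boolP (gfits _ D); last by rewrite !mul0r eqxx.
have sD : size D = size gs by rewrite (gfits_size hD) size_gslots.
rewrite refillE unzip1_zip ?unzip2_zip ?sY // prepend_zip //.
by rewrite -(size_map size) -/(shape _) shape_refillN size_map.
Qed.

Lemma wint_paths_nil R h : wint (paths_weight Q R [::]) h = h [::].
Proof.
rewrite /wint (isum_only (t0 := [::])); first by rewrite /paths_weight /= big_nil !mul1r.
by move=> [|w ws] //= _; rewrite /paths_weight /paths_in /= !mul0r.
Qed.

Lemma rebuilt_nil R h : rebuilt [::] R h = soup_mass R * h [::].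
Proof. by rewrite /rebuilt /= -soup_cst; apply: eq_soup => c; rewrite fint_ret. Qed.

Lemma paths_in_card R gs ab : paths_in R ab gs -> ab != [::] -> (#|R :\: gsupp gs| < #|R|)%N.
Proof.
case: ab gs => // o ab [|[|x g] gs]; rewrite /paths_in /= ?andbF //.
move=> /andP[_ /andP[/andP[xR _] _]] _.
apply: proper_card; apply/properP; split; first exact: finset.subsetDl.
by exists x => //; rewrite gsupp_cons !inE eqxx.
Qed.

(** The endpoints and the test function are arbitrary, as the induction is applied to the endpoints
    of the runs and to a function that puts the rebuilt runs back. *)
Lemma construct_rebuild n R ab f : (#|R| <= n)%N ->
  wint (paths_weight Q R ab) (fun ws =>
    fint (construct_rec lambda n R ws) (fun Om => rebuilt (layers_rec n R Om) R f)) =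
  soup_mass R * wint (paths_weight Q R ab) f.
Proof.
elim: n R ab f => [|n IH] R ab f hR.
  have [->|ab0] := eqVneq ab [::].
    rewrite !wint_paths_nil [construct_rec _ _ _ _]/= fint_ret -rebuilt_nil.
    apply: eq_soup => c /=; rewrite !fint_bind /= ?fint_ret //=; exact: nonnegf_ret.
  rewrite /wint !isum0 ?mulr0 // => ws; rewrite /paths_weight;
    have [/paths_in_card/(_ ab0)|_] := boolP (paths_in R ab ws); rewrite ?mul0r //;
    by rewrite ltnNge (leq_trans hR).
(* For the empty tuple the region does not shrink, so the induction hypothesis could not be applied
   to B. *)
have [->|ab0] := eqVneq ab [::].
  rewrite !wint_paths_nil.
  rewrite (@fint_construct _ _ _ lambda_bounds n R [::] [::]) // fint_ret fint_ret.
  rewrite -rebuilt_nil; apply: eq_soup => c /=.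
  by rewrite !fint_bind /= ?fint_ret //=; exact: nonnegf_ret.
rewrite !(wint_decompose R Q_ge0) -wintZ; apply: eq_wint_on => gs.
rewrite /skel_weight; case: (boolP (_ && _)) => [/andP[hg hp] _|]; last by rewrite mul0r eqxx.
set ss := gslots R finset.set0 gs.
pose B := (R :\: gsupp gs)%SET.
have hB : (#|B| <= n)%N by rewrite -ltnS; exact: leq_trans (paths_in_card hp ab0) hR.
(* Construction followed by recovery, both in B, as an operator of the kind treated by [resample];
   [H] then adds the lists D of the present layer. *)
pose KK zs h := fint (ext_construct lambda n B zs) (fun zs' => rebuilt (ext_layers n B zs') B h).
pose H Y := wint (plistQ del ss) (fun D => f [seq insert_loops s | s <- zip gs (catN D Y)]).
transitivity (wint (plistQ (fun=> 1) ss) (fun Y =>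
   fint (flaw_map (flaw_map (@thin_list K lambda _)) Y) (fun Ys =>
    fint (ext_construct lambda n B (segments B (zip gs Ys))) (fun zs =>
      rebuilt (layers_rec n.+1 R [seq insert_loops s | s <- refill B (zip gs Ys) zs]) R f)))).
  apply: eq_wint_on => Y; rewrite plistN_gfits.
  have [hY _|] := boolP (gfits _ Y); last by rewrite !mul0r eqxx.
  by rewrite fint_construct.
rewrite plistN_thin //.
transitivity (wint (plistQ del ss) (fun=> wint (plistQ ret ss) (fun Ys =>
    KK (segsN B Ys) (fun zs => H (refillN B Ys zs))))).
  apply: eq_wint => _; apply: eq_wint_on => Ys; rewrite plistN_gfits.
  have [hY _|] := boolP (gfits _ Ys); last by rewrite !mul0r eqxx.
  have sY : size Ys = size gs by rewrite (gfits_size hY) size_gslots.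
  rewrite segmentsE unzip2_zip ?sY // /KK.
  have pz := paths_in_segs B (flatten (flatten Ys)).
  apply: (eq_fint_on (supported_ext_construct lambda n pz)) => zs hzs.
  have [hz es] := paths_in_run erefl hzs.
  have hY' : gfits ss (refillN B Ys zs) by apply: gfits_refillN => //; exact: stable_gslots0.
  rewrite refillE unzip1_zip ?unzip2_zip ?sY // layers_gfits // rebuilt_gfits // -/B -/ss.
  rewrite segsN_refillN //; apply: eq_soup => c; apply: eq_fint => zs'.
  by rewrite /H; apply: eq_wint => D; rewrite refillN_refillN.
have hKK ab' h : wint (paths_weight Q B ab') (KK^~ h) = soup_mass B * wint (paths_weight Q B ab') h.
  have [->|ab'0] := eqVneq ab' [::].
    by rewrite !wint_paths_nil /KK fint_ret rebuilt_nil.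
  rewrite -(IH B ab' h hB); apply: eq_wint_on => zs.
  rewrite /paths_weight; have [hzs _|] := boolP (paths_in B ab' zs); last by rewrite mul0r eqxx.
  have nz us : paths_in B ab' us -> us != [::].
    by case: us => //; rewrite /paths_in /= andbT eq_sym (negPf ab'0).
  rewrite /KK (_ : ext_construct _ _ _ _ = construct_rec lambda n B zs).
    apply: (eq_fint_on (supported_construct lambda n hzs)) => us /nz.
    by case: us.
  by move: (nz _ hzs); case: (zs).
(* The lists deleted by the construction now enter only through their mass, which turns the mass of
   the soup in B into that in R; inside [H] the fresh D merges with the retained lists. *)
under eq_wint => D do rewrite (resample Q_ge0 ret (stable_gslots0 R gs) hKK).
rewrite wint_cst (soup_mass_split R gs) -/B -/ss.
have -> : wint (plistQ ret ss) H = wint (plistQ (fun=> 1) ss) (fun Y => f [seq insert_loops s | s <- zip gs Y]).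
  rewrite -(plistN_merge Q lambda_bounds) [RHS]wint_swap.
  by [].
by ring.
Qed.

End Recovery.

(** * From lists of points to multisets *)

Section SoupMultiset.
Variable K : realType.
Local Notation E0 := (ennreal K).

Lemma iint0 (E : choiceType) (w : E -> E0) m : iint w m (fun=> 0) = 0.
Proof. by elim: m => //= m IH; rewrite /wint isum0 // => x; rewrite IH mulr0. Qed.

Lemma iint_size (E : choiceType) (w : E -> E0) m n :
  iint w m (fun s => (size s == n)%:R) = (m == n)%:R * (wint w (fun=> 1)) ^+ m.
Proof.
elim: m n => [|m IH] [|n] /=; rewrite ?expr0 ?mulr1 ?eqxx //.
  by rewrite mul0r /wint isum0 // => x; rewrite iint0 mulr0.
under eq_wint do under eq_iint do rewrite eqSS.
rewrite IH eqSS exprS; set c := _%:R * _.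
by have := wintZ w (fun=> 1) c; under eq_wint do rewrite mulr1; move=> ->; rewrite /c; ring.
Qed.

(** By [soup_split] the points equal to x are independent of the others, and only lists of exactly n
    x such points contribute. *)
Lemma soup_counts (E : choiceType) (w : E -> E0) (u : seq E) (n : E -> nat) : uniq u ->
  soup w (fun s => (all (mem u) s && all (fun x => count_mem x s == n x) u)%:R) =
  \prod_(x <- u) (w x ^+ n x * en (n x)`!%:R^-1).
Proof.
elim: u w => [|x u IH] w /=.
  move=> _; rewrite big_nil /soup (isum_only (t0 := 0%N)) /=; first by rewrite invr1 en1 mulr1.
  move=> [|m] //= _; rewrite /wint isum0 ?mulr0 // => x.
  by rewrite iint0 mulr0.
move=> /andP[xu uu]; rewrite big_cons.
pose F (s1 s2 : seq E) : E0 := (size s1 == n x)%:R *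
  (all (mem u) s2 && all (fun y => count_mem y s2 == n y) u)%:R.
transitivity (soup w (fun s => F (seq.filter (pred1 x) s) (seq.filter (predC (pred1 x)) s))).
  apply: eq_soup => s; rewrite /F size_filter -natrM mulnb; congr (nat_of_bool _)%:R.
  rewrite andbCA; congr (_ && (_ && _)).
    by elim: s => //= y s ->; rewrite inE; case: eqP.
  apply: eq_in_all => y yu; rewrite count_filter; congr (_ == _); apply: eq_count => z /=.
  by case: (eqVneq z y) => [->|//]; rewrite /= -/(_ != _); case: eqP => // e; rewrite -e yu in xu.
rewrite soup_split /F.
under eq_soup => s1 do rewrite soupZ IH //.
under eq_soup => s1 do rewrite mulrC.
rewrite soupZ mulrC; congr (_ * _); last first.
  apply: eq_big_seq => y yu; rewrite /restrict /=; case: eqP => [e|_]; last by rewrite mul1r.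
  by rewrite -e yu in xu.
rewrite /soup (isum_only (t0 := n x)) => [|m mn]; rewrite iint_size ?eqxx.
  rewrite mul1r mulrC; congr (_ ^+ _ * _); rewrite /wint (isum_only (t0 := x)).
    by rewrite /restrict /= eqxx mul1r mulr1.
  by move=> y yx; rewrite /restrict /= (negPf yx) !mul0r.
by rewrite (negPf mn) mul0r mulr0.
Qed.

(** A product of Poisson weights without their exponential factors. *)
Definition mset_weight (E : choiceType) (w : E -> E0) (c : {mset E}%mset) : E0 :=
  \prod_(x <- undup (enum_mset c)) (w x ^+ c x * en (c x)`!%:R^-1).

Lemma soup_mset (E : choiceType) (w : E -> E0) (phi : seq E -> E0) :
  (forall s t, perm_eq s t -> phi s = phi t) ->
  soup w phi = isum (fun c : {mset E}%mset => mset_weight w c * phi (enum_mset c)).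
Proof.
move=> hphi.
transitivity (soup w (fun s => isum (fun c : {mset E}%mset =>
    phi (enum_mset c) * (all (mem (undup (enum_mset c))) s &&
      all (fun x => count_mem x s == c x) (undup (enum_mset c)))%:R))).
  apply: eq_soup => s; rewrite (isum_only (t0 := seq_mset s)).
    rewrite (hphi _ s (perm_eq_seq_mset s)).
    rewrite (_ : _ && _) ?mulr1 //; apply/andP; split; apply/allP => x xs.
      by rewrite /= mem_undup (perm_mem (perm_eq_seq_mset s)).
    by rewrite mset_seqE.
  move=> c cs; rewrite (_ : _ && _ = false) ?mulr0 //; apply/negP => /andP[/allP h1 /allP h2].
  case/eqP: cs; apply/msetP => x; rewrite mset_seqE.
  have [xc|xc] := boolP (x \in undup (enum_mset c)); first by rewrite (eqP (h2 x xc)).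
  rewrite (count_memPn (_ : x \notin s)); last by apply: contra xc => /h1.
  by rewrite -count_mem_mset; apply/count_memPn; rewrite -mem_undup.
rewrite /soup; under eq_isum => m do rewrite iint_isum mulr_isumr.
rewrite isum_swap; apply: eq_isum => c.
rewrite mulrC /mset_weight -(soup_counts w c (undup_uniq _)) -soupZ /soup.
by [].
Qed.

Lemma fint_flaw_map_cat (A F : Type) (k : A -> flaw K F) s1 s2 (H : seq F -> E0) :
  (forall x, nonnegf (k x)) ->
  fint (flaw_map k (s1 ++ s2)) H =
  fint (flaw_map k s1) (fun y1 => fint (flaw_map k s2) (fun y2 => H (y1 ++ y2))).
Proof.
move=> hk; elim: s1 H => [|x s1 IH] H; first by rewrite fint_ret.
rewrite cat_cons !fint_map_cons //; apply: eq_fint => y.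
exact: (IH (fun ys => H (y :: ys))).
Qed.

Lemma fint_flaw_map_perm (A : eqType) (F : eqType) (k : A -> flaw K F) s t (H : seq F -> E0) :
  (forall x, nonnegf (k x)) -> (forall y y', perm_eq y y' -> H y = H y') ->
  perm_eq s t -> fint (flaw_map k s) H = fint (flaw_map k t) H.
Proof.
move=> hk; elim: s t H => [|x s IH] t H hH.
  by rewrite perm_sym => /perm_nilP ->.
move=> hst; have xt : x \in t by rewrite -(perm_mem hst) mem_head.
have [t1 [t2 [et _ _ _]]] : exists t1 t2, [/\ t = t1 ++ x :: t2, True, True & True].
  by case/splitPr: xt => t1 t2; exists t1, t2.
have hs : perm_eq s (t1 ++ t2).
  by rewrite -(perm_cons x) (perm_trans hst) // et -cat1s perm_catCA.
rewrite et fint_flaw_map_cat // fint_map_cons //.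
under [RHS]eq_fint => y1 do rewrite fint_map_cons //.
rewrite [RHS]fint_swap; apply: eq_fint => y.
rewrite (IH (t1 ++ t2)) // => [|z z' hz]; last by apply: hH; rewrite perm_cons.
rewrite fint_flaw_map_cat //; apply: eq_fint => y1; apply: eq_fint => y2.
by apply: hH; rewrite -(cat1s y y2) -(cat1s y) perm_catCA.
Qed.

(** The permutation from s to t is absorbed by a translation in the symmetric group. *)
Lemma big_arrangements_perm (E : eqType) (s t : seq E) (g : seq E -> E0) : perm_eq s t ->
  \sum_(x <- arrangements s) g x = \sum_(x <- arrangements t) g x.
Proof.
move=> hst; have st := perm_size hst.
rewrite (big_arrangements (erefl (size t)) (t := in_tuple t)) //.
rewrite (big_arrangements st (t := tcast st (in_tuple s))) ?val_tcast //.
have /tuple_permP[sg es] : perm_eq (tcast st (in_tuple s)) (in_tuple t) by rewrite val_tcast.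
rewrite [RHS](reindex_inj (mulIg sg)) /=; apply: eq_bigr => p _; congr g; apply: eq_map => i.
have -> : tcast st (in_tuple s) = [tuple tnth (in_tuple t) (sg i) | i < size t] by exact: val_inj.
by rewrite tnth_mktuple permM.
Qed.

Variable V : finType.

Lemma fint_assigned_perm lys n i t u c c' (g : seq (seq V) -> E0) : perm_eq c c' ->
  fint (assigned K lys c n i t u) g = fint (assigned K lys c' n i t u) g.
Proof.
move=> hc; rewrite /assigned !fint_bind; try by apply: nonnegf_map => l; exact: nonnegf_uniform.
apply: fint_flaw_map_perm; last exact: perm_filter.
- by move=> l; exact: nonnegf_uniform.
- move=> r r' hr; rewrite !fint_bind ?nonnegf_uniform // !fint_uniform.
  by rewrite !size_arrangements (perm_size hr) (big_arrangements_perm _ hr).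
Qed.

Lemma eq_fint_flaw_map (A F : Type) (k k' : A -> flaw K F) s (H : seq F -> E0) :
  (forall x, nonnegf (k x)) -> (forall x, nonnegf (k' x)) ->
  (forall x h, fint (k x) h = fint (k' x) h) ->
  fint (flaw_map k s) H = fint (flaw_map k' s) H.
Proof.
move=> hk hk' h; elim: s H => // x s IH H; rewrite !fint_map_cons // h.
by apply: eq_fint => y; exact: IH.
Qed.

(** The order in which [enum_mset] lists the soup is lost when the independently rooted loops are
    permuted uniformly; [soup_mset] requires this symmetry. *)
Lemma fint_rebuild_perm lys c c' n rest (g : seq (seq V) -> E0) : perm_eq c c' ->
  fint (rebuild K lys c n rest) g = fint (rebuild K lys c' n rest) g.
Proof.
move=> hc; elim: rest n g => // -[st B] rest IH n g /=.
rewrite !fint_bind ?nonnegf_rebuild // IH; apply: eq_fint => zs.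
rewrite !fint_bind; try by apply: nonnegf_map => p; exact: nonnegf_assigned_strand.
apply: eq_fint_flaw_map => [p|p|p h]; try exact: nonnegf_assigned_strand.
rewrite /assigned_strand; apply: eq_fint_flaw_map => [q|q|q h']; try exact: nonnegf_assigned.
exact: fint_assigned_perm.
Qed.

End SoupMultiset.

(** * Probability *)

Section Probability.
Context (K : realType) (d : measure_display) (T : measurableType d) (P : probability T K).
Local Open Scope classical_set_scope.
Local Notation E0 := (ennreal K).

Definition pr (B : set T) : E0 := Ennreal (measure_ge0 P B).

Lemma pr_setT : pr setT = 1.
Proof. by apply: ev_inj; rewrite /= probability_setT. Qed.

(** Total probability over the values of X; [nu] arranges them in a sequence, so that
    sigma-additivity applies. *)
Lemma pr_countable (E : choiceType) (nu : E -> nat) (X : T -> E) (B : set T) : injective nu ->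
  (forall x, measurable (B `&` X @^-1` [set x])) ->
  pr B = isum (fun x => pr (B `&` X @^-1` [set x])).
Proof.
move=> nu_inj mB; pose F n := B `&` [set t | nu (X t) = n].
have FE x : F (nu x) = B `&` X @^-1` [set x].
  by rewrite /F; congr (_ `&` _); apply/seteqP; split => t /= => [/nu_inj|->].
have F0 n : ~ range nu n -> F n = set0.
  by move=> h; rewrite -subset0 => t [_ /= e]; apply: h; exists (X t).
have mF n : measurable (F n).
  by have [[x _ <-]|/F0 ->] := pselect (range nu n); rewrite ?FE.
have BE : B = \bigcup_(n in setT) F n.
  by apply/seteqP; split => [t Bt|t [n _ []//]]; exists (nu (X t)).
transitivity (isum (fun n => pr (F n))).
  apply: ev_inj; rewrite /= {1}BE measure_bigcup //.
    rewrite nneseries_esum => [|n _]; last exact: measure_ge0.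
    by congr esum; apply/seteqP; split => n //= _; rewrite in_setT.
  by move=> i j _ _ [t [[_ /= <-] [_ /= <-]]].
apply: (@isum_bij _ _ _ (range nu) setT nu) => //.
- split => [x _|x y _ _ /nu_inj //|n [x _ <-]]; [by exists x|by exists x].
- by move=> n /F0 ->; apply: ev_inj; rewrite /= measure0.
- by move=> x [].
- by move=> x _; rewrite FE.
Qed.

Lemma flaw_mass_fint (F : eqType) (mu : flaw K F) x : nonnegf mu ->
  (flaw_mass mu x)%:E = ev (fint mu (fun y => (y == x)%:R)).
Proof.
move=> h; rewrite /flaw_mass /fint -ev_en; last first.
  by rewrite big_seq_cond; apply: sumr_ge0 => p /andP[/(allP h)].
congr ev; elim: mu h => [|p mu IH] /=; first by rewrite !big_nil en0.
move=> /andP[p0 hmu]; rewrite !big_cons -IH //.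
case: (p.2 == x); rewrite ?mulr0 ?add0r // mulr1 enD //.
by rewrite big_seq_cond; apply: sumr_ge0 => q /andP[/(allP hmu)].
Qed.

Lemma pr_output (E : Type) (F : choiceType) (kernel : E -> flaw K F) (Y : T -> E) (X : T -> F) y x :
  output_of P kernel Y X -> nonnegf (kernel y) ->
  pr (X @^-1` [set x] `&` Y @^-1` [set y]) =
  pr (Y @^-1` [set y]) * fint (kernel y) (fun z => (z == x)%:R).
Proof.
move=> h hk; apply: ev_inj; rewrite evM /= setIC h; congr (_ * _)%E.
exact: flaw_mass_fint.
Qed.

(** * Probabilities of the values of the loop soup *)

Section LoopSoup.
Variables (V : finType) (Q : V -> V -> K) (R : {set V}) (lambda : K).
Hypothesis Q_ge0 : forall x y, 0 <= Q x y.
Hypothesis l0 : 0 <= lambda.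

(** Relative to the mass at 0 the exponential factor cancels. The case m = 0 is separate, since
    [poisson_prob] is then a Dirac mass. *)
Lemma poisson_prob1 (m : K) n : 0 <= m ->
  poisson_prob m 0%N [set n] = ((m ^+ n / n`!%:R)%:E * poisson_prob m 0%N [set 0%N])%E.
Proof.
move=> m0; rewrite /poisson_prob; case: ifPn => mp.
  rewrite !esum_set1 ?lee_fin ?poisson_pmf_ge0 // -EFinM /poisson_pmf mp; congr EFin.
  by rewrite expr0 fact0 invr1 !mul1r.
have -> : m = 0 by apply/eqP; rewrite eq_le m0 leNgt mp.
rewrite !diracE; case: n => [|n]; rewrite ?expr0 ?fact0 ?divr1 ?mul1e //.
by rewrite exprS !mul0r mul0e memNset.
Qed.

Lemma rooted_loop_mass_ge0 s : 0 <= rooted_loop_mass Q R s.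
Proof.
have [->|s0] := eqVneq s [::] => //.
by rewrite rooted_loop_massE // !mulr_ge0 ?ler0n ?loop_weight_ge0 ?invr_ge0.
Qed.

Lemma finite_class (l : loop V) : finite_set [set s : seq V | [set l] (\pi_(loop V) s)].
Proof.
apply: (sub_finite_set (B := [set` [seq rot k (repr l) | k <- iota 0 (size (repr l)).+1]])).
  move=> s /= e; have h : repr l = s %[mod loop V] by rewrite reprK.
  have /existsP[[k hk] /eqP <-] := introT (eqmodP (cyclic_shift_equiv V) _ _) h.
  apply: (@map_f _ _ (fun j => rot j (repr l)) (iota 0 (size (repr l)).+1) k).
  by rewrite mem_iota.
exact: finite_seq.
Qed.

(** A class contains finitely many rooted loops, so its intensity is a real number, as the Poisson
    clause of [loop_soup] demands. *)
Lemma loop_intensity1 (l : loop V) :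
  exists m : K, [/\ 0 <= m, loop_intensity Q R lambda [set l] = m%:E & loop_int Q lambda R l = en m].
Proof.
have e1 : loop_intensity Q R lambda [set l] = ev (loop_int Q lambda R l).
  have -> : loop_int Q lambda R l = en lambda *
      isum (fun s => (\pi_(loop V) s == l)%:R * en (rooted_loop_mass Q R s)).
    by rewrite mulr_isumr; apply: eq_isum => s; rewrite enM //; ring.
  rewrite evM ev_en // /loop_intensity; congr (_ * _)%E.
  rewrite esum_mkcond; apply: eq_esum => s _.
  case: ifPn => [/set_mem /= ->|].
    by rewrite eqxx mul1e max_l ?rooted_loop_mass_ge0.
  rewrite notin_setE => h; have /negPf -> : \pi_(loop V) s != l by apply/eqP => e; exact: h.
  by rewrite /= mul0e.
have fin : (loop_intensity Q R lambda [set l] \is a fin_num)%E.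
  rewrite /loop_intensity esum_fset; last 2 first.
  - exact: finite_class.
  - by move=> s _; rewrite lee_fin rooted_loop_mass_ge0.
  rewrite fin_numM // fsbig_finite ?sumEFin //; exact: finite_class.
have m0 : 0 <= fine (loop_intensity Q R lambda [set l]) by rewrite fine_ge0 // e1 ev_ge0.
exists (fine (loop_intensity Q R lambda [set l])); split; rewrite ?fineK //.
by apply: ev_inj; rewrite ev_en // fineK.
Qed.

Variable (L : T -> {mset loop V}%mset).
Hypothesis L_soup : loop_soup P Q R lambda L.

(** For u without repetitions, these are the singletons of u and a last cell for all other loops,
    where [index] equals [size u]. *)
Definition cell (u : seq (loop V)) (i : 'I_(size u).+1) : set (loop V) := [set l | index l u = i].

Lemma cell_ord_max u : cell (u := u) ord_max = [set l | l \notin u].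
Proof.
apply/seteqP; split => l; rewrite /cell /= -index_mem -leqNgt => h; first by rewrite h leqnn.
by apply/eqP; rewrite eqn_leq index_size h.
Qed.

Lemma cell_lift u (l0' : loop V) (i : 'I_(size u)) : uniq u ->
  cell (u := u) (widen_ord (leqnSn _) i) = [set nth l0' u i].
Proof.
move=> uu; apply/seteqP; split => l; rewrite /cell /= => e; last by rewrite e index_uniq.
by rewrite -e nth_index // -index_mem e.
Qed.

Lemma loop_count1 (l : loop V) (c : {mset loop V}%mset) : loop_count [set l] c = c l.
Proof.
rewrite -count_mem_mset /loop_count; apply: eq_count => x /=.
by apply/idP/eqP => [/set_mem//|->]; rewrite inE.
Qed.

(** A multiset contained in u is determined by its counts in the cells, the last one being 0. *)
Lemma pr_soup_cells (u : seq (loop V)) (c : {mset loop V}%mset) : uniq u ->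
  {subset enum_mset c <= u} ->
  pr (L @^-1` [set c]) = \prod_(i < (size u).+1)
    pr ((loop_count (cell i) \o L) @^-1` [set loop_count (cell i) c]).
Proof.
move=> uu cu; apply: ev_inj; rewrite ev_prod /=.
have tA : trivIset [set: 'I_(size u).+1] (@cell u).
  by move=> i j _ _ [l [ei ej]]; rewrite /cell /= in ei ej; apply: val_inj; rewrite /= -ei -ej.
rewrite -(L_soup.2 _ _ tA); congr (P _); apply/seteqP; split => t /= h; first by move=> i _; rewrite /= h.
apply/msetP => l; have [lu|lu] := boolP (l \in u).
  have hi : (index l u < size u)%N by rewrite index_mem.
  have := h (widen_ord (leqnSn _) (Ordinal hi)) I.
  by rewrite /= (cell_lift l) // nth_index // !loop_count1.
have c0 : c l = 0%N by apply/eqP; rewrite mset_eq0; apply: contra lu => /cu.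
have := h ord_max I; rewrite /= cell_ord_max.
have -> : loop_count [set l | l \notin u] c = 0%N.
  apply/eqP; rewrite -leqn0 leqNgt -has_count; apply/hasP => -[x /cu xu /set_mem /=].
  by rewrite xu.
rewrite c0 => /eqP; rewrite -leqn0 leqNgt -has_count => /hasPn hL.
apply/eqP; rewrite mset_eq0; apply/negP => /hL; apply/negP; rewrite negbK.
by rewrite inE.
Qed.

(** The last cell is empty both for c and for the empty multiset, so its probability is a common
    factor; on the singletons the ratio is given by [poisson_prob1]. *)
Lemma pr_soup (c : {mset loop V}%mset) :
  pr (L @^-1` [set c]) =
  pr (L @^-1` [set mset0]) * mset_weight (loop_int Q lambda R) c.
Proof.
have uu := undup_uniq (enum_mset c); set u := undup _ in uu.
have cu : {subset enum_mset c <= u} by move=> x; rewrite mem_undup.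
rewrite (pr_soup_cells uu cu) (@pr_soup_cells u mset0) //; last by move=> x; rewrite enum_mset0.
rewrite !big_ord_recr /= cell_ord_max.
have n0 c' : {subset enum_mset c' <= u} -> loop_count [set l | l \notin u] c' = 0%N.
  move=> hc; apply/eqP; rewrite -leqn0 leqNgt -has_count; apply/hasP => -[x /hc xu /set_mem /=].
  by rewrite xu.
rewrite !n0 //; last by move=> x; rewrite enum_mset0.
rewrite mulrAC; congr (_ * _).
rewrite /mset_weight -/u.
pose x0 := \pi_(loop V) ([::] : seq V).
rewrite (big_nth x0) big_mkord -big_split; apply: eq_bigr => i _ /=.
rewrite (cell_lift x0) // !loop_count1 mset0E.
have [m [m0 em ew]] := loop_intensity1 (nth x0 u i).
have hP n : pr ((loop_count [set nth x0 u i] \o L) @^-1` [set n]) =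
    en (m ^+ n / n`!%:R) * pr ((loop_count [set nth x0 u i] \o L) @^-1` [set 0%N]).
  apply: ev_inj; rewrite evM ev_en; last by rewrite divr_ge0 ?exprn_ge0 ?ler0n.
  by rewrite /= !(L_soup.1 _ _ em) poisson_prob1.
rewrite hP mulrC ew (enM _ (exprn_ge0 _ m0)); congr (_ * (_ * _)).
by elim: (c _) => [|n IH]; rewrite ?expr0 ?en1 // !exprS enM // IH.
Qed.

End LoopSoup.

End Probability.

(** * The joint law of the recovered paths *)

Section Law.
Context (K : realType) (d : measure_display) (T : measurableType d) (P : probability T K).
Local Open Scope classical_set_scope.
Local Notation E0 := (ennreal K).
Local Notation pr := (pr P).

Lemma pr_set0 : pr set0 = 0.
Proof. by apply: ev_inj; rewrite /= measure0. Qed.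

Lemma prod_natb (I : finType) (B : pred I) : \prod_(i : I) (B i)%:R = [forall i, B i]%:R :> E0.
Proof.
have [/forallP h|/forallPn[i /negPf hi]] := boolP [forall i, B i].
  by rewrite big1 // => i _; rewrite h.
by rewrite (bigD1 i) //= hi mul0r.
Qed.

Variables (V : finType) (Q : V -> V -> K) (R : {set V}) (r : nat) (a b : 'I_r -> V) (lambda : K).
Hypothesis Q_ge0 : forall x y, 0 <= Q x y.
Hypothesis green_gt0 : forall i, 0 < green Q R (a i) (b i).
Hypothesis lambda_bounds : 0 <= lambda <= 1.
Variables (omega : 'I_r -> T -> seq V) (Omega0 : T -> seq (seq V)).
Variables (L : T -> {mset loop V}%mset) (out : T -> seq (seq V)).
Hypothesis omega_rv : forall i : 'I_r, discrete_rv (omega i).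
Hypotheses (Omega0_rv : discrete_rv Omega0) (L_rv : discrete_rv L) (out_rv : discrete_rv out).
Hypothesis omega_walk : forall i : 'I_r, normalized_walk P Q R (a i) (b i) (omega i).
Hypothesis omega_independent : mutually_independent P omega.
Let W t := [seq omega i t | i <- enum 'I_r].
Hypothesis Omega0_output : output_of P (construct lambda R) W Omega0.
Hypothesis L_soup : loop_soup P Q R lambda L.
Hypothesis L_independent : independent_pair P (fun t => (W t, Omega0 t)) L.
Hypothesis out_output :
  output_of P (fun y => recover K R y.1 y.2) (fun t => (Omega0 t, L t)) out.

Let ab := [seq Some (a i, b i) | i <- enum 'I_r].
Let C : E0 := \prod_i en (green Q R (a i) (b i))^-1.

Lemma walks_preimage (u : r.-tuple (seq V)) :
  W @^-1` [set val u] = \bigcap_(i in [set: 'I_r]) (omega i @^-1` [set tnth u i]).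
Proof.
rewrite -[val u](map_tnth_enum u); apply/seteqP; split => t /= h.
  by move=> i _ /=; move/eq_in_map: h; apply; rewrite mem_enum.
by apply/eq_in_map => i _; exact: h.
Qed.

Lemma walks_rv : discrete_rv W.
Proof.
move=> ws; have [e|ne] := eqVneq (size ws) r.
  rewrite (walks_preimage (Tuple (introT eqP e))); apply: fin_bigcap_measurable => // i _.
  exact: omega_rv.
rewrite (_ : _ @^-1` _ = set0) // -subset0 => t /= e.
by case/eqP: ne; rewrite -e size_map size_enum_ord.
Qed.

Lemma pr_walk i s : pr (omega i @^-1` [set s]) =
  en (green Q R (a i) (b i))^-1 * ((is_path_in R (a i) (b i) s)%:R * pwE Q s).
Proof.
have q0 : 0 <= path_weight Q s by exact: path_weight_ge0.
apply: ev_inj; rewrite /= omega_walk; case: ifP => _; last by rewrite !mul0e mule0.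
rewrite mul1e !max_l ?invr_ge0 ?(ltW (green_gt0 _)) // -EFinM.
by rewrite mulrC.
Qed.

Lemma pr_walks ws : pr (W @^-1` [set ws]) = C * paths_weight Q R ab ws.
Proof.
have [e|ne] := eqVneq (size ws) r; last first.
  rewrite (_ : W @^-1` _ = set0) ?pr_set0; last first.
    by rewrite -subset0 => t /= e; case/eqP: ne; rewrite -e size_map size_enum_ord.
  rewrite /paths_weight (_ : paths_in _ _ _ = false) ?mul0r ?mulr0 //.
  apply/negP => /andP[/eqP/(congr1 size)]; rewrite /ab !size_map -enumT size_enum_ord => e _.
  by rewrite e eqxx in ne.
pose u := Tuple (introT eqP e).
rewrite -[ws]/(val u) walks_preimage.
transitivity (\prod_i pr (omega i @^-1` [set tnth u i])).
  by apply: ev_inj; rewrite ev_prod /= omega_independent.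
under eq_bigr do rewrite pr_walk; rewrite !big_split /= -/C prod_natb /paths_weight.
congr (_ * (_%:R * _)); last by rewrite (big_tuple _ _ u).
congr nat_of_bool; rewrite /paths_in -[ws](map_tnth_enum u) -map_comp.
apply/forallP/andP => [h|[/eqP/eq_in_map h1 h2] i].
  split; first apply/eqP/eq_in_map => i _ /=.
    by have := h i; case: (tnth u i) => //= x p /and3P[/eqP-> /eqP ->].
  by rewrite all_map; apply/allP => i _ /=; have := h i; case: (tnth u i) => //= x p /and3P[].
have /= := h1 i; rewrite mem_enum => /(_ isT).
have := allP h2 (tnth u i); rewrite (map_tnth_enum u) mem_tnth => /(_ isT) /=.
by case: (tnth u i) => //= x p hR [<- <-]; rewrite !eqxx.
Qed.

Lemma pr_setI_preimage (E : choiceType) (X : T -> E) (A : set E) x :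
  pr (X @^-1` A `&` X @^-1` [set x]) = (x \in A)%:R * pr (X @^-1` [set x]).
Proof.
case: (boolP (x \in A)) => hx; rewrite ?mul1r ?mul0r.
  by congr pr; apply/seteqP; split => t /=; [case|move=> e; split => //; rewrite e; exact/set_mem].
rewrite (_ : _ `&` _ = set0) ?pr_set0 // -subset0 => t /= [h e].
by case/negP: hx; apply/mem_set; rewrite -e.
Qed.

(** A law on a countable set is determined by its atoms. *)
Lemma eq_law (E : countType) (X Y : T -> E) : discrete_rv X -> discrete_rv Y ->
  (forall x, pr (X @^-1` [set x]) = pr (Y @^-1` [set x])) ->
  forall A, P (X @^-1` A) = P (Y @^-1` A).
Proof.
move=> mX mY h A; apply: (congr1 (@ev K) (x := pr _) (y := pr _)).
have hm (Z : T -> E) : discrete_rv Z -> forall x, measurable (Z @^-1` A `&` Z @^-1` [set x]).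
  move=> mZ x; case: (boolP (x \in A)) => hx.
    rewrite (_ : _ `&` _ = Z @^-1` [set x]) //.
    by apply/seteqP; split => t /=; [case|move=> e; split => //; rewrite e; exact/set_mem].
  rewrite (_ : _ `&` _ = set0) // -subset0 => t /= [hA e].
  by case/negP: hx; apply/mem_set; rewrite -e.
rewrite (pr_countable P (pcan_inj (@choice.pickleK E)) (hm _ mX)).
rewrite (pr_countable P (pcan_inj (@choice.pickleK E)) (hm _ mY)).
by apply: eq_isum => x; rewrite !pr_setI_preimage h.
Qed.

(** Codes multisets of loops in a countable type, for the injection that [pr_countable] asks for. *)
Definition mset_code (c : {mset loop V}%mset) : seq (seq V) := [seq repr l | l <- enum_mset c].

Lemma mset_code_inj : injective mset_code.
Proof.
move=> c c' /(inj_map (can_inj (@reprK _ (loop V)))) e.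
by rewrite -[c]seq_mset_id -[c']seq_mset_id e.
Qed.

Lemma pr_construct Om : pr (Omega0 @^-1` [set Om]) =
  C * wint (paths_weight Q R ab) (fun ws => fint (construct lambda R ws) (fun x => (x == Om)%:R)).
Proof.
rewrite (pr_countable P (pcan_inj (@choice.pickleK (seq (seq V)))) (X := W)).
  rewrite /wint mulr_isumr; apply: eq_isum => ws.
  rewrite (pr_output _ Omega0_output) ?pr_walks ?mulrA //.
  exact: nonnegf_construct.
by move=> ws; apply: measurableI; [exact: Omega0_rv|exact: walks_rv].
Qed.

Lemma preimage_pair (E F : Type) (X : T -> E) (Y : T -> F) x y :
  (fun t => (X t, Y t)) @^-1` [set (x, y)] = X @^-1` [set x] `&` Y @^-1` [set y].
Proof. by apply/seteqP; split => t /= [-> ->]. Qed.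

Lemma pr_joint Om c : pr ((fun t => (Omega0 t, L t)) @^-1` [set (Om, c)]) =
  pr (Omega0 @^-1` [set Om]) * pr (L @^-1` [set c]).
Proof.
rewrite preimage_pair; apply: ev_inj; rewrite evM /=.
exact: (L_independent [set p | p.2 = Om] [set c]).
Qed.

Lemma fint_indic (E : choiceType) (mu : flaw K E) (g : E -> E0) :
  isum (fun x => fint mu (fun z => (z == x)%:R) * g x) = fint mu g.
Proof.
rewrite /fint; under eq_isum do rewrite mulr_suml; rewrite isum_sum; apply: eq_bigr => p _.
rewrite (isum_only (t0 := p.2)) ?eqxx ?mulr1 // => x.
by rewrite eq_sym => /negPf ->; rewrite mulr0 mul0r.
Qed.

Let l0 : 0 <= lambda. Proof. by case/andP: lambda_bounds. Qed.

(** The probabilities given by [pr_soup] sum to 1; in particular the mass of the soup is finite. *)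
Lemma pr_no_loop : pr (L @^-1` [set mset0]) * soup_mass Q lambda R = 1.
Proof.
rewrite /soup_mass soup_mset // mulr_isumr.
have nu_inj : injective (choice.pickle \o mset_code) by apply: inj_comp mset_code_inj; exact: pcan_inj choice.pickleK.
rewrite -[RHS](pr_setT P) (pr_countable (B := setT) P nu_inj (X := L)) => [|c]; last by rewrite setTI.
by apply: eq_isum => c; rewrite setTI (pr_soup Q_ge0 l0 L_soup c) mulr1.
Qed.

Lemma pr_recover x : pr (out @^-1` [set x]) = pr (W @^-1` [set x]).
Proof.
pose nu (y : seq (seq V) * {mset loop V}%mset) := choice.pickle (y.1, mset_code y.2).
have nu_inj : injective nu.
  by move=> [y c] [y' c'] /(pcan_inj choice.pickleK) [-> /mset_code_inj ->].
rewrite (pr_countable P nu_inj (X := fun t => (Omega0 t, L t))); last first.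
  by move=> [Om c]; rewrite preimage_pair; apply: measurableI => //; exact: measurableI.
pose f z : E0 := (z == x)%:R.
pose p0 := pr (L @^-1` [set mset0]).
pose G Om := rebuilt Q lambda (layers R Om) R f.
(* The sum runs over the values of the output and of the independent soup; summing over the soup
   first produces [rebuilt]. *)
transitivity (isum (fun Om => pr (Omega0 @^-1` [set Om]) * (p0 * G Om))).
  transitivity (isum (fun Om => isum (fun c =>
      pr (out @^-1` [set x] `&` (fun t => (Omega0 t, L t)) @^-1` [set (Om, c)])))).
    by rewrite isum_pair; apply: eq_isum => -[].
  apply: eq_isum => Om.
  rewrite /G /rebuilt soup_mset; last by move=> s t; exact: fint_rebuild_perm.
  rewrite !mulr_isumr; apply: eq_isum => c.
  rewrite (pr_output _ out_output) ?pr_joint; last exact: nonnegf_rebuild.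
  by rewrite (pr_soup Q_ge0 l0 L_soup) -!mulrA.
transitivity (C * p0 * wint (paths_weight Q R ab) (fun ws => fint (construct lambda R ws) G)).
  rewrite /wint mulr_isumr.
  under [RHS]eq_isum => ws do rewrite -fint_indic mulr_isumr mulr_isumr.
  rewrite isum_swap; apply: eq_isum => Om; rewrite pr_construct /wint mulr_isumr mulr_isuml.
  by apply: eq_isum => ws; rewrite /f; ring.
(* The factor [soup_mass] obtained here cancels against the probability [p0] of the empty soup. *)
rewrite /G /layers /construct (construct_rebuild Q_ge0 lambda_bounds) //.
rewrite mulrA -[C * p0 * _]mulrA pr_no_loop mulr1 pr_walks; congr (_ * _).
by rewrite /wint (isum_only (t0 := x)) /f ?eqxx ?mulr1 // => z /negPf ->; rewrite mulr0.
Qed.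

End Law.

Local Open Scope classical_set_scope.
Local Open Scope ring_scope.

Theorem proposition2p8 (K : realType) (V : finType) (Q : V -> V -> K)
    (Q_ge0 : forall x y : V, 0 <= Q x y)
    (Q_substochastic : forall x : V, \sum_(y : V) Q x y <= 1)
    (Q_radius : spectral_radius_lt1 (principal Q [set: V]%SET))
    (R : {set V}) (r : nat) (a b : 'I_r -> V)
    (green_gt0 : forall i : 'I_r, 0 < green Q R (a i) (b i))
    (lambda : K) (lambda_bounds : 0 <= lambda <= 1)
    (d : measure_display) (T : measurableType d) (P : probability T K)
    (omega : 'I_r -> T -> seq V) (Omega0 : T -> seq (seq V))
    (L : T -> {mset loop V}%mset) (out : T -> seq (seq V))
    (omega_rv : forall i : 'I_r, discrete_rv (omega i))
    (Omega0_rv : discrete_rv Omega0) (L_rv : discrete_rv L) (out_rv : discrete_rv out)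
    (omega_walk : forall i : 'I_r, normalized_walk P Q R (a i) (b i) (omega i))
    (omega_independent : mutually_independent P omega)
    (Omega0_output : output_of P (construct lambda R)
       (fun t => [seq omega i t | i <- enum 'I_r]) Omega0)
    (L_soup : loop_soup P Q R lambda L)
    (L_independent : independent_pair P
       (fun t => ([seq omega i t | i <- enum 'I_r], Omega0 t)) L)
    (out_output : output_of P (fun y => recover K R y.1 y.2)
       (fun t => (Omega0 t, L t)) out) :
  forall A : set (seq (seq V)),
    P (out @^-1` A) = P ((fun t => [seq omega i t | i <- enum 'I_r]) @^-1` A).
Proof.
apply: eq_law => [//||x]; first exact: walks_rv omega_rv.
exact: (pr_recover Q_ge0 green_gt0 lambda_bounds omega_rv Omega0_rv L_rv out_rv omega_walk
  omega_independent Omega0_output L_soup L_independent out_output).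
Qed.
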